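(* Let $d\ge2$, $\alpha>1$, $\beta=\frac32$, and let $\delta>0$ be small ($0<\delta<\alpha-1$). Let $B_1\subset\mathbb R^d$ be a ball with radius $1$ such that $0\in B_1$. Let $E\subset B_1$ be a compact subset with $c_{F_{\alpha,\beta}}(E)>0$. Then there are positive constants $C$ and $\varepsilon_0$, depending only on $d,\alpha,\delta$ and $c_{F_{\alpha,\beta}}(E)$, such that any analytic function $\phi:\mathbb D_{10}(0)\subset\mathbb C^d\to\mathbb C$ satisfies $$\sup_{x\in B_1}|\phi(x)|\le\varepsilon\sup_{z\in\mathbb D_{10}(0)}|\phi(z)|+\exp\Big\{\frac{C(\log\frac1\varepsilon)^2}{(\log\log\frac1\varepsilon)^{2(\alpha-1-\delta)/3}}\Big\}\sup_{x\in E}|\phi(x)|$$ for each $\varepsilon\in(0,\varepsilon_0]$.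
   Context: $\mathbb D_r(a)=\{z\in\mathbb C^d:|z-a|\le r\}$ is the closed disc in $\mathbb C^d$. A gauge function is a strictly increasing continuous $f:(0,\infty)\to[0,\infty)$ with $\lim_{t\to0^+}f(t)=0$. For a gauge function $f$, the $f$-Hausdorff content of $E\subset\mathbb R^d$ is $c_f(E)=\inf\{\sum_{j\ge1} f(d(B_j)):E\subset\bigcup_{j\ge1} B_j\}$, where the $B_j$ are open balls in $\mathbb R^d$ with diameter $d(B_j)$. $F_{\alpha,\beta}(t)=t^{d-1}(\log\frac1t)^{-\beta}(\log\log\frac1t)^{-\alpha}$ for $t\in(0,e^{-3}]$, understood as a gauge function on $(0,\infty)$ via a fixed extension with $F_{\alpha,\beta}(t)\sim1$ as $t\to+\infty$. *)

(* Defs.v *)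
From HB Require Import structures.
From mathcomp Require Import all_boot all_order all_algebra finmap.
From mathcomp Require Import all_classical all_reals all_analysis.
From mathcomp.analysis.showcase Require Import summability.
From mathcomp Require Import complex.
Set Implicit Arguments.
Unset Strict Implicit.
Unset Printing Implicit Defensive.
Import Order.TTheory GRing.Theory Num.Theory.
Import numFieldNormedType.Exports.
Local Open Scope classical_set_scope.
Local Open Scope ring_scope.

(* Normc.normc is the modulus as an element of R; `|z| lives in R[i].
   The norm that the library puts on row vectors is the sup norm, hence the
   Euclidean norms below.  The induced topologies agree. *)
Definition renorm (R : realType) (d : nat) (x : 'rV[R]_d) : R :=
  Num.sqrt (\sum_(i < d) x ord0 i ^+ 2).

Definition cenorm (R : realType) (d : nat) (z : 'rV[R[i]]_d) : R :=
  Num.sqrt (\sum_(i < d) Normc.normc (z ord0 i) ^+ 2).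

Definition open_eball (R : realType) (d : nat) (a : 'rV[R]_d) (r : R) :
    set 'rV[R]_d :=
  [set x | renorm (x - a) < r].

Definition closed_eball (R : realType) (d : nat) (a : 'rV[R]_d) (r : R) :
    set 'rV[R]_d :=
  [set x | renorm (x - a) <= r].

(* "A ball" without further qualification may be open or closed. *)
Definition is_eball (R : realType) (d : nat) (B : set 'rV[R]_d)
    (a : 'rV[R]_d) (r : R) : Prop :=
  B = open_eball a r \/ B = closed_eball a r.

Definition cdisc (R : realType) (d : nat) (a : 'rV[R[i]]_d) (r : R) :
    set 'rV[R[i]]_d :=
  [set z | cenorm (z - a) <= r].

Definition of_real_vec (R : realType) (d : nat) (x : 'rV[R]_d) : 'rV[R[i]]_d :=
  map_mx (real_complex R) x.

(* Values of f outside ]0, +oo[ are irrelevant. *)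
Definition gauge_function (R : realType) (f : R -> R) : Prop :=
  [/\ forall t : R, 0 < t -> 0 <= f t,
      forall s t : R, 0 < s -> s < t -> f s < f t,
      {in `]0, +oo[, continuous f}
    & f t @[t --> 0^'+] --> 0].

(* An open ball of radius r has diameter 2 * r. *)
Definition hausdorff_content (R : realType) (d : nat) (f : R -> R)
    (E : set 'rV[R]_d) : \bar R :=
  ereal_inf [set s | exists (x : nat -> 'rV[R]_d) (r : nat -> R),
    [/\ forall j, 0 < r j,
        E `<=` \bigcup_j open_eball (x j) (r j)
      & s = (\sum_(0 <= j <oo) (f (2 * r j))%:E)%E]].

Definition log_gauge (R : realType) (d : nat) (alpha beta t : R) : R :=
  t ^+ d.-1 * ln t^-1 `^ (- beta) * ln (ln t^-1) `^ (- alpha).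

(* f extends log_gauge from ]0, exp(-3)] to a gauge function that is comparable
   to 1 at +oo. *)
Definition log_gauge_extension (R : realType) (d : nat) (alpha beta : R)
    (f : R -> R) : Prop :=
  [/\ gauge_function f,
      forall t : R, 0 < t -> t <= expR (- 3) -> f t = log_gauge d alpha beta t
    & exists m M : R, 0 < m /\ \forall t \near +oo, m <= f t <= M].

Definition multi_monomial (R : realType) (d : nat) (k : {ffun 'I_d -> nat})
    (h : 'rV[R[i]]_d) : R[i] :=
  \prod_(i < d) h ord0 i ^+ k i.

(* phi is, near a, the sum of an absolutely convergent power series indexed by
   multi-indices; the sum is the limit along the finite sets of multi-indices. *)
Definition analytic_at (R : realType) (d : nat) (phi : 'rV[R[i]]_d -> R[i])
    (a : 'rV[R[i]]_d) : Prop :=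
  exists (c : {ffun 'I_d -> nat} -> R[i]) (r : R), 0 < r /\
    forall h : 'rV[R[i]]_d, cenorm h < r ->
      (\esum_(k in [set: {ffun 'I_d -> nat}])
          (Normc.normc (c k * multi_monomial k h))%:E < +oo)%E /\
      Normc.normc (partial_sum (fun k => c k * multi_monomial k h) J
                   - phi (a + h)) @[J --> totally] --> (0 : R).

(* Analytic on an open neighbourhood of A. *)
Definition analytic_on (R : realType) (d : nat) (A : set 'rV[R[i]]_d)
    (phi : 'rV[R[i]]_d -> R[i]) : Prop :=
  forall a, A a -> analytic_at phi a.

Definition sup_on (R : realType) (T : Type) (A : set T) (g : T -> R[i]) :
    \bar R :=
  ereal_sup [set (Normc.normc (g z))%:E | z in A].

(* Main.v *)
Require Import Defs.
From mathcomp Require Import all_boot all_order all_algebra finmap.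
From mathcomp Require Import all_classical all_reals all_analysis.
From mathcomp.analysis.showcase Require Import summability.
From mathcomp Require Import complex.
From mathcomp Require Import ring lra zify.
Import Order.TTheory GRing.Theory Num.Theory.
Import numFieldNormedType.Exports.
Set Implicit Arguments.
Unset Strict Implicit.
Unset Printing Implicit Defensive.
Local Open Scope classical_set_scope.
Local Open Scope ring_scope.

(* Let N = ln (1/eps) and A = C N^2 / (ln N)^kappa with
   kappa = 2 (alpha - 1 - delta) / 3.  If the inequality fails, some x* in B1
   has W = |phi x*| > 0 with |phi| <= W e^N on the disc and |phi| <= W e^-A
   on E; the claim is that then the content of E is small.

   Running through the coordinates one at a time, a one-variable Remez
   argument shows that at least half of the points w of a fine grid satisfy
   |phi w| >= W e^(-c N).  Fix such a base point w and cut space into thin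
   tubes issuing from w.  On the complex line carried by a tube, phi is tiny at
   the points of E and not small at w; interpolation at Fekete points combined
   with the maximum modulus principle (applied to phi divided by a polynomial)
   gives m = O(N) parameters y_l such that prod_l |t - y_l| <= 2^(-19A/40)
   for every point of E in the tube, t being its position along the tube.
   Hence, for J_i = (A/40) (4/9)^i, such a t has 2^i of the y_l within 2^-J_i
   for some i <= log m.

   A greedy Frostman argument puts a measure nu on a finite subset of E with
   mass bounded below by the content and nu Q <= F(4 d 2^-n) for dyadic cubes Q
   of side 2^-n.  Two points at distance 2^-n lie in a common tube for a
   proportion at most 2^(n(d-1)) / G^(d-1) of the base points, where 1/G is the
   mesh of the grid and the width of the tubes.  Averaging over the base points,
   with x <= th + x^2 / th, bounds the mass of nu by N times the tail
   sum_(n >= A) 2^(n(d-1)) F(2^-n), which is at most A^(-1/2) (ln A)^-alpha up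
   to a constant as beta = 3/2.  Since kappa/2 < alpha the product is
   O(C^(-1/2)). *)

(** A single scale would not do. A product of m = O(N) distances below 2^(-19A/40) only puts t
    within 2^-J of one root with J of order A/N, which is about N; the energy tail from that level
    on is N^(-1/2) up to logarithms, too large against N intervals. Counting roots repairs this: the
    points with 2^i roots within 2^-J_i lie in O(m / 2^i) intervals, so J_i may fall geometrically
    from order A and the sum over i costs only a constant.

    Nor would a single base point do, since E may concentrate in a few tubes issuing from it;
    averaging over base points replaces the count of tubes by the kernel 2^(n(d-1)), which cancels
    the power in the gauge and leaves n^(-3/2).

    The inequality x <= th + x^2 / th is applied to the mass x of one heavy interval. After
    averaging, the squares give the total mass times a small factor, which is absorbed on the left.

    All objects are finite: nu lives on one point per occupied dyadic cube and the base points form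
    a grid. The mesh 2^-J can be taken as fine as needed because the final bound does not involve J;
    neither integration nor a limit of measures occurs. *)

Local Notation nc := Normc.normc.

(** * The modulus of a complex number as an element of [R] *)

Section Modulus.
Variable R : realType.
Implicit Types z w : R[i].

Lemma nc_ge0 z : 0 <= nc z.
Proof. by case: z => a b; exact: sqrtr_ge0. Qed.

Lemma ncM z w : nc (z * w) = nc z * nc w.
Proof. exact: Normc.normcM. Qed.

Lemma nc0 : nc (0 : R[i]) = 0.
Proof. exact: Normc.normc0. Qed.

Lemma nc1 : nc (1 : R[i]) = 1.
Proof. exact: Normc.normc1. Qed.

Lemma nc_eq0 z : (nc z == 0) = (z == 0).
Proof.
by apply/eqP/eqP => [/Normc.eq0_normc //|->]; exact: nc0.
Qed.

Lemma nc_gt0 z : (0 < nc z) = (z != 0).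
Proof. by rewrite lt_neqAle nc_ge0 andbT eq_sym nc_eq0. Qed.

Lemma ncD z w : nc (z + w) <= nc z + nc w.
Proof. exact: le_normcD. Qed.

Lemma ncN z : nc (- z) = nc z.
Proof. exact: normcN. Qed.

Lemma ncB z w : nc (z - w) <= nc z + nc w.
Proof. by rewrite -[nc w]ncN; exact: ncD. Qed.

Lemma nc_lb z w : nc z - nc w <= nc (z + w).
Proof. by rewrite lerBlDr -[nc w]ncN; apply: le_trans (ncD _ _); rewrite addrK. Qed.

Lemma ncX z n : nc (z ^+ n) = nc z ^+ n.
Proof. by elim: n => [|n IH]; rewrite ?expr0 ?nc1 // !exprS ncM IH. Qed.

Lemma nc_sum (I : Type) (r : seq I) (P : pred I) (F : I -> R[i]) :
  nc (\sum_(i <- r | P i) F i) <= \sum_(i <- r | P i) nc (F i).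
Proof.
elim/big_ind2: _ => //; first by rewrite nc0.
by move=> x y z t h1 h2; apply: le_trans (ncD _ _) _; exact: lerD.
Qed.

Lemma nc_prod (I : Type) (r : seq I) (P : pred I) (F : I -> R[i]) :
  nc (\prod_(i <- r | P i) F i) = \prod_(i <- r | P i) nc (F i).
Proof. by elim/big_ind2: _ => [|x y z t <- <-|//]; [exact: nc1|exact: ncM]. Qed.

Lemma nc_real (x : R) : nc (real_complex R x) = `|x|.
Proof. by rewrite /= expr0n addr0 sqrtr_sqr. Qed.

Lemma nc_le_ReIm z : nc z <= `|complex.Re z| + `|complex.Im z|.
Proof.
case: z => a b /=.
rewrite -(ger0_norm (addr_ge0 (normr_ge0 a) (normr_ge0 b))) -sqrtr_sqr.
rewrite ler_wsqrtr // sqrrD !real_normK ?num_real //.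
by rewrite -addrA lerD2l lerDr mulrn_wge0 // mulr_ge0.
Qed.

Lemma ReIm_le_nc z : `|complex.Re z| <= nc z /\ `|complex.Im z| <= nc z.
Proof.
case: z => a b /=; rewrite -!sqrtr_sqr; split; rewrite ler_wsqrtr //.
  by rewrite lerDl sqr_ge0.
by rewrite lerDr sqr_ge0.
Qed.

End Modulus.

(** * Complex power series in one variable *)

Section PowerSeries.
Variable R : realType.
Implicit Types (u : nat -> R[i]) (b : nat -> R[i]) (z : R[i]) (F : R[i] -> R[i]).

Definition cvgc u (l : R[i]) :=
  forall eps : R, 0 < eps -> exists n0, forall n, (n0 <= n)%N -> nc (u n - l) < eps.

Definition psum b z (n : nat) : R[i] := \sum_(k < n) b k * z ^+ k.

Definition psexp b (r : R) F := forall z, nc z < r -> cvgc (psum b z) (F z).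

Lemma cvgc_le u l z (B : R) n1 :
  cvgc u l -> (forall n, (n1 <= n)%N -> nc (u n - z) <= B) -> nc (l - z) <= B.
Proof.
move=> ul uB; apply/ler_addgt0Pr => e e0; have [n0 h] := ul _ e0.
have -> : l - z = - (u (maxn n0 n1) - l) + (u (maxn n0 n1) - z) by ring.
apply: le_trans (ncD _ _) _; rewrite ncN addrC lerD ?uB ?leq_maxr //.
by rewrite ltW // h // leq_maxl.
Qed.

Lemma cvgc_unique u l l' : cvgc u l -> cvgc u l' -> l = l'.
Proof.
move=> ul ul'; apply/eqP; rewrite -subr_eq0 -nc_eq0; apply/eqP/le_anti.
rewrite nc_ge0 andbT; apply/ler_addgt0Pr => e e0; rewrite add0r.
have [n0 h] := ul' _ e0.
by apply: (cvgc_le ul (n1 := n0)) => n /h /ltW.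
Qed.

Lemma cvgc_cst l : cvgc (fun=> l) l.
Proof. by move=> e e0; exists 0%N => n _; rewrite subrr nc0. Qed.

Lemma cvgc_near u v l n1 :
  (forall n, (n1 <= n)%N -> u n = v n) -> cvgc v l -> cvgc u l.
Proof.
move=> uv vl e e0; have [n0 h] := vl _ e0; exists (maxn n0 n1) => n.
by rewrite geq_max => /andP[n0n n1n]; rewrite uv // h.
Qed.

Lemma cvgcD u v l l' : cvgc u l -> cvgc v l' -> cvgc (fun n => u n + v n) (l + l').
Proof.
move=> ul vl e e0; have e20 : 0 < e / 2 by lra.
have [n0 h] := ul _ e20; have [n1 h1] := vl _ e20; exists (maxn n0 n1) => n.
rewrite geq_max => /andP[/h h2 /h1 h3].
have -> : u n + v n - (l + l') = (u n - l) + (v n - l') by ring.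
by apply: le_lt_trans (ncD _ _) _; lra.
Qed.

Lemma cvgcZ u l z : cvgc u l -> cvgc (fun n => z * u n) (z * l).
Proof.
move=> ul; have [->|z0] := eqVneq z 0.
  by move=> e e0; exists 0%N => n _; rewrite !mul0r subrr nc0.
move=> e e0; have zp : 0 < nc z by rewrite nc_gt0.
have [n0 h] := ul _ (divr_gt0 e0 zp); exists n0 => n /h hn.
by rewrite -mulrBr ncM mulrC -ltr_pdivlMr.
Qed.

Lemma cvgcB u v l l' : cvgc u l -> cvgc v l' -> cvgc (fun n => u n - v n) (l - l').
Proof.
move=> ul vl; have := cvgcD ul (cvgcZ (-1) vl).
by rewrite mulN1r; apply: (cvgc_near (n1 := 0%N)) => n _; rewrite mulN1r.
Qed.

Lemma psum_bounded b z l : cvgc (psum b z) l ->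
  exists2 B : R, 0 < B & forall n, nc (b n) * nc z ^+ n <= B.
Proof.
move=> h; have [n0 hn] := h _ ltr01.
have S0 : 0 <= \sum_(k < n0) nc (b k) * nc z ^+ k.
  by apply: sumr_ge0 => k _; rewrite mulr_ge0 ?exprn_ge0 ?nc_ge0.
exists (2 + \sum_(k < n0) nc (b k) * nc z ^+ k); first by lra.
move=> n; rewrite -ncX -ncM; case: (ltnP n n0) => nn0.
  rewrite (bigD1 (Ordinal nn0)) //= ncM ncX.
  have : 0 <= \sum_(i < n0 | i != Ordinal nn0) nc (b i) * nc z ^+ i.
    by apply: sumr_ge0 => k _; rewrite mulr_ge0 ?exprn_ge0 ?nc_ge0.
  by lra.
have h1 := hn _ nn0; have h2 := hn _ (leqW nn0).
have -> : b n * z ^+ n = (psum b z n.+1 - l) - (psum b z n - l).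
  by rewrite /psum big_ord_recr /=; ring.
by apply: le_trans (ncB _ _) _; lra.
Qed.

Lemma geo_half (x : R) n : 0 <= x -> x <= 1 / 2 -> \sum_(k < n) x ^+ k <= 2.
Proof.
move=> x0 x1; suff : \sum_(k < n) x ^+ k <= 2 - 2 * x ^+ n.
  have : 0 <= x ^+ n by exact: exprn_ge0.
  by lra.
elim: n => [|n IH]; first by rewrite big_ord0 expr0; lra.
rewrite big_ord_recr /= exprS; have : 0 <= x ^+ n by exact: exprn_ge0.
by move: IH; nra.
Qed.

(** Convergence at the single point rho = r / 2 gives |b n| <= B / rho^n. For |z| < rho / 2 the
    terms after the k-th are then dominated by a geometric series of ratio at most 1/2. *)
Lemma psexp_tail b r F k : 0 < r -> psexp b r F -> (forall n, (n < k)%N -> b n = 0) ->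
  exists K r' : R, [/\ 0 <= K, 0 < r', r' <= r &
    forall z, nc z < r' -> nc (F z - b k * z ^+ k) <= K * nc z ^+ k.+1].
Proof.
move=> r0 hF bk0; pose rho := r / 2; have rho0 : 0 < rho by rewrite /rho; lra.
have ncrho : nc (real_complex R rho) = rho by rewrite nc_real gtr0_norm.
have [|B B0 hB] := psum_bounded (hF (real_complex R rho) _).
  by rewrite ncrho /rho; lra.
have {}hB n : nc (b n) <= B / rho ^+ n.
  by rewrite ler_pdivlMr ?exprn_gt0 // -{1}ncrho.
exists (2 * B / rho ^+ k.+1), (rho / 2); split; rewrite /rho; try lra.
  by rewrite divr_ge0 ?exprn_ge0 //; lra.
move=> z zr; apply: (cvgc_le (n1 := k.+1) (u := psum b z)).
  by apply: hF; rewrite /rho in zr; lra.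
move=> n /subnKC <-; set m := (n - k.+1)%N.
rewrite /psum big_split_ord /= big_ord_recr /= big1 ?add0r; last first.
  by move=> i _; rewrite bk0 ?mul0r.
rewrite addrAC subrr add0r; apply: le_trans (nc_sum _ _ _) _.
set x := nc z / rho.
have x0 : 0 <= x by rewrite divr_ge0 ?nc_ge0 // ltW.
have x1 : x <= 1 / 2 by rewrite /x ler_pdivrMr //; rewrite -/rho in zr; lra.
have -> : 2 * B / (r / 2) ^+ k.+1 * nc z ^+ k.+1 = B * x ^+ k.+1 * 2.
  by rewrite -/rho /x [(nc z / rho) ^+ _]expr_div_n; ring.
apply: le_trans (_ : B * x ^+ k.+1 * (\sum_(i < m) x ^+ i) <= _); last first.
  by rewrite ler_wpM2l ?geo_half // mulr_ge0 ?exprn_ge0 // ltW.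
rewrite mulr_sumr; apply: ler_sum => i _; rewrite ncM ncX.
rewrite -mulrA -exprD /x expr_div_n [nc z ^+ _ / _]mulrC mulrA.
by rewrite ler_wpM2r ?exprn_ge0 ?nc_ge0 ?hB.
Qed.

Lemma psexp_at0 b r F : 0 < r -> psexp b r F -> F 0 = b 0%N.
Proof.
move=> r0 hF; apply: (cvgc_unique (hF 0 _)); first by rewrite nc0.
apply: (cvgc_near (n1 := 1%N) (v := fun=> b 0%N)); last exact: cvgc_cst.
case=> // n _; rewrite /psum big_ord_recl expr0 mulr1 big1 ?addr0 // => i _.
by rewrite expr0n /= mulr0.
Qed.

Lemma psexp_poly (p : {poly R[i]}) r : psexp (fun n => p`_n) r (horner p).
Proof.
move=> z _; apply: (cvgc_near (n1 := size p) (v := fun=> p.[z])); last exact: cvgc_cst.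
by move=> n sn; rewrite (horner_coef_wide _ sn).
Qed.

Lemma psexpB b b' r F F' : psexp b r F -> psexp b' r F' ->
  psexp (fun n => b n - b' n) r (fun z => F z - F' z).
Proof.
move=> h h' z zr; have := cvgcB (h z zr) (h' z zr).
apply: (cvgc_near (n1 := 0%N)) => n _; rewrite /psum -sumrB.
by apply: eq_bigr => i _; rewrite mulrBl.
Qed.

Lemma psexp_shift b r F : 0 < r -> psexp b r F -> b 0%N = 0 ->
  psexp (fun n => b n.+1) r (fun z => if z == 0 then b 1%N else F z / z).
Proof.
move=> r0 h b0 z zr; case: eqVneq => [->|z0].
  apply: (cvgc_near (n1 := 1%N) (v := fun=> b 1%N)); last exact: cvgc_cst.
  case=> // n _; rewrite /psum big_ord_recl expr0 mulr1 big1 ?addr0 // => i _.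
  by rewrite expr0n /= mulr0.
have hz := cvgcZ z^-1 (h z zr); move=> e e0.
have [n0 hn] := hz e e0; exists n0 => n n0n; have := hn n.+1 (leqW n0n).
rewrite /psum big_ord_recl b0 mul0r add0r mulr_sumr [z^-1 * _]mulrC.
congr (nc (_ - _) < e); apply: eq_bigr => i _.
by rewrite exprS; field.
Qed.

Lemma psexp_le b r r' F : r' <= r -> psexp b r F -> psexp b r' F.
Proof. by move=> rr h z zr; apply: h; exact: lt_le_trans rr. Qed.

Lemma psexp_ext b r F F' : (forall z, nc z < r -> F z = F' z) ->
  psexp b r F -> psexp b r F'.
Proof. by move=> e h z zr; rewrite -e //; exact: h. Qed.

End PowerSeries.

(** * Local behaviour of power series divided by polynomials *)

Section MaximumModulus.
Variable R : realType.
Implicit Types (g : R[i] -> R[i]) (z : R[i]).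

(* Germs of quotients of a power series by a polynomial: dividing such a
   function by [z - x] needs no multiplication of power series. *)
Definition lquot g z0 := exists (b : nat -> R[i]) (q : {poly R[i]}) (r : R),
  [/\ 0 < r, q.[0] != 0 & psexp b r (fun z => g (z0 + z) * q.[z])].

Definition lquot_on (rho : R) g := forall z, nc z <= rho -> lquot g z.

Lemma lquotB_horner g z0 (p : {poly R[i]}) :
  lquot g z0 -> lquot (fun z => g z - p.[z]) z0.
Proof.
move=> [b [q [r [r0 q0 h]]]].
exists (fun n => b n - ((p \Po ('X + z0%:P)) * q)`_n), q, r; split=> //.
apply: psexp_ext (psexpB h (psexp_poly ((p \Po ('X + z0%:P)) * q) (r := r))) => z _.
by rewrite hornerM horner_comp !hornerE mulrBl [z + z0]addrC.
Qed.

Lemma lquot_ext g g' z0 (r : R) : 0 < r ->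
  (forall z, nc z < r -> g (z0 + z) = g' (z0 + z)) -> lquot g z0 -> lquot g' z0.
Proof.
move=> r0 e [b [q [r1 [r10 q0 h]]]]; exists b, q, (Num.min r r1); split=> //.
  by rewrite lt_min r0.
apply: psexp_ext (psexp_le _ h); last by rewrite ge_min lexx orbT.
by move=> z; rewrite lt_min => /andP[/e ->].
Qed.

(** At x the series is shifted by one index. At any other centre the factor z - x joins the
    polynomial denominator and the series stays the same. *)
Lemma lquot_div g (x : R[i]) (rho : R) : nc x <= rho -> lquot_on rho g -> g x = 0 ->
  exists v, lquot_on rho (fun z => if z == x then v else g z / (z - x)).
Proof.
move=> xr hg gx; have [b [q [r [r0 q0 h]]]] := hg _ xr.
have b0 : b 0%N = 0 by rewrite -(psexp_at0 r0 h) addr0 gx mul0r.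
exists (b 1%N / q.[0]) => z zr; have [->|zx] := eqVneq z x.
  exists (fun n => b n.+1), q, r; split=> //.
  apply: psexp_ext (psexp_shift r0 h b0) => w wr.
  have -> : (x + w == x) = (w == 0) by rewrite -[X in _ == X]addr0 (inj_eq (addrI x)).
  case: eqVneq => [->|w0]; first by rewrite divfK.
  have -> : x + w - x = w by ring.
  by field.
have [b' [q' [r' [r'0 q'0 h']]]] := hg _ zr.
have d0 : 0 < nc (z - x) by rewrite nc_gt0 subr_eq0.
exists b', (q' * ('X + (z - x)%:P)), (Num.min r' (nc (z - x))); split.
- by rewrite lt_min r'0.
- by rewrite hornerM !hornerE mulf_neq0 // subr_eq0.
apply: psexp_ext (psexp_le _ h'); last by rewrite ge_min lexx.
move=> w; rewrite lt_min => /andP[_ wd].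
have wzx : z + w - x != 0.
  apply/eqP => e; have : z - x = - w by rewrite -[RHS]addr0 -e; ring.
  by move=> e'; rewrite e' ncN ltxx in wd.
rewrite -subr_eq0 (negbTE wzx) hornerM hornerD hornerX hornerC; field.
by rewrite wzx.
Qed.

Lemma lquot_lip g z0 : lquot g z0 -> exists K r : R, [/\ 0 <= K, 0 < r &
  forall z, nc z < r -> nc (g (z0 + z) - g z0) <= K * nc z].
Proof.
move=> [b [q [r [r0 q0 h]]]].
have [//|K1 [r1 [K10 r10 _ h1]]] := psexp_tail r0 h (k := 0).
have [//|K2 [r2 [K20 r20 _ h2]]] := psexp_tail ltr01 (psexp_poly q (r := 1)) (k := 0).
have ncq : 0 < nc q.[0] by rewrite nc_gt0.
have b0 := psexp_at0 r0 h; rewrite addr0 in b0.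
exists (2 * (K1 + nc (g z0) * K2) / nc q.[0]), (Num.min (Num.min r1 r2) (nc q.[0] / (2 * (K2 + 1)))).
split.
- by rewrite divr_ge0 ?nc_ge0 // mulr_ge0 // addr_ge0 // mulr_ge0 ?nc_ge0.
- by rewrite !lt_min r10 r20 divr_gt0 // mulr_gt0 //; lra.
move=> z; rewrite !lt_min => /andP[/andP[zr1 zr2]].
rewrite ltr_pdivlMr; last by rewrite mulr_gt0 //; lra.
move=> zq.
have := h1 _ zr1; have := h2 _ zr2; rewrite !expr0 !mulr1 !expr1 -b0 -horner_coef0.
move=> e2 e1.
have qlb : nc q.[0] / 2 <= nc q.[z].
  have -> : q.[z] = q.[0] + (q.[z] - q.[0]) by ring.
  apply: le_trans (nc_lb _ _).
  by move: zq e2; have := nc_ge0 z; nra.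
have E : (g (z0 + z) - g z0) * q.[z] =
   (g (z0 + z) * q.[z] - g z0 * q.[0]) - g z0 * (q.[z] - q.[0]) by ring.
have : nc (g (z0 + z) - g z0) * nc q.[z] <= (K1 + nc (g z0) * K2) * nc z.
  rewrite -ncM E; apply: le_trans (ncB _ _) _; rewrite ncM.
  by rewrite mulrDl lerD // -mulrA ler_wpM2l // nc_ge0.
move=> hh; rewrite mulrAC ler_pdivlMr //.
by move: hh qlb; have := nc_ge0 (g (z0 + z) - g z0); nra.
Qed.

Lemma real_complexXM (x y : R) k :
  real_complex R (x ^+ k * y) = real_complex R x ^+ k * real_complex R y.
Proof. by rewrite rmorphM rmorphXn. Qed.

Lemma exists_root_nc (c : R[i]) k : (0 < k)%N -> exists w, w ^+ k = c.
Proof.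
by move=> k0; exists (k.-root c); rewrite rootCK.
Qed.

(** Consider the expansion of (g - g z0) q. If all its coefficients vanish, g is constant near z0,
    as q has no zero there. Otherwise the first nonzero one governs the growth, and a k-th root
    yields a direction in which its term is a positive multiple of g z0 * q(0). *)
Lemma lquot_local_max g z0 : lquot g z0 -> g z0 != 0 ->
  (exists2 r : R, 0 < r & forall z, nc z < r -> g (z0 + z) = g z0) \/
  (forall r : R, 0 < r -> exists2 z, nc z < r & nc (g z0) < nc (g (z0 + z))).
Proof.
move=> [b [q [r [r0 q0 h]]]] g0.
have gp : 0 < nc (g z0) by rewrite nc_gt0.
have ncq : 0 < nc q.[0] by rewrite nc_gt0.
pose b' n : R[i] := b n - (g z0 *: q)`_n.
have h' : psexp b' r (fun z => g (z0 + z) * q.[z] - (g z0 *: q).[z]).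
  exact: psexpB h (psexp_poly _ (r := r)).
have [K2 [r2 [K20 r20 _ h2]]] := psexp_tail ltr01 (psexp_poly q (r := 1)) (k := 0)
  (fun n (e : (n < 0)%N) => ltac:(by [])).
case: (pselect (exists n, b' n != 0)) => [ex|nex]; last first.
  left; exists (Num.min (Num.min r r2) (nc q.[0] / (K2 + 1))).
    by rewrite !lt_min r0 r20 divr_gt0 //; lra.
  move=> z; rewrite !lt_min => /andP[/andP[zr zr2]]; rewrite ltr_pdivlMr; last by lra.
  move=> zq.
  have b'0 n : b' n = 0 by apply: contrapT => /eqP e; apply: nex; exists n.
  have : g (z0 + z) * q.[z] - (g z0 *: q).[z] = 0.
    apply: (cvgc_unique (h' z zr)); apply: (cvgc_near (n1 := 0%N) _ (cvgc_cst 0)) => n _.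
    by rewrite /psum big1 // => i _; rewrite b'0 mul0r.
  rewrite hornerZ -mulrBl => /eqP; rewrite mulf_eq0 subr_eq0 => /orP[/eqP//|/eqP qz].
  have := h2 _ zr2; rewrite expr0 mulr1 expr1 -horner_coef0 qz sub0r ncN.
  by move=> hq; exfalso; move: hq zq (nc_ge0 z); nra.
right.
have [k bk kmin] : exists2 k, b' k != 0 & forall n, (n < k)%N -> b' n = 0.
  have [k bk km] := ex_minnP ex; exists k => // n nk.
  by apply/eqP; apply: contraLR nk => /km; rewrite -leqNgt.
have k0 : (0 < k)%N.
  rewrite lt0n; apply: contraNneq bk => ->.
  have := psexp_at0 r0 h'; rewrite -/b' => <-.
  by rewrite addr0 hornerZ subrr.
have [K1 [r1 [K10 r10 _ h1]]] := psexp_tail r0 h' kmin.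
have bp : 0 < nc (b' k) by rewrite nc_gt0.
(* This value gives the root [w] below modulus 1. *)
pose s : R := nc (b' k) / (nc q.[0] * nc (g z0)).
have s0 : 0 < s by rewrite divr_gt0 // mulr_gt0.
have [w wk] := exists_root_nc (real_complex R s * (g z0 * q.[0]) / b' k) k0.
have bw : b' k * w ^+ k = real_complex R s * (g z0 * q.[0]).
  by rewrite wk mulrC divfK.
have ncw : nc w = 1.
  apply/eqP; rewrite -(pexpr_eq1 k0) ?nc_ge0 //.
  rewrite -ncX wk !ncM Normc.normcV nc_real gtr0_norm // /s.
  by apply/eqP; field; rewrite !gt_eqF.
clearbody s; move=> e e0; pose L : R := K1 + s * nc (g z0) * K2 + K2 + 1.
have snn : 0 <= s * nc (g z0) * K2 by apply: mulr_ge0 => //; apply: mulr_ge0; exact: ltW.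
have L0 : 0 < L by rewrite /L; lra.
pose m : R := Num.min (s * nc (g z0)) 1 * nc q.[0].
have m0 : 0 < m by rewrite mulr_gt0 // lt_min ltr01 mulr_gt0.
pose t : R := Num.min (Num.min e (Num.min r1 r2)) (m / L) / 4.
have t0 : 0 < t by rewrite divr_gt0 // !lt_min e0 r10 r20 divr_gt0.
have : t < Num.min (Num.min e (Num.min r1 r2)) (m / L) by rewrite /t; rewrite /t in t0; lra.
rewrite !lt_min => /andP[/andP[te /andP[tr1 tr2]]] _.
have tL : 4 * t * L <= m.
  rewrite -ler_pdivlMr // /t mulrC divfK // ?pnatr_eq0 //.
  by rewrite ge_min lexx orbT.
clearbody t; pose z : R[i] := real_complex R t * w.
have ncz : nc z = t by rewrite ncM nc_real ncw mulr1 gtr0_norm.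
exists z; first by rewrite ncz.
have := h1 z; rewrite ncz => /(_ tr1); have := h2 z; rewrite ncz => /(_ tr2).
rewrite expr0 mulr1 expr1 -horner_coef0 hornerZ.
set e2 := q.[z] - q.[0] => h2z.
have T0 : 0 < t ^+ k by rewrite exprn_gt0.
have [T [TE ncT nc1T]] : exists T : R[i], [/\ T = real_complex R (t ^+ k * s),
    nc T = t ^+ k * s & nc (1 + T) = 1 + t ^+ k * s].
  exists (real_complex R (t ^+ k * s)); split=> //.
    by rewrite nc_real gtr0_norm //; exact: mulr_gt0.
  rewrite -[1 in LHS](rmorph1 (real_complex R)) -rmorphD nc_real gtr0_norm //.
  by apply: addr_gt0 => //; exact: mulr_gt0.
have -> : b' k * z ^+ k = T * (g z0 * q.[0]).
  rewrite exprMn mulrCA bw TE real_complexXM -mulrA. reflexivity.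
set e1 := (X in nc X <= _ -> _) => h1z.
(* The gain T is of order t^k, whereas both error terms are of order t^(k+1). *)
have E : g (z0 + z) * q.[z] = (1 + T) * g z0 * q.[z] + (e1 - T * g z0 * e2).
  by rewrite /e1 /e2; ring.
have qlb : nc q.[0] / 2 <= nc q.[z].
  have -> : q.[z] = q.[0] + e2 by rewrite /e2; ring.
  apply: le_trans (nc_lb _ _).
  have : m <= nc q.[0] by rewrite /m -{2}[nc q.[0]]mul1r ler_pM2r // ge_min lexx orbT.
  have : t * K2 <= t * L by rewrite ler_pM2l // /L; lra.
  by move: h2z tL; lra.
have qz : 0 < nc q.[z] by lra.
rewrite -(ltr_pM2r qz) -[X in _ < X]ncM E.
apply: lt_le_trans (nc_lb _ _).
rewrite ltrBrDr !ncM nc1T.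
have : nc (e1 - T * g z0 * e2) <=
   K1 * t ^+ k.+1 + t ^+ k * s * nc (g z0) * (K2 * t).
  apply: le_trans (ncB _ _) _; rewrite !ncM ncT; apply: lerD => //.
  apply: ler_wpM2l => //; apply: mulr_ge0; last exact: ltW.
  by apply: mulr_ge0; exact: ltW.
suff : K1 * t ^+ k.+1 + t ^+ k * s * nc (g z0) * (K2 * t) <
   t ^+ k * s * nc (g z0) * nc q.[z] by lra.
have -> : K1 * t ^+ k.+1 + t ^+ k * s * nc (g z0) * (K2 * t) =
  t ^+ k * (t * (K1 + s * nc (g z0) * K2)) by rewrite exprS; ring.
rewrite -!mulrA ltr_pM2l // !mulrA.
have : t * (K1 + s * nc (g z0) * K2) <= t * L by rewrite ler_pM2l // /L; lra.
have : m <= s * nc (g z0) * nc q.[0] by rewrite /m ler_pM2r // ge_min lexx.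
have : s * nc (g z0) * (nc q.[0] / 2) <= s * nc (g z0) * nc q.[z].
  by rewrite ler_pM2l // mulr_gt0.
by move: tL m0; lra.
Qed.

End MaximumModulus.

(** * The maximum modulus principle on closed discs *)

Section MaximumPrinciple.
Variable R : realType.
Implicit Types (g : R[i] -> R[i]) (z : R[i]).

Lemma nc_continuity (h : R[i] -> R) (p : R * R) :
  (forall e : R, 0 < e -> exists2 r : R, 0 < r & forall w, nc w < r ->
     `|h (Complex p.1 p.2 + w) - h (Complex p.1 p.2)| < e) ->
  {for p, continuous (fun p : R * R => h (Complex p.1 p.2))}.
Proof.
move=> H; apply/cvgrPdist_lt => e e0; have [r r0 hr] := H e e0.
have r20 : 0 < r / 2 by rewrite divr_gt0.
near=> q.
have -> : Complex q.1 q.2 = Complex p.1 p.2 + (Complex q.1 q.2 - Complex p.1 p.2).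
  by rewrite addrC subrK.
rewrite distrC; apply: hr; apply: le_lt_trans (nc_le_ReIm _) _.
have -> : r = r / 2 + r / 2 by lra.
have : ball p (r / 2) q by near: q; exact: (nbhsx_ballx p (r / 2) r20).
by case=> /=; rewrite /ball /= => h1 h2; rewrite distrC ltrD // distrC.
Unshelve. all: by end_near.
Qed.

Lemma lquot_nc_cont g z0 : lquot g z0 ->
  forall e : R, 0 < e -> exists2 r : R, 0 < r & forall w, nc w < r ->
    `|nc (g (z0 + w)) - nc (g z0)| < e.
Proof.
move=> /lquot_lip[K [r [K0 r0 h]]] e e0.
exists (Num.min r (e / (K + 1))).
  by rewrite lt_min r0 divr_gt0 //; lra.
move=> w; rewrite lt_min => /andP[/h hw]; rewrite ltr_pdivlMr; last by lra.
move=> we; have h1 := nc_lb (g (z0 + w)) (- (g (z0 + w) - g z0)).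
have h2 := nc_lb (g z0) (g (z0 + w) - g z0).
have e1 : g (z0 + w) - (g (z0 + w) - g z0) = g z0 by ring.
have e2 : g z0 + (g (z0 + w) - g z0) = g (z0 + w) by ring.
rewrite e1 ncN in h1; rewrite e2 in h2; have := nc_ge0 w => w0.
have : `|nc (g (z0 + w)) - nc (g z0)| <= nc (g (z0 + w) - g z0).
  by rewrite ler_norml; lra.
by nra.
Qed.

Lemma compact_disc (rho : R) :
  compact [set p : R * R | nc (Complex p.1 p.2) <= rho].
Proof.
set A := (X in compact X).
have cK : compact (`[- rho, rho]%classic `*` `[- rho, rho]%classic : set (R * R)).
  by apply: compact_setX; exact: segment_compact.
apply: (subclosed_compact _ cK).
  have -> : A = (fun p : R * R => nc (Complex p.1 p.2)) @^-1` [set x | x <= rho] by [].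
  apply: closed_comp => [p _|]; last exact: closed_le.
  apply: (nc_continuity (h := fun z => nc z)) => e e0; exists e => // w we.
  rewrite ltr_norml; set z := Complex _ _.
  have := ncD z w; have := nc_lb z w.
  by lra.
move=> [x y] /= h; have /= [h1 h2] := ReIm_le_nc (Complex x y).
rewrite !in_itv /= -!ler_norml; split; exact: le_trans h.
Qed.

(** Suppose the maximum M, attained at z0, exceeds B. On the segment from z0 to a boundary point let
    [ts] be the last parameter with modulus M. By [lquot_local_max], either g is constant near that
    point, so M is attained later, or M is exceeded nearby. *)
Lemma max_modulus g (rho B : R) : 0 < rho -> lquot_on rho g ->
  (forall z, nc z = rho -> nc (g z) <= B) -> forall z, nc z <= rho -> nc (g z) <= B.
Proof.
move=> rho0 hg hB.
have [p pA pmax] : exists2 p : R * R,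
    p \in [set p : R * R | nc (Complex p.1 p.2) <= rho] & forall t : R * R,
    t \in [set p : R * R | nc (Complex p.1 p.2) <= rho] ->
      nc (g (Complex t.1 t.2)) <= nc (g (Complex p.1 p.2)).
  apply: (@compact_EVT_max _ R (fun t : R * R => nc (g (Complex t.1 t.2)))).
  - by exists (0, 0); rewrite /= expr0n /= addr0 sqrtr0 ltW.
  - exact: compact_disc.
  apply: continuous_in_subspaceT => t /set_mem /= tA.
  by apply: (nc_continuity (h := fun z => nc (g z))); apply: lquot_nc_cont; exact: hg.
set z0 := Complex p.1 p.2 in pmax pA; move/set_mem: pA => /= pA.
have zmax z : nc z <= rho -> nc (g z) <= nc (g z0).
  by case: z => x y zr; apply: (pmax (x, y)); rewrite inE.
suff : nc (g z0) <= B by move=> h z /zmax /le_trans; exact.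
rewrite leNgt; apply/negP => BM; set M := nc (g z0) in BM zmax.
have [z1 nz1] : exists z1 : R[i], nc z1 = rho.
  by exists (real_complex R rho); rewrite nc_real gtr0_norm.
have B0 : 0 <= B by apply: le_trans (hB _ nz1); exact: nc_ge0.
pose zt (t : R) : R[i] := z0 + real_complex R t * (z1 - z0).
have ztr t : 0 <= t -> t <= 1 -> nc (zt t) <= rho.
  move=> t0 t1.
  have -> : zt t = real_complex R (1 - t) * z0 + real_complex R t * z1.
    by rewrite /zt rmorphB rmorph1; ring.
  apply: le_trans (ncD _ _) _; rewrite !ncM nz1 !nc_real (ger0_norm t0) ger0_norm ?subr_ge0 //.
  have : (1 - t) * nc z0 <= (1 - t) * rho by rewrite ler_wpM2l ?subr_ge0.
  by lra.
pose S : set R := [set t | 0 <= t <= 1 /\ M <= nc (g (zt t))].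
have S0 : S 0 by split; rewrite ?lexx ?ler01 // /zt mul0r addr0.
have supS : has_sup S.
  by split; [exists 0|exists 1 => t [/andP[]]].
pose ts := sup S.
have ts0 : 0 <= ts by apply: sup_upper_bound.
have ts1 : ts <= 1 by apply: sup_le_ub; [exists 0|move=> t [/andP[]]].
have near_t (r : R) : 0 < r -> exists2 r', 0 < r' &
    forall t, `|t - ts| < r' -> nc (real_complex R (t - ts) * (z1 - z0)) < r.
  move=> r0; exists (r / (nc (z1 - z0) + 1)).
    by rewrite divr_gt0 // ltr_wpDl ?nc_ge0.
  move=> t; rewrite ltr_pdivlMr ?ltr_wpDl ?nc_ge0 // ncM nc_real.
  by have := nc_ge0 (z1 - z0); have := normr_ge0 (t - ts); nra.
have ztE t : zt t = zt ts + real_complex R (t - ts) * (z1 - z0).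
  by rewrite /zt rmorphB; ring.
have zts := ztr _ ts0 ts1.
have Mts : M <= nc (g (zt ts)).
  rewrite leNgt; apply/negP => lt.
  have [|r r0 hr] := lquot_nc_cont (hg _ zts) (e := M - nc (g (zt ts))); first by lra.
  have [r' r'0 hr'] := near_t _ r0.
  have [t [/andP[t0 t1] Mt] tts] := sup_adherent r'0 supS.
  have tle : t <= ts by apply: sup_upper_bound => //; split => //; apply/andP.
  have := hr (real_complex R (t - ts) * (z1 - z0)); rewrite -ztE => H.
  have /H : nc (real_complex R (t - ts) * (z1 - z0)) < r.
    by apply: hr'; rewrite -/ts in tts; rewrite ltr_norml; lra.
  by rewrite ltr_norml; lra.
have ts_lt1 : ts < 1.
  rewrite lt_neqAle ts1 andbT; apply/eqP => e1.
  have : zt ts = z1 by rewrite e1 /zt rmorph1; ring.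
  by move=> e2; move: Mts; rewrite e2 => h; have := hB _ nz1; lra.
have zts_lt : nc (zt ts) < rho.
  rewrite lt_neqAle zts andbT; apply/eqP => /hB.
  by lra.
have gts : g (zt ts) != 0.
  by rewrite -nc_gt0; lra.
have [[r r0 hr]|H] := lquot_local_max (hg _ zts) gts; last first.
  have [|z zr] := H (rho - nc (zt ts)); first by lra.
  suff /zmax : nc (zt ts + z) <= rho by lra.
  by apply: le_trans (ncD _ _) _; lra.
have [r' r'0 hr'] := near_t _ r0.
pose t := Num.min 1 (ts + r' / 2).
have tts : ts < t by rewrite lt_min ts_lt1 /=; lra.
have tr' : t <= ts + r' / 2 by rewrite ge_min lexx orbT.
have t1 : t <= 1 by rewrite ge_min lexx.
have : t <= ts.
  apply: sup_upper_bound => //; split; first by apply/andP; split; lra.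
  rewrite ztE hr //; apply: hr'; rewrite ltr_norml; lra.
by lra.
Qed.

End MaximumPrinciple.

(** * Schwarz lemma with several zeros, and Lagrange interpolation *)

Section Interpolation.
Variable R : realType.
Implicit Types (g f : R[i] -> R[i]) (z : R[i]).

(** On the circle |z - x| >= rho - sigma, and the maximum principle carries the resulting bound for
    the quotient inside. *)
Lemma schwarz_div g (rho M sigma : R) (x : R[i]) : 0 <= sigma -> sigma < rho ->
  nc x <= sigma -> lquot_on rho g -> (forall z, nc z <= rho -> nc (g z) <= M) ->
  g x = 0 ->
  exists g1, [/\ lquot_on rho g1,
    forall z, nc z <= rho -> nc (g1 z) <= M / (rho - sigma) &
    forall z, g z = g1 z * (z - x)].
Proof.
move=> s0 sr xs hg hM gx.
have rho0 : 0 < rho by lra.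
have [|v hv] := lquot_div _ hg gx; first by lra.
eexists; split; first exact: hv.
  apply: max_modulus => // z zr.
  have zx : rho - sigma <= nc (z - x).
    by have := nc_lb z (- x); rewrite ncN zr; lra.
  have -> : (z == x) = false.
    by apply/negbTE; rewrite -subr_eq0 -nc_gt0; lra.
  rewrite ncM Normc.normcV ler_pdivrMr; last by lra.
  have := hM z; rewrite zr => /(_ (lexx _)) gM.
  apply: le_trans gM _; rewrite mulrAC ler_pdivlMr; last by lra.
  rewrite ler_wpM2l //; apply: le_trans (nc_ge0 (g x)) _; apply: hM; lra.
move=> z /=; case: eqVneq => [->|zx]; first by rewrite gx subrr mulr0.
by rewrite divfK // subr_eq0.
Qed.

Lemma zeros_bound (s : seq R[i]) g (rho M sigma : R) : 0 <= sigma -> sigma < rho ->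
  uniq s -> (forall x, x \in s -> nc x <= sigma /\ g x = 0) ->
  lquot_on rho g -> (forall z, nc z <= rho -> nc (g z) <= M) ->
  forall z, nc z <= rho ->
    nc (g z) <= (\prod_(x <- s) nc (z - x)) * (M / (rho - sigma) ^+ size s).
Proof.
move=> s0 sr; elim: s g M => [|x s IH] g M /=.
  by move=> _ _ _ hM z /hM; rewrite big_nil expr0 mul1r divr1.
move=> /andP[xs us] hx hg hM z zr.
have [xsig gx] := hx x (mem_head _ _).
have [g1 [hg1 hM1 g1E]] := schwarz_div s0 sr xsig hg hM gx.
have h1 : forall y, y \in s -> nc y <= sigma /\ g1 y = 0.
  move=> y ys; have [|ysig gy] := hx y; first by rewrite inE ys orbT.
  split=> //; move: gy; rewrite g1E => /eqP; rewrite mulf_eq0 subr_eq0.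
  by case/orP => /eqP // yx; rewrite -yx ys in xs.
have := IH g1 _ us h1 hg1 hM1 z zr.
rewrite g1E ncM big_cons => h.
apply: le_trans (ler_wpM2r (nc_ge0 _) h) _.
have d0 : rho - sigma != 0 by apply/eqP; lra.
rewrite exprS invfM le_eqVlt; apply/orP; left; apply/eqP.
by rewrite -!mulrA; ring.
Qed.

(** L bounds the Lagrange interpolant on the disc. The difference from f vanishes at m + 1 nodes,
    and 5 sigma <= 2 rho makes each zero contribute a factor sigma / (rho - sigma) <= 2/3 at the
    origin. *)
Lemma interpolation_bound f (rho M sigma e P : R) (m : nat) (t : 'I_m.+1 -> R[i]) :
  0 <= sigma -> 5 * sigma <= 2 * rho -> 0 < rho -> injective t ->
  (forall k, nc (t k) <= sigma) -> lquot_on rho f ->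
  (forall z, nc z <= rho -> nc (f z) <= M) ->
  (forall k, nc (f (t k)) <= e) ->
  0 < P -> (forall k, P <= \prod_(i | i != k) nc (t k - t i)) ->
  let L := m.+1%:R * (2 * rho) ^+ m / P * e in
  nc (f 0) <= L + (2 / 3) ^+ m.+1 * (M + L).
Proof.
move=> s0 sr rho0 tinj ts hf hM he P0 hP /=; set Lam := _ * e.
have e0 : 0 <= e by apply: le_trans (he ord0); exact: nc_ge0.
pose lag k : {poly R[i]} := \prod_(i | i != k) ((t k - t i)^-1 *: ('X - (t i)%:P)).
pose L := \sum_k f (t k) *: lag k.
have lagE k z : (lag k).[z] = \prod_(i | i != k) ((t k - t i)^-1 * (z - t i)).
  by rewrite /lag horner_prod; apply: eq_bigr => i _; rewrite hornerZ hornerXsubC.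
have Lt k : L.[t k] = f (t k).
  rewrite /L horner_sum (bigD1 k) //= hornerZ lagE big1 ?mulr1; last first.
    by move=> i ik; rewrite mulVf // subr_eq0 (inj_eq tinj) eq_sym.
  rewrite big1 ?addr0 // => i ik; rewrite hornerZ lagE (bigD1 k) 1?eq_sym //=.
  by rewrite subrr mulr0 mul0r mulr0.
have LB z : nc z <= rho -> nc L.[z] <= Lam.
  move=> zr; rewrite /L horner_sum; apply: le_trans (nc_sum _ _ _) _.
  apply: le_trans (_ : \sum_(k < m.+1) e * ((2 * rho) ^+ m / P) <= _); last first.
    rewrite sumr_const card_ord -[X in X <= _]mulr_natl /Lam le_eqVlt.
    by apply/orP; left; apply/eqP; ring.
  apply: ler_sum => k _; rewrite hornerZ lagE ncM ler_pM ?nc_ge0 //.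
  rewrite nc_prod; under eq_bigr do rewrite ncM Normc.normcV.
  rewrite big_split /= prodfV mulrC ler_pM ?invr_ge0 //.
  - by apply: prodr_ge0 => i _; exact: nc_ge0.
  - by apply: prodr_ge0 => i _; exact: nc_ge0.
  - apply: le_trans (_ : \prod_(i < m.+1 | i != k) (2 * rho) <= _).
      apply: ler_prod => i _; rewrite nc_ge0 /=; apply: le_trans (ncB _ _) _.
      by have := ts i; lra.
    by rewrite prodr_const cardC1 card_ord.
  by rewrite lef_pV2 ?posrE ?hP //; exact: lt_le_trans (hP k).
have Lam0 : 0 <= Lam by apply: le_trans (LB 0 _); rewrite ?nc_ge0 // nc0 ltW.
have sr' : sigma < rho by lra.
have u : uniq (codom t) by apply/injectiveP.
have h : forall x, x \in codom t -> nc x <= sigma /\ f x - L.[x] = 0.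
  by move=> x /codomP[k ->]; rewrite ts Lt subrr.
have hfL : lquot_on rho (fun z => f z - L.[z]).
  by move=> z zr; apply: lquotB_horner; exact: hf.
have hML z : nc z <= rho -> nc (f z - L.[z]) <= M + Lam.
  by move=> zr; apply: le_trans (ncB _ _) _; rewrite lerD ?hM ?LB.
have r00 : nc (0 : R[i]) <= rho by rewrite nc0 ltW.
have := zeros_bound s0 sr' u h hfL hML r00.
rewrite size_codom card_ord => hz.
have -> : f 0 = (f 0 - L.[0]) + L.[0] by ring.
apply: le_trans (ncD _ _) _; rewrite addrC lerD ?LB //.
apply: le_trans hz _.
have Q0 : 0 <= M + Lam by apply: le_trans (hML 0 r00); exact: nc_ge0.
rewrite mulrCA [X in X <= _]mulrC; apply: ler_wpM2r => //.
have rs : 0 < rho - sigma by lra.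
rewrite ler_pdivrMr ?exprn_gt0 // -exprMn.
have -> : \prod_(x <- codom t) nc (0 - x) = \prod_(k < m.+1) nc (0 - t k).
  by rewrite /codom /image_mem big_map big_enum.
apply: le_trans (_ : \prod_(k < m.+1) (2 / 3 * (rho - sigma)) <= _); last first.
  by rewrite prodr_const card_ord.
apply: ler_prod => k _; rewrite nc_ge0 sub0r ncN /=.
by have := ts k; lra.
Qed.

Lemma lquot_lipschitz f (rho M : R) : 1 <= rho -> lquot_on rho f ->
  (forall z, nc z <= rho -> nc (f z) <= M) -> nc (f 1 - f 0) <= 2 * M / rho.
Proof.
move=> rho1 hf hM.
have r0 : nc (0 : R[i]) <= rho by rewrite nc0; lra.
have hf' : lquot_on rho (fun z => f z - f 0).
  move=> z zr; have := lquotB_horner (f 0)%:P (hf z zr).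
  by apply: (lquot_ext ltr01) => w _; rewrite hornerC.
have hM' z : nc z <= rho -> nc (f z - f 0) <= 2 * M.
  by move=> zr; apply: le_trans (ncB _ _) _; have := hM _ zr; have := hM _ r0; lra.
have h : forall x : R[i], x \in [:: 0] -> nc x <= 0 /\ f x - f 0 = 0.
  by move=> x; rewrite inE => /eqP ->; rewrite subrr nc0.
have rho0 : 0 < rho by lra.
have r1 : nc (1 : R[i]) <= rho by rewrite nc1.
have := zeros_bound (lexx 0) rho0 (s := [:: 0]) isT h hf' hM' r1.
by rewrite big_seq1 !subr0 nc1 mul1r expr1.
Qed.

End Interpolation.

(** * Analytic functions of several variables on complex lines *)

Section LineRestriction.
Variables (R : realType) (d : nat).
Implicit Types (k : {ffun 'I_d -> nat}) (c : {ffun 'I_d -> nat} -> R[i]).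
Implicit Types (x v : 'rV[R[i]]_d) (phi : 'rV[R[i]]_d -> R[i]).

Definition mdeg k := (\sum_i k i)%N.

(** The entries of such a multi-index are at most m, so a finite function type can be enumerated. *)
Definition multi_of_deg (m : nat) : seq {ffun 'I_d -> nat} :=
  map (fun f : {ffun 'I_d -> 'I_m.+1} => [ffun i => val (f i)])
    (enum [pred f : {ffun 'I_d -> 'I_m.+1} | (\sum_i f i == m)%N]).

Lemma mem_multi_of_deg m k : (k \in multi_of_deg m) = (mdeg k == m).
Proof.
apply/mapP/eqP => [[f + ->]|km].
  rewrite mem_enum => /eqP fm.
  by rewrite -[RHS]fm; apply: eq_bigr => i _; rewrite ffunE.
have kl i : (k i < m.+1)%N.
  by rewrite ltnS -km /mdeg (bigD1 i) //= leq_addr.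
exists [ffun i => Ordinal (kl i)]; last by apply/ffunP => i; rewrite !ffunE.
by rewrite mem_enum inE -[X in _ == X]km; apply/eqP/eq_bigr => i _; rewrite ffunE.
Qed.

Lemma multi_of_deg_uniq m : uniq (multi_of_deg m).
Proof.
rewrite map_inj_uniq ?enum_uniq // => f g /ffunP fg; apply/ffunP => i; apply: val_inj.
by have := fg i; rewrite !ffunE.
Qed.

Fixpoint multi_below (n : nat) : seq {ffun 'I_d -> nat} :=
  if n is n'.+1 then multi_below n' ++ multi_of_deg n' else [::].

Lemma mem_multi_below n k : (k \in multi_below n) = (mdeg k < n)%N.
Proof.
by elim: n => //= n IH; rewrite mem_cat IH mem_multi_of_deg ltnS [RHS]leq_eqVlt orbC.
Qed.

Lemma multi_below_uniq n : uniq (multi_below n).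
Proof.
elim: n => //= n IH; rewrite cat_uniq IH multi_of_deg_uniq andbT /=.
by apply/hasPn => k; rewrite mem_multi_of_deg mem_multi_below => /eqP ->; rewrite ltnn.
Qed.

Lemma multi_monomialZ k (z : R[i]) v :
  multi_monomial k (z *: v) = z ^+ mdeg k * multi_monomial k v.
Proof.
rewrite /multi_monomial /mdeg expr_sum -big_split /=.
by apply: eq_bigr => i _; rewrite mxE exprMn.
Qed.

Lemma psum_multi_below c v z n :
  psum (fun m => \sum_(k <- multi_of_deg m) c k * multi_monomial k v) z n =
  \sum_(k <- multi_below n) c k * multi_monomial k (z *: v).
Proof.
elim: n => [|n IH]; first by rewrite /psum big_ord0 big_nil.
rewrite /psum big_ord_recr /= big_cat -IH; congr (_ + _).
rewrite mulr_suml; apply: eq_big_seq => k; rewrite mem_multi_of_deg => /eqP <-.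
by rewrite multi_monomialZ mulrCA mulrC.
Qed.

Lemma cenormZ z v : cenorm (z *: v) = nc z * cenorm v.
Proof.
rewrite /cenorm -[nc z in RHS]ger0_norm ?nc_ge0 // -sqrtr_sqr -sqrtrM ?sqr_ge0 //.
congr (Num.sqrt _); rewrite mulr_sumr; apply: eq_bigr => i _.
by rewrite mxE ncM exprMn.
Qed.

(** Grouping monomials by total degree turns the partial sums of the one-variable series into sums
    over [multi_below n]. These sets eventually contain any given finite set of multi-indices, so
    convergence along finite sets applies. The denominator is 1. *)
Lemma analytic_at_lquot phi x v z0 : analytic_at phi (x + z0 *: v) ->
  lquot (fun z => phi (x + z *: v)) z0.
Proof.
move=> [c [r [r0 H]]].
have v1 : 0 < cenorm v + 1 by rewrite ltr_wpDl // sqrtr_ge0.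
exists (fun m => \sum_(k <- multi_of_deg m) c k * multi_monomial k v), 1,
  (r / (cenorm v + 1)); split; first exact: divr_gt0.
  by rewrite hornerC oner_eq0.
move=> z zr; have hz : cenorm (z *: v) < r.
  move: zr; rewrite ltr_pdivlMr // cenormZ.
  by have := nc_ge0 z; nra.
have [_ /cvgrPdist_lt lim] := H _ hz.
rewrite hornerC mulr1 scalerDl addrA => e e0.
have [|A _ hA] := lim _ e e0; first exact: totally_filter.
exists (\max_(k : A) (mdeg (val k))).+1 => n nA.
rewrite psum_multi_below.
have /hA /= : [set B | (A `<=` B)%fset] (seq_fset tt (multi_below n)).
  apply/fsubsetP => k kA; rewrite seq_fsetE mem_multi_below.
  by apply: leq_trans nA; rewrite ltnS; exact: (leq_bigmax [` kA]%fset).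
rewrite sub0r normrN ger0_norm ?nc_ge0 // /partial_sum.
rewrite -(big_seq_fsetE _ _ xpredT (fun k => c k * multi_monomial k (z *: v))) /=.
rewrite (perm_big _ (seq_fset_perm tt (multi_below n))).
by rewrite undup_id // multi_below_uniq.
Qed.

End LineRestriction.

(** * Euclidean norms on real and complex row vectors *)

Section EuclideanNorms.
Variables (R : realType) (d : nat).
Implicit Types (a b : 'I_d -> R) (x y v : 'rV[R]_d).

Lemma cauchy_schwarz a b :
  (\sum_i a i * b i) ^+ 2 <= (\sum_i a i ^+ 2) * (\sum_i b i ^+ 2).
Proof.
set A := \sum_i a i ^+ 2; set B := \sum_i b i ^+ 2; set C := \sum_i a i * b i.
have B0 : 0 <= B by apply: sumr_ge0 => i _; exact: sqr_ge0.
have [B00|Bn0] := eqVneq B 0.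
  have b0 i : b i = 0.
    have := psumr_eq0P (P := xpredT) (fun i _ => sqr_ge0 (b i)) B00 => /(_ i isT).
    by move=> /eqP; rewrite sqrf_eq0 => /eqP.
  have -> : C = 0 by apply: big1 => i _; rewrite b0 mulr0.
  by rewrite B00 mulr0 expr0n.
have Bp : 0 < B by rewrite lt_neqAle eq_sym Bn0.
have : 0 <= \sum_i (B * a i - C * b i) ^+ 2 by apply: sumr_ge0 => i _; exact: sqr_ge0.
have -> : \sum_i (B * a i - C * b i) ^+ 2 = B * (A * B - C ^+ 2).
  rewrite (eq_bigr (fun i => B ^+ 2 * a i ^+ 2 - 2 * B * C * (a i * b i)
     + C ^+ 2 * b i ^+ 2)); last by move=> i _; ring.
  by rewrite big_split /= big_split /= sumrN -!mulr_sumr -/A -/B -/C; ring.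
by rewrite pmulr_rge0 // subr_ge0.
Qed.

Lemma l2_triangle a b :
  Num.sqrt (\sum_i (a i + b i) ^+ 2) <=
  Num.sqrt (\sum_i a i ^+ 2) + Num.sqrt (\sum_i b i ^+ 2).
Proof.
set A := \sum_i a i ^+ 2; set B := \sum_i b i ^+ 2.
have A0 : 0 <= A by apply: sumr_ge0 => i _; exact: sqr_ge0.
have B0 : 0 <= B by apply: sumr_ge0 => i _; exact: sqr_ge0.
rewrite -[X in _ <= X]ger0_norm ?addr_ge0 ?sqrtr_ge0 // -sqrtr_sqr.
apply: ler_wsqrtr; rewrite sqrrD !sqr_sqrtr //.
rewrite (eq_bigr (fun i => a i ^+ 2 + 2 * (a i * b i) + b i ^+ 2)); last first.
  by move=> i _; ring.
rewrite big_split /= big_split /= -mulr_sumr -/A -/B lerD2r lerD2l -[X in _ <= X]mulr_natl.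
rewrite ler_pM2l // -sqrtrM //; apply: le_trans (ler_norm _) _.
by rewrite -sqrtr_sqr; apply: ler_wsqrtr; exact: cauchy_schwarz.
Qed.

Lemma l2_mono a b : (forall i, 0 <= a i) -> (forall i, a i <= b i) ->
  Num.sqrt (\sum_i a i ^+ 2) <= Num.sqrt (\sum_i b i ^+ 2).
Proof.
move=> a0 ab; apply: ler_wsqrtr; apply: ler_sum => i _.
by rewrite ler_pXn2r // nnegrE ?(le_trans (a0 i)).
Qed.

Lemma renorm_ge0 x : 0 <= renorm x.
Proof. exact: sqrtr_ge0. Qed.

Lemma renorm_triangle x y : renorm (x + y) <= renorm x + renorm y.
Proof.
have := l2_triangle (fun i => x ord0 i) (fun i => y ord0 i).
by congr (Num.sqrt _ <= _); apply: eq_bigr => i _; rewrite mxE.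
Qed.

Lemma renormN x : renorm (- x) = renorm x.
Proof. by congr Num.sqrt; apply: eq_bigr => i _; rewrite mxE sqrrN. Qed.

Lemma renormZ (t : R) x : renorm (t *: x) = `|t| * renorm x.
Proof.
rewrite /renorm -sqrtr_sqr -sqrtrM ?sqr_ge0 // mulr_sumr; congr Num.sqrt.
by apply: eq_bigr => i _; rewrite mxE exprMn.
Qed.

Lemma coord_le_renorm x i : `|x ord0 i| <= renorm x.
Proof.
rewrite -sqrtr_sqr; apply: ler_wsqrtr; rewrite (bigD1 i) //= lerDl.
by apply: sumr_ge0 => j _; exact: sqr_ge0.
Qed.

Lemma renorm_le_sum x : renorm x <= \sum_i `|x ord0 i|.
Proof.
have S0 : 0 <= \sum_i `|x ord0 i| by apply: sumr_ge0 => i _.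
rewrite -[X in _ <= X]ger0_norm // -sqrtr_sqr; apply: ler_wsqrtr.
rewrite expr2 mulr_suml; apply: ler_sum => i _.
rewrite -real_normK ?num_real // expr2 ler_wpM2l // (bigD1 i) //= lerDl.
by apply: sumr_ge0 => j _.
Qed.

Lemma cenorm_line x v (z : R[i]) :
  cenorm (of_real_vec x + z *: of_real_vec v) <= renorm x + nc z * renorm v.
Proof.
apply: le_trans (_ : Num.sqrt (\sum_i (`|x ord0 i| + nc z * `|v ord0 i|) ^+ 2) <= _).
  apply: (@l2_mono (fun i => nc _)) => i; first exact: nc_ge0.
  by rewrite !mxE; apply: le_trans (ncD _ _) _; rewrite ncM !nc_real.
apply: le_trans (l2_triangle _ _) _.
rewrite le_eqVlt; apply/orP; left; apply/eqP; congr (_ + _).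
  by congr Num.sqrt; apply: eq_bigr => i _; rewrite real_normK ?num_real.
rewrite -[nc z in RHS]ger0_norm ?nc_ge0 // -sqrtr_sqr -sqrtrM ?sqr_ge0 //.
congr Num.sqrt; rewrite mulr_sumr; apply: eq_bigr => i _.
by rewrite exprMn real_normK ?num_real.
Qed.

End EuclideanNorms.

(** * The function on complexified real lines inside the disc *)

Section RealLines.
Variables (R : realType) (d : nat) (phi : 'rV[R[i]]_d -> R[i]) (M : R).
Hypothesis aphi : analytic_on (cdisc 0 10) phi.
Hypothesis bphi : forall z, cdisc 0 10 z -> nc (phi z) <= M.
Implicit Types x v p q : 'rV[R]_d.

Definition on_line x v (z : R[i]) : R[i] := phi (of_real_vec x + z *: of_real_vec v).

Lemma on_line_cdisc x v (rho : R) : renorm x + rho * renorm v <= 10 ->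
  forall z, nc z <= rho -> cdisc 0 10 (of_real_vec x + z *: of_real_vec v).
Proof.
move=> h z zr; rewrite /cdisc /= subr0; apply: le_trans (cenorm_line _ _ _) _.
apply: le_trans h; rewrite lerD2l ler_wpM2r ?renorm_ge0 //.
Qed.

Lemma on_line_lquot x v (rho : R) : renorm x + rho * renorm v <= 10 ->
  lquot_on rho (on_line x v).
Proof.
by move=> h z zr; apply: analytic_at_lquot; apply: aphi; exact: on_line_cdisc h _ zr.
Qed.

Lemma on_line_le x v (rho : R) : renorm x + rho * renorm v <= 10 ->
  forall z, nc z <= rho -> nc (on_line x v z) <= M.
Proof. by move=> h z zr; apply: bphi; exact: on_line_cdisc h _ zr. Qed.

Lemma on_lineE x v (t : R) :
  on_line x v (real_complex R t) = phi (of_real_vec (x + t *: v)).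
Proof.
congr phi; apply/rowP => i; rewrite !mxE -[in RHS]/(real_complex R _) rmorphD.
by rewrite rmorphM.
Qed.

(** On the line through p and q the parameter disc of radius 6 / eta is admissible, because 4 + 6 =
    10; the Schwarz lemma gives 2 M / (6 / eta). *)
Lemma lipschitz_real p q (eta : R) : renorm p <= 4 -> 0 < eta -> eta <= 6 ->
  renorm (q - p) <= eta ->
  nc (phi (of_real_vec q) - phi (of_real_vec p)) <= M * eta / 3.
Proof.
move=> p4 eta0 eta6 pq.
have h : renorm p + 6 / eta * renorm (q - p) <= 10.
  have : 6 / eta * renorm (q - p) <= 6 / eta * eta.
    by rewrite ler_wpM2l // divr_ge0 // ltW.
  by rewrite divfK ?gt_eqF //; lra.
have r1 : 1 <= 6 / eta by rewrite ler_pdivlMr // mul1r.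
have := lquot_lipschitz r1 (on_line_lquot h) (on_line_le h).
rewrite -[1](rmorph1 (real_complex R)) -[0](rmorph0 (real_complex R)) !on_lineE.
rewrite scale1r scale0r addr0 (addrC p) subrK => /le_trans; apply.
rewrite le_eqVlt; apply/orP; left; apply/eqP; field.
by rewrite gt_eqF.
Qed.

End RealLines.

(** * Representatives of the classes of a map on a finite type *)

Section Representatives.
Variables (T : finType) (K : eqType) (c : T -> K).

Lemma class_repr : exists r : T -> T,
  (forall p, c (r p) = c p) /\ (forall p q, c p = c q -> r p = r q).
Proof.
exists (fun p => odflt p [pick q | c q == c p]); split=> [p|p q pq].
  by case: pickP => [q /eqP //|/(_ p)]; rewrite eqxx.
rewrite pq; case: pickP => [//|/(_ q)]; by rewrite eqxx.
Qed.

End Representatives.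

(** * Fekete points of a finite set *)

Section Fekete.
Variable R : realType.

(** The nodes maximize the product of all mutual distances. Moving the node k alone to p changes
    only the distances to that node, which gives the extremal property. The first alternative covers
    sets with at most m distinct values. *)
Lemma fekete_points (T : finType) (A : {set T}) (t : T -> R) (m : nat) :
  (exists2 s : seq R, (size s <= m)%N & forall p, p \in A -> t p \in s) \/
  (exists f : 'I_m.+1 -> T, [/\ forall i, f i \in A, injective (t \o f) &
    forall k p, p \in A ->
      \prod_(i | i != k) `|t p - t (f i)| <= \prod_(i | i != k) `|t (f k) - t (f i)|]).
Proof.
pose V := undup [seq t p | p in A].
have [Vm|mV] := leqP (size V) m.
  by left; exists V => // p pA; rewrite mem_undup; apply/fintype.imageP; exists p.
right.
have ex (i : 'I_m.+1) : exists2 p, p \in A & t p = nth 0 V i.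
  have : nth 0 V i \in V by rewrite mem_nth // (leq_trans (ltn_ord i)).
  by rewrite mem_undup => /fintype.imageP[p pA ->]; exists p.
have /fin_all_exists2 [g gA tg] := ex.
pose W (f : {ffun 'I_m.+1 -> T}) := \prod_i \prod_(j | j != i) `|t (f i) - t (f j)|.
pose g' := [ffun i => g i].
pose P (f : {ffun 'I_m.+1 -> T}) := [forall i, f i \in A].
have Pg' : P g' by apply/forallP => i; rewrite ffunE.
have Wg' : 0 < W g'.
  apply: prodr_gt0 => i _; apply: prodr_gt0 => j ji; rewrite normr_gt0 subr_eq0 !ffunE !tg.
  by rewrite nth_uniq ?undup_uniq ?(leq_trans (ltn_ord _)) // eq_sym.
have [f Pf fmax] : exists2 f, P f & forall f', P f' -> W f' <= W f.
  by have [f Pf h] := arg_maxP W Pg'; exists f.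
have Wf : 0 < W f by exact: lt_le_trans (fmax _ Pg').
(* [W] counts every pair of nodes twice, hence the square; the other factor does not involve
   [h k]. *)
have split_W (h : {ffun 'I_m.+1 -> T}) k : W h =
    (\prod_(i | i != k) `|t (h k) - t (h i)|) ^+ 2 *
    \prod_(i | i != k) \prod_(j | (j != i) && (j != k)) `|t (h i) - t (h j)|.
  rewrite /W (bigD1 k) //= expr2 -mulrA; congr (_ * _).
  rewrite -big_split /=; apply: eq_bigr => i ik.
  by rewrite (bigD1 k) 1?eq_sym //= distrC.
have finj : injective (t \o f).
  move=> i j /= e; apply/eqP; apply: contraTT Wf => ij.
  rewrite -leNgt (split_W f i) (bigD1 j) 1?eq_sym //= e subrr normr0 mul0r.
  by rewrite expr0n mul0r.
exists f; split=> // [i|k p pA]; first exact/(forallP Pf).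
pose f' : {ffun 'I_m.+1 -> T} := [ffun i => if i == k then p else f i].
have Pf' : P f'.
  by apply/forallP => i; rewrite ffunE; case: eqP => // _; exact: (forallP Pf).
have := fmax _ Pf'; rewrite (split_W f k) (split_W f' k).
set W2 := (X in _ * X <= _ -> _); set W1 := (X in _ <= _ * X -> _).
have -> : W2 = W1.
  apply: eq_bigr => i ik; apply: eq_bigr => j /andP[ji jk].
  by rewrite !ffunE (negbTE ik) (negbTE jk).
have W10 : 0 < W1.
  apply: prodr_gt0 => i ik; apply: prodr_gt0 => j /andP[ji jk].
  by rewrite normr_gt0 subr_eq0 (inj_eq finj) eq_sym.
rewrite ler_pM2r // ler_pXn2r ?nnegrE ?prodr_ge0 //.
rewrite ffunE eqxx; under eq_bigr => i ik do rewrite ffunE (negbTE ik).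
by [].
Qed.
End Fekete.

(** * Dyadic scales, and points close to many roots *)

Definition hpow (R : realType) (n : nat) : R := (1 / 2) ^+ n.

Section HeavyIntervals.
Variable R : realType.
Implicit Types (s : seq R) (x y : R).

Lemma hpow_gt0 n : 0 < hpow R n.
Proof. by rewrite exprn_gt0. Qed.

Lemma hpow_ge0 n : 0 <= hpow R n.
Proof. exact: ltW (hpow_gt0 n). Qed.

Lemma hpow_le1 n : hpow R n <= 1.
Proof. by rewrite exprn_ile1 //; lra. Qed.

Lemma hpow_anti n n' : (n <= n')%N -> hpow R n' <= hpow R n.
Proof. by move=> nn; rewrite ler_wiXn2l //; lra. Qed.

Lemma hpowD n n' : hpow R (n + n') = hpow R n * hpow R n'.
Proof. exact: exprD. Qed.

Lemma hpowE n : hpow R n = (2 ^+ n)^-1.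
Proof. by rewrite /hpow mul1r exprVn. Qed.

Lemma prodr_const_count (U : Type) (s : seq U) (P : pred U) x :
  \prod_(i <- s | P i) x = x ^+ count P s.
Proof. by rewrite big_const_seq iter_mulr_1. Qed.

Lemma dyadic_layers (J : nat -> nat) (I : nat) (a : R) : hpow R (J 0%N) <= a ->
  (\prod_(i < I) (if a < hpow R (J i.+1) then hpow R (J i) else 1)) *
    hpow R (J I) <= a.
Proof.
have h0 := hpow_ge0; have h1 := hpow_le1.
move=> J0; elim: I => [|I IH]; first by rewrite big_ord0 mul1r.
have p0 : 0 <= \prod_(i < I) (if a < hpow R (J i.+1) then hpow R (J i) else 1).
  by apply: prodr_ge0 => i _; case: ifP.
have p1 : \prod_(i < I) (if a < hpow R (J i.+1) then hpow R (J i) else 1) <= 1.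
  by apply: prodr_ile1 => i _; case: ifP => _; apply/andP; split.
rewrite big_ord_recr /=; case: ltP => h; last first.
  by rewrite mulr1; apply: le_trans h; exact: ler_piMl.
by apply: le_trans IH; apply: ler_piMr => //; exact: mulr_ge0.
Qed.

Lemma heavy_level s x (m I : nat) (J : nat -> nat) : (size s <= m)%N ->
  (forall i, (i <= I)%N -> (count (fun y => `|x - y| < hpow R (J i))%R s < 2 ^ i)%N) ->
  hpow R (\sum_(i < I) J i * 2 ^ i.+1 + J I * m) <= \prod_(y <- s) `|x - y|.
Proof.
move=> sm light.
have h0 n : 0 <= hpow R n by rewrite exprn_ge0.
have anti := hpow_anti.
(* At level 0 fewer than 2^0 close roots means none, which starts [dyadic_layers]. *)
have far y : y \in s -> hpow R (J 0%N) <= `|x - y|.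
  move=> ys; rewrite leNgt; apply/negP => h; have := light _ (leq0n I).
  by rewrite expn0 ltnS leqn0 -leqn0 leqNgt -has_count => /negP; apply; apply/hasP; exists y.
pose lay y := \prod_(i < I) (if `|x - y| < hpow R (J i.+1) then hpow R (J i) else 1).
apply: le_trans (_ : \prod_(y <- s) (lay y * hpow R (J I)) <= _); last first.
  rewrite big_seq [X in _ <= X]big_seq; apply: ler_prod => y ys.
  rewrite dyadic_layers ?far // andbT mulr_ge0 //.
  by apply: prodr_ge0 => i _; case: ifP.
rewrite big_split /= /lay exchange_big /= /hpow exprD; apply: ler_pM.
- exact: exprn_ge0.
- exact: exprn_ge0.
- rewrite expr_sum; apply: ler_prod => i _; rewrite exprn_ge0 //= .
  rewrite -big_mkcond /= prodr_const_count -/(hpow R _) -exprM.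
  apply: anti; rewrite leq_mul2l; apply/orP; right.
  by apply: ltnW; apply: light; exact: ltn_ord.
- rewrite prodr_const_count -exprM; apply: anti.
  by rewrite leq_mul2l count_predT sm orbT.
Qed.

Lemma hpow_archi (x : R) : 0 < x -> exists n, hpow R n <= x.
Proof.
move=> x0; exists (Num.trunc x^-1).+1; rewrite hpowE -[X in _ <= X]invrK.
rewrite lef_pV2 ?posrE ?invr_gt0 ?exprn_gt0 //.
apply: le_trans (ltW (truncnS_gt _)) _.
by rewrite -natrX ler_nat ltnW // ltn_expl.
Qed.

Lemma floor_near (a b : R) : `|a - b| < 1 ->
  Num.floor a \in [:: Num.floor b - 1; Num.floor b; Num.floor b + 1].
Proof.
move=> ab; have /andP[a1 a2] := floor_itv a; have /andP[b1 b2] := floor_itv b.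
move: ab; rewrite ltr_norml => /andP[h1 h2]; rewrite !inE.
set u := Num.floor a in a1 a2 *; set v := Num.floor b in b1 b2 *.
have h3 : u < v + 1 + 1 by rewrite -(ltr_int R) rmorphD; move: h2 a1 b2; lra.
have h4 : v < u + 1 + 1 by rewrite -(ltr_int R) rmorphD; move: h1 a2 b1; lra.
by lia.
Qed.

Lemma le_add_sqr (x th : R) : 0 <= x -> 0 < th -> x <= th + th^-1 * x ^+ 2.
Proof.
move=> x0 th0; have [xt|tx] := leP x th.
  by rewrite ler_wpDr // mulr_ge0 ?sqr_ge0 // invr_ge0 ltW.
rewrite ler_wpDl ?(ltW th0) // expr2 mulrA ler_peMl // mulrC ler_pdivlMr //.
by rewrite mul1r ltW.
Qed.

(* The intervals are those of the grid of mesh [hpow R J]; a root charges at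
   most three of them. *)
Lemma heavy_mass (T : finType) (A : {set T}) (t nu : T -> R) s (J K : nat) (th : R) :
  (forall p, 0 <= nu p) -> 0 < th -> (0 < K)%N ->
  \sum_(p in A | (K <= count (fun y => `|t p - y| < hpow R J)%R s)%N) nu p <=
    3 * (size s)%:R / K%:R * th +
    th^-1 * \sum_(p in A) \sum_(q in A | Num.floor (t q * 2 ^+ J) ==
                                           Num.floor (t p * 2 ^+ J)) nu p * nu q.
Proof.
move=> nu0 th0 K0; pose fl (x : R) := Num.floor (x * 2 ^+ J).
have [r [rc rE]] := class_repr (fun p => fl (t p)).
pose hv p := (K <= count (fun y => `|t p - y| < hpow R J)%R s)%N.
pose H := r @: [set p in A | hv p].
have two0 : 0 < 2 ^+ J :> R by rewrite exprn_gt0.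
have flnear x y : `|x - y| < hpow R J -> fl x \in [:: fl y - 1; fl y; fl y + 1].
  rewrite hpowE -[X in _ < X]mul1r ltr_pdivlMr // => h; apply: floor_near.
  by rewrite -mulrBl normrM (gtr0_norm two0).
have Hinj : {in H &, injective (fun h => fl (t h))}.
  move=> h h' /imsetP[p _ ->] /imsetP[p' _ ->] /=.
  by rewrite !rc => /rE.
pose nr y h := fl (t h) \in [:: fl y - 1; fl y; fl y + 1].
have cardH : (#|H| * K <= 3 * size s)%N.
  rewrite -sum_nat_const.
  apply: (@leq_trans (\sum_(h in H) \sum_(y <- s) nr y h)%N).
    apply: leq_sum => h /imsetP[p]; rewrite inE => /andP[_ hp] ->.
    apply: leq_trans hp _; rewrite -sum1_count big_mkcond /=.
    by apply: leq_sum => y _; case: ifP => // /flnear h1; rewrite /nr rc h1.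
  rewrite exchange_big /= mulnC -sum1_size big_distrl /=.
  apply: leq_sum => y _; rewrite mul1n.
  have <- : #|[set h in H | nr y h]| = (\sum_(h in H) nr y h)%N.
    rewrite -sum1_card big_mkcond [RHS]big_mkcond; apply: eq_bigr => h _.
    by rewrite inE; case: (h \in H); case: (nr y h).
  rewrite cardE -(size_map (fun h => fl (t h))).
  apply: (uniq_leq_size (s2 := [:: fl y - 1; fl y; fl y + 1])).
    rewrite map_inj_in_uniq ?enum_uniq // => h h'.
    by rewrite !mem_enum !inE => /andP[hH _] /andP[h'H _]; exact: Hinj.
  by move=> z /mapP[h]; rewrite mem_enum inE => /andP[_ hy] ->.
pose X h := \sum_(p in A | r p == h) nu p.
have X0 h : 0 <= X h by apply: sumr_ge0.
have eA : \sum_(p in A | hv p) nu p <= \sum_(h in H) X h.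
  have -> : \sum_(p in A | hv p) nu p = \sum_(p in [set p in A | hv p]) nu p.
    by apply: eq_bigl => p; rewrite inE.
  rewrite (partition_big_imset r) /=; apply: ler_sum => h _.
  rewrite big_mkcond [X in _ <= X]big_mkcond /=; apply: ler_sum => p _.
  by rewrite inE; case: (p \in A); case: (hv p); case: (r p == h) => /=; rewrite ?lexx ?nu0.
apply: le_trans eA _.
apply: le_trans (_ : \sum_(h in H) (th + th^-1 * X h ^+ 2) <= _).
  by apply: ler_sum => h _; exact: le_add_sqr.
rewrite big_split /= sumr_const -mulr_sumr; apply: lerD.
  rewrite -[X in X <= _]mulr_natl ler_wpM2r ?(ltW th0) // ler_pdivlMr ?ltr0n //.
  by rewrite -!natrM ler_nat.
rewrite ler_wpM2l ?invr_ge0 ?(ltW th0) //.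
apply: le_trans (_ : \sum_h X h ^+ 2 <= _).
  rewrite [X in _ <= X](bigID (mem H)) /= lerDl.
  by apply: sumr_ge0 => h _; exact: sqr_ge0.
rewrite [X in _ <= X](partition_big r xpredT) //=; apply: ler_sum => h _.
rewrite expr2 {1}/X mulr_suml; apply: ler_sum => p /andP[pA /eqP rp].
rewrite mulr_sumr le_eqVlt; apply/orP; left; apply/eqP; apply: eq_bigl => q.
congr (_ && _); rewrite -rp; apply/eqP/eqP => [/(congr1 (fun x : T => fl (t x)))|/rE //].
by rewrite !rc.
Qed.

End HeavyIntervals.

(** * A finite Frostman lemma for nested partitions *)

Section Frostman.
Variables (R : realType) (T : finType) (K : eqType) (J : nat).
Variables (cl : nat -> T -> K) (f : nat -> R).
Hypothesis f0 : forall n, 0 <= f n.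

Let mass (nu : T -> R) n p := \sum_(q | cl n q == cl n p) nu q.

(** Points are served one by one: each receives the largest mass that its classes still admit, which
    saturates the class of least slack. Classes saturated earlier remain so, since masses only
    grow. *)
Lemma greedy_measure (s : seq T) : exists nu : T -> R,
  [/\ forall p, 0 <= nu p, forall n p, (n <= J)%N -> mass nu n p <= f n &
    forall p, p \in s -> exists2 n, (n <= J)%N & mass nu n p = f n].
Proof.
elim: s => [|x s [nu [nu0 nuf nus]]].
  by exists (fun=> 0); split=> // n p _; rewrite /mass big1.
have [n0 _ n0min] : exists2 n0 : 'I_J.+1, true & forall n : 'I_J.+1,
    f n0 - mass nu n0 x <= f n - mass nu n x.
  have [i _ h] := @arg_minP _ R _ ord0 xpredT (fun n : 'I_J.+1 => f n - mass nu n x) isT.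
  by exists i => // n; exact: h.
set del := f n0 - mass nu n0 x in n0min.
have del0 : 0 <= del by rewrite subr_ge0 nuf // -ltnS.
pose nu' q := nu q + (if q == x then del else 0).
have mE n p : mass nu' n p = mass nu n p + (if cl n x == cl n p then del else 0).
  rewrite /mass /nu' big_split /=; congr (_ + _); case: ifP => h.
    rewrite (bigD1 x) //= eqxx big1 ?addr0 // => q /andP[_ /negbTE ->] //.
  by apply: big1 => q hq; case: eqP => // e; rewrite e h in hq.
have m'f n p : (n <= J)%N -> mass nu' n p <= f n.
  move=> nJ; rewrite mE; case: eqP => h; last by rewrite addr0 nuf.
  have -> : mass nu n p = mass nu n x by apply: eq_bigl => q; rewrite h.
  by have := n0min (Ordinal (nJ : (n < J.+1)%N)) => /=; rewrite lerBrDl.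
exists nu'; split=> // [p|p].
  by rewrite /nu' addr_ge0 //; case: ifP.
rewrite inE => /orP[/eqP ->|/nus[n nJ e]].
  exists n0; first by rewrite -ltnS.
  by rewrite mE eqxx /del addrC subrK.
exists n => //; apply/le_anti; rewrite m'f //= mE -e lerDl.
by case: ifP.
Qed.

(** [N p] is the coarsest saturated level at p. By nestedness two classes selected in this way are
    equal or disjoint, so they partition T and their bounds add up to the total mass. *)
Lemma frostman_cover :
  (forall n p q, cl n.+1 p = cl n.+1 q -> cl n p = cl n q) ->
  exists nu : T -> R, exists (C : {set T}) (N : T -> nat),
  [/\ forall p, 0 <= nu p,
    forall n p, (n <= J)%N -> \sum_(q | cl n q == cl n p) nu q <= f n,
    forall p, (N p <= J)%N,
    forall p, exists2 x, x \in C & cl (N x) p = cl (N x) x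
    & \sum_(x in C) f (N x) = \sum_p nu p].
Proof.
move=> nested; have [nu [nu0 nuf nus]] := greedy_measure (enum T).
have ex p : exists n, (n <= J)%N && (mass nu n p == f n).
  by have [|n nJ e] := nus p; [rewrite mem_enum|exists n; rewrite nJ e eqxx].
pose N p := ex_minn (ex p).
have NP p : (N p <= J)%N /\ mass nu (N p) p = f (N p).
  by rewrite /N; case: ex_minnP => n /andP[nJ /eqP].
have Nmin p n : (n <= J)%N -> mass nu n p = f n -> (N p <= n)%N.
  by move=> nJ e; rewrite /N; case: ex_minnP => m _; apply; rewrite nJ e eqxx.
have nest n n' p q : (n <= n')%N -> cl n' p = cl n' q -> cl n p = cl n q.
  by move=> /subnK <-; elim: (n' - n)%N => //= k IH /nested.
have mass_cl n p q : cl n p = cl n q -> mass nu n p = mass nu n q.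
  by move=> e; apply: eq_bigl => x; rewrite e.
have [r [rc rE]] := class_repr (fun p => (N p, cl (N p) p)).
have rN p : N (r p) = N p by case: (rc p).
have rcl p : cl (N p) (r p) = cl (N p) p by case: (rc p) => <-.
exists nu, (r @: predT), N; split=> // [p|p|].
- by have [] := NP p.
- by exists (r p); [exact: imset_f|rewrite rN rcl]. 
have -> : \sum_p nu p = \sum_(p in predT) nu p by apply: eq_bigl.
rewrite [RHS](partition_big_imset r) /=; apply: eq_bigr => x /imsetP[p _ xp].
have rx : r x = x by rewrite xp; apply: rE; rewrite rN rcl.
rewrite -(NP x).2; apply: eq_bigl => y /=; apply/eqP/eqP => [h|<-].
  have Nyx : (N y <= N x)%N by apply: Nmin; [case: (NP x)|rewrite (mass_cl _ _ _ h) (NP x).2].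
  have h' := nest _ _ _ _ Nyx h.
  have Nxy : (N x <= N y)%N by apply: Nmin; [case: (NP y)|rewrite -(mass_cl _ _ _ h') (NP y).2].
  have e : N y = N x by apply/eqP; rewrite eqn_leq Nyx.
  by rewrite -[RHS]rx; apply: rE; rewrite e h.
by rewrite rN rcl.
Qed.

End Frostman.

(** * Finite covers and the Hausdorff content *)

Section Content.
Variables (R : realType) (d : nat) (F : R -> R).
Hypothesis gF : gauge_function F.

(** The content asks for infinitely many balls of positive radius. The list is continued by balls so
    small that together they cost at most e, as F tends to 0 at 0. *)
Lemma hausdorff_content_le (E : set 'rV[R]_d) (s : seq ('rV[R]_d * R)) :
  (forall xr, xr \in s -> 0 < xr.2) ->
  (forall x, E x -> exists2 xr, xr \in s & open_eball xr.1 xr.2 x) ->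
  (hausdorff_content F E <= (\sum_(xr <- s) F (2 * xr.2))%:E)%E.
Proof.
case: gF => F0 Fmono _ Flim s0 cover.
have Fge0 xr : xr \in s -> 0 <= F (2 * xr.2) by move=> /s0 h; apply: F0; rewrite mulr_gt0.
have geo n : \sum_(0 <= j < n) (1 / 2) ^+ j.+1 = 1 - (1 / 2) ^+ n :> R.
  elim: n => [|n IH]; first by rewrite big_geq // expr0 subrr.
  by rewrite big_nat_recr //= IH exprS; lra.
apply/lee_addgt0Pr => e e0.
have tiny (n : nat) : exists2 r : R, 0 < r & F (2 * r) <= e * (1 / 2) ^+ n.+1.
  have en : 0 < e * (1 / 2) ^+ n.+1 by rewrite mulr_gt0 // exprn_gt0.
  move/cvgrPdist_lt: Flim => /(_ _ en); case=> r /= r0 hr.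
  exists (r / 4); first by rewrite divr_gt0.
  have r40 : 0 < 2 * (r / 4) by lra.
  have := hr (2 * (r / 4)); rewrite /= sub0r normrN gtr0_norm // => /(_ _ r40).
  by rewrite sub0r normrN => H; apply: le_trans (ler_norm _) _; apply/ltW/H; lra.
have [rho rho0 rhoF] : exists2 rho : nat -> R, forall n, 0 < rho n &
    forall n, F (2 * rho n) <= e * (1 / 2) ^+ n.+1.
  have [rho h] := choice (fun n => let: ex_intro2 r p q := tiny n in ex_intro _ r (conj p q)).
  by exists rho => n; case: (h n).
pose u (j : nat) := if (j < size s)%N then nth (0, 1) s j else (0, rho (j - size s)%N).
have uin j : (j < size s)%N -> u j \in s by rewrite /u => js; rewrite js mem_nth.
have u0 j : 0 < (u j).2.
  by rewrite /u; case: ifP => js; [apply: s0; exact: mem_nth|exact: rho0].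
have Fu0 j : 0 <= F (2 * (u j).2) by apply: F0; rewrite mulr_gt0.
apply: (@le_trans _ _ (\sum_(0 <= j <oo) (F (2 * (u j).2))%:E)%E).
  apply: ereal_inf_lbound => /=; exists (fun j => (u j).1), (fun j => (u j).2).
  split=> // x /cover[xr xrs hx]; exists (index xr s) => //=.
  by rewrite /u index_mem xrs nth_index.
apply: lime_le; first by apply: is_cvg_nneseries => n _ _; rewrite lee_fin.
near=> n; rewrite sumEFin -EFinD lee_fin.
apply: le_trans (_ : \sum_(0 <= j < size s + n) F (2 * (u j).2) <= _).
  rewrite [X in _ <= X](big_cat_nat (n := n)) ?leq_addl //= lerDl.
  by apply: sumr_ge0 => j _.
rewrite (big_cat_nat (n := size s)) ?leq_addr //=; apply: lerD.
  rewrite le_eqVlt; apply/orP; left; apply/eqP.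
  rewrite [RHS](big_nth (0, 1)); apply: eq_big_nat => j /andP[_ js].
  by rewrite /u js.
rewrite -{1}[size s]add0n big_addn addKn.
apply: le_trans (_ : \sum_(0 <= j < n) e * (1 / 2) ^+ j.+1 <= _).
  apply: ler_sum => j _; rewrite /u ltnNge leq_addl /= addnK; exact: rhoF.
rewrite -mulr_sumr -[X in _ <= X]mulr1 ler_pM2l //.
by rewrite geo gerBl exprn_ge0.
Unshelve. all: by end_near.
Qed.

End Content.

(** * Dyadic cubes, and the Frostman measure on a subset of E *)

Section DyadicCells.
Variables (R : realType) (d : nat).
Implicit Types (x y : 'rV[R]_d).

Definition cell (n : nat) x : {ffun 'I_d -> int} :=
  [ffun i => Num.floor (x ord0 i * 2 ^+ n)].

Lemma floor_eq_dist (n : nat) (u v : R) :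
  Num.floor (u * 2 ^+ n) = Num.floor (v * 2 ^+ n) -> `|u - v| < hpow R n.
Proof.
move=> e; have p0 : 0 < 2 ^+ n :> R by rewrite exprn_gt0.
rewrite hpowE -[X in _ < X]mul1r ltr_pdivlMr //.
rewrite -{1}(gtr0_norm p0) -normrM mulrBl.
have /andP[] := floor_itv (u * 2 ^+ n); have /andP[] := floor_itv (v * 2 ^+ n).
rewrite e rmorphD /= ltr_norml => *; lra.
Qed.

Lemma cell_dist n x y i : cell n x = cell n y -> `|x ord0 i - y ord0 i| < hpow R n.
Proof. by move=> /ffunP /(_ i); rewrite !ffunE; exact: floor_eq_dist. Qed.

Lemma cell_nested n x y : cell n.+1 x = cell n.+1 y -> cell n x = cell n y.
Proof.
move=> /ffunP h; apply/ffunP => i; have := h i; rewrite !ffunE.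
have half (u : R) : exists2 w, Num.floor (u * 2 ^+ n.+1) = w &
    (2 * Num.floor (u * 2 ^+ n) <= w < 2 * Num.floor (u * 2 ^+ n) + 2)%R.
  exists (Num.floor (u * 2 ^+ n.+1)) => //.
  have := floor_itv (u * 2 ^+ n); have := floor_itv (u * 2 ^+ n.+1).
  rewrite exprS mulrCA; set v := u * 2 ^+ n; set w := Num.floor (2 * v).
  set z := Num.floor v; rewrite !rmorphD /= => /andP[h1 h2] /andP[h3 h4].
  have h5 : 2 * z < w + 1 by rewrite -(ltr_int R) rmorphM rmorphD /=; lra.
  have h6 : w < 2 * z + 2 by rewrite -(ltr_int R) rmorphD rmorphM /=; lra.
  by apply/andP; split; lia.
have [w -> /andP[]] := half (x ord0 i); have [w' -> /andP[]] := half (y ord0 i).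
by move=> ? ? ? ? ?; lia.
Qed.

Lemma cell_nested_le n n' x y : (n <= n')%N -> cell n' x = cell n' y -> cell n x = cell n y.
Proof. by move=> /subnK <-; elim: (n' - n)%N => //= k IH /cell_nested. Qed.

Lemma cell_dist_renorm n x y : (0 < d)%N -> cell n x = cell n y ->
  renorm (x - y) < 2 * d%:R * hpow R n.
Proof.
move=> d0 h; apply: le_lt_trans (renorm_le_sum _) _.
apply: le_lt_trans (_ : \sum_(i < d) hpow R n < _).
  by apply: ler_sum => i _; rewrite !mxE ltW // cell_dist.
rewrite sumr_const card_ord -[X in X < _]mulr_natl ltr_pM2r ?hpow_gt0 //.
by rewrite ltr_pMl ?ltr0n // ltr1n.
Qed.

(** Places integers in a finite type; the code is faithful only between -B and B. *)
Definition int_code (B : nat) (u : int) : 'I_(2 * B).+1 := inord (absz (u + B%:Z)).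

Lemma int_code_inj (B : nat) (u v : int) :
  - B%:Z <= u <= B%:Z -> - B%:Z <= v <= B%:Z -> int_code B u = int_code B v -> u = v.
Proof.
move=> /andP[u1 u2] /andP[v1 v2] /(congr1 val) /=.
rewrite !inordK; [lia|lia|lia].
Qed.

Lemma floor_bound (u : R) (B : nat) : `|u| <= B%:R -> - B%:Z <= Num.floor u <= B%:Z.
Proof.
rewrite ler_norml => /andP[h1 h2]; apply/andP; split.
  by rewrite floor_ge_int rmorphN.
by rewrite -(ler_int R); apply: le_trans (floor_le _) _.
Qed.

(** T has one point of E for each occupied cell of level J. A cell of level n lies in the ball of
    radius 2 d 2^-n about any of its points, whence the diameter 4 d 2^-n in F. The other points of
    E share their cell of level J, hence all coarser ones, with a point of T, so the balls cover
    E. *)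
Lemma frostman_set (F : R -> R) (E : set 'rV[R]_d) (c' : R) (J : nat) :
  (0 < d)%N -> gauge_function F -> (forall x i, E x -> `|x ord0 i| <= 2) ->
  (c'%:E < hausdorff_content F E)%E ->
  exists (T : finType) (pt : T -> 'rV[R]_d) (nu : T -> R),
    [/\ forall p, E (pt p), forall p, 0 <= nu p,
      forall n p, (n <= J)%N ->
        \sum_(q | cell n (pt q) == cell n (pt p)) nu q <= F (4 * d%:R * hpow R n)
      & c' <= \sum_p nu p].
Proof.
move=> d0 gF bE cE; pose B := (2 * 2 ^ J)%N.
pose code x : {ffun 'I_d -> 'I_(2 * B).+1} := [ffun i => int_code B (cell J x i)].
have codeP x y : E x -> E y -> code x = code y -> cell J x = cell J y.
  move=> Ex Ey /ffunP h; apply/ffunP => i; have := h i; rewrite !ffunE.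
  have bd z : E z -> - B%:Z <= Num.floor (z ord0 i * 2 ^+ J) <= B%:Z.
    move=> Ez; apply: floor_bound; rewrite normrM /B natrM natrX.
    by rewrite [ `|2 ^+ J|]gtr0_norm ?exprn_gt0 // ler_wpM2r ?exprn_ge0 ?bE.
  by apply: int_code_inj; exact: bd.
pose P k := asbool (exists2 x, E x & code x = k).
pose T : finType := {k : {ffun 'I_d -> 'I_(2 * B).+1} | P k}.
have ptP (p : T) : exists x, E x /\ code x = val p.
  by have /asboolP[x Ex e] := valP p; exists x.
have [pt hpt] := choice ptP.
pose f n := F (4 * d%:R * hpow R n).
have dr : 0 < d%:R :> R by rewrite ltr0n.
have pos n : 0 < 4 * d%:R * hpow R n by rewrite !mulr_gt0 ?hpow_gt0.
have f0 n : 0 <= f n by case: gF => F0 _ _ _; exact: F0.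
have [|nu [C [N [nu0 nuf NJ Ccov Csum]]]] :=
  @frostman_cover R T _ J (fun n p => cell n (pt p)) f f0.
  by move=> n p q; exact: cell_nested.
exists T, pt, nu; split=> // [p|]; first by case: (hpt p).
rewrite -lee_fin ltW // (lt_le_trans cE) // -Csum.
have -> : \sum_(z in C) f (N z) =
    \sum_(xr <- [seq (pt z, 2 * d%:R * hpow R (N z)) | z <- enum C]) F (2 * xr.2).
  rewrite big_map big_enum; apply: eq_bigr => z _ /=.
  by rewrite /f; congr F; ring.
apply: hausdorff_content_le => // [xr /mapP[z _ ->] /=|x Ex].
  by rewrite !mulr_gt0 ?hpow_gt0.
have Pk : P (code x) by apply/asboolP; exists x.
pose p : T := exist _ (code x) Pk.
have [Ep cp] := hpt p; have [y yC hy] := Ccov p.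
exists (pt y, 2 * d%:R * hpow R (N y)).
  by apply/mapP; exists y; rewrite ?mem_enum.
rewrite /open_eball /=; apply: cell_dist_renorm => //; rewrite -hy.
by apply: cell_nested_le (NJ y) _; apply: codeP.
Qed.

(** The cell of such a point differs from that of x by at most 1 in each coordinate, which leaves
    3^d cells. *)
Lemma near_mass (T : finType) (pt : T -> 'rV[R]_d) (nu : T -> R) (B : R) n x :
  (forall p, 0 <= nu p) -> 0 <= B ->
  (forall p, \sum_(q | cell n (pt q) == cell n (pt p)) nu q <= B) ->
  \sum_(q | [forall i, `|pt q ord0 i - x ord0 i| < hpow R n]) nu q <= 3 ^+ d * B.
Proof.
move=> nu0 B0 hB.
pose code q : {ffun 'I_d -> 'I_3} :=
  [ffun i => int_code 1 (cell n (pt q) i - cell n x i)].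
rewrite (partition_big code xpredT) //=.
apply: le_trans (_ : \sum_(k : {ffun 'I_d -> 'I_3}) B <= _); last first.
  by rewrite sumr_const card_ffun !card_ord -[X in X <= _]mulr_natl natrX.
apply: ler_sum => k _.
have [p /andP[/forallP np /eqP cp]|none] := pickP [pred q |
   [forall i, `|pt q ord0 i - x ord0 i| < hpow R n] && (code q == k)]; last first.
  by rewrite big_pred0.
have inr q i : `|pt q ord0 i - x ord0 i| < hpow R n ->
    - 1%:Z <= cell n (pt q) i - cell n x i <= 1%:Z.
  move=> h; have p0 : 0 < 2 ^+ n :> R by rewrite exprn_gt0.
  have /floor_near : `|pt q ord0 i * 2 ^+ n - x ord0 i * 2 ^+ n| < 1.
    by rewrite -mulrBl normrM (gtr0_norm p0) -ltr_pdivlMr // mul1r -hpowE.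
  by rewrite !ffunE !inE => /or3P[] /eqP ->; lia.
apply: le_trans (hB p); rewrite big_mkcond [X in _ <= X]big_mkcond /=.
apply: ler_sum => q _; case: ifP => [/andP[/forallP nq /eqP cq]|_]; last by case: ifP.
suff -> : cell n (pt q) == cell n (pt p) by [].
apply/eqP/ffunP => i.
have : code q i = code p i by rewrite cp cq.
rewrite [code q i]ffunE [code p i]ffunE => /(int_code_inj (inr _ _ (nq i)) (inr _ _ (np i))).
by move/addIr.
Qed.

End DyadicCells.

(** * Mass estimates over a partition into tubes; counting grid points *)

Section SectorMass.
Variable R : realType.

(** By [heavy_level] each point has, for some i <= I, at least 2^i roots of its own tube within
    [hpow R (Jl i)]. The bounds of [heavy_mass] are then summed over the levels and over the
    tubes. *)
Lemma sector_mass (T K : finType) (c : T -> K) (t nu : T -> R) (m I : nat)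
    (Jl : nat -> nat) (th : nat -> R) :
  (forall p, 0 <= nu p) -> (forall i, 0 < th i) ->
  (forall k : K, exists2 s : seq R, (size s <= m)%N & forall p, c p = k ->
     \prod_(y <- s) `|t p - y| < hpow R (\sum_(i < I) Jl i * 2 ^ i.+1 + Jl I * m)) ->
  (m <= 2 ^ I)%N ->
  \sum_p nu p <= \sum_(i < I.+1)
    (#|K|%:R * (3 * m%:R / 2 ^+ i * th i) +
     (th i)^-1 * \sum_p \sum_(q | (c q == c p) &&
        (Num.floor (t q * 2 ^+ Jl i) == Num.floor (t p * 2 ^+ Jl i))) nu p * nu q).
Proof.
move=> nu0 th0 hs mI.
pose en i (k : K) := \sum_(p in finset (fun p => c p == k)) \sum_(q in finset (fun p => c p == k) |
   Num.floor (t q * 2 ^+ Jl i) == Num.floor (t p * 2 ^+ Jl i)) nu p * nu q.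
have main k : \sum_(p | c p == k) nu p <=
    \sum_(i < I.+1) (3 * m%:R / 2 ^+ i * th i + (th i)^-1 * en i k).
  have [s sm sP] := hs k.
  pose hv i p := (2 ^ i <= count (fun y => `|t p - y| < hpow R (Jl i))%R s)%N.
  apply: le_trans (_ : \sum_(i < I.+1) \sum_(p in finset (fun p => c p == k) | hv i p) nu p <= _).
    under [X in _ <= X]eq_bigr do rewrite big_mkcondr /=.
    rewrite exchange_big /= [X in _ <= X](eq_bigl (fun p => c p == k)); last first.
      by move=> p; rewrite inE.
    apply: ler_sum => p /eqP cp.
    have [i hi] : exists i : 'I_I.+1, hv i p.
      apply: contrapT => nex; have := sP p cp; rewrite ltNge => /negP; apply.
      apply: heavy_level => // i iI; rewrite ltnNge; apply/negP => h; apply: nex.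
      by exists (Ordinal (iI : (i < I.+1)%N)).
    rewrite (bigD1 i) //= hi lerDl; apply: sumr_ge0 => j _.
    by case: ifP.
  apply: ler_sum => i _.
  have K0 : (0 < 2 ^ i)%N by rewrite expn_gt0.
  apply: le_trans (heavy_mass (finset (fun p => c p == k)) t s (Jl i) nu0 (th0 i) K0) _.
  rewrite lerD2r ler_wpM2r ?(ltW (th0 _)) // natrX ler_wpM2r ?invr_ge0 ?exprn_ge0 //.
  by rewrite ler_wpM2l // ler_nat.
rewrite (partition_big c xpredT) //=.
apply: le_trans (ler_sum _ (fun k _ => main k)) _.
rewrite exchange_big /= le_eqVlt; apply/orP; left; apply/eqP.
apply: eq_bigr => i _; rewrite big_split /= sumr_const -[X in X + _]mulr_natl.
congr (_ + _); rewrite -mulr_sumr; congr (_ * _).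
rewrite [RHS](partition_big c xpredT) //=; apply: eq_bigr => k _; rewrite /en.
apply: eq_big => [p|p]; first by rewrite inE.
rewrite inE => /eqP cp; apply: eq_bigl => q.
by rewrite inE cp.
Qed.

Lemma card_small_diam (G : nat) (A : pred 'I_G) (L : R) : 0 <= L ->
  (forall x y, A x -> A y -> `|(val x)%:R - (val y)%:R| < L) ->
  #|A|%:R <= L + 1.
Proof.
move=> L0 hA; have [x0 x0A|A0] := pickP A; last first.
  by rewrite (eq_card0 (A := A)) // addr_ge0.
have [x1 x1A xmin] := arg_minnP (fun x : 'I_G => val x) x0A.
pose N := Num.trunc L.
have inN y : A y -> (val y - val x1 <= N)%N.
  move=> Ay; rewrite truncn_ge_nat // natrB ?xmin //.
  by apply: ltW; apply: le_lt_trans (hA y x1 Ay x1A); exact: ler_norm.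
pose f (y : 'I_G) : 'I_N.+1 := inord (val y - val x1).
have finj : {in A &, injective f}.
  move=> y z Ay Az /(congr1 val) /=; rewrite !inordK ?ltnS ?inN // => e.
  apply: val_inj; have := xmin _ Ay; have := xmin _ Az; move: e => /=.
  by lia.
have : (#|A| <= N.+1)%N.
  by rewrite -(card_in_imset finj) -[X in (_ <= X)%N]card_ord; exact: max_card.
rewrite -(ler_nat R) => /le_trans; apply; rewrite -natr1 lerD2r.
by have /andP[] := truncn_itv L0.
Qed.

(** Fits the condition that two points share a tube: the slope along axis i involves only the
    coordinates 0 and i of the base point. *)
Lemma card_fibred (e G : nat) (P : 'I_G -> 'I_e.+1 -> pred 'I_G)
    (A : pred {ffun 'I_e.+1 -> 'I_G}) (X : R) : 0 <= X ->
  (forall w i, A w -> i != ord0 -> P (w ord0) i (w i)) ->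
  (forall w0 i, i != ord0 -> #|P w0 i|%:R <= X) ->
  #|A|%:R <= G%:R * X ^+ e.
Proof.
move=> X0 AP PX; pose Fm w0 i : pred 'I_G := if i == ord0 then (pred1 w0 : pred 'I_G) else P w0 i.
have Fcard w0 : #|family (Fm w0)|%:R <= X ^+ e.
  rewrite card_family foldrE big_map big_enum /= big_ord_recl /Fm /=.
  rewrite card1 mul1n natr_prod -[X in _ <= _ ^+ X]card_ord -prodr_const.
  by apply: ler_prod => i _; rewrite ler0n /= PX.
have : (#|A| <= \sum_(w0 : 'I_G) #|family (Fm w0)|)%N.
  rewrite -sum1_card (partition_big (fun w : {ffun 'I_e.+1 -> 'I_G} => w ord0) xpredT) //=.
  apply: leq_sum => w0 _; rewrite sum1_card; apply: subset_leq_card.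
  apply/fintype.subsetP => w; rewrite !inE => /andP[Aw /eqP ww].
  apply/familyP => i; rewrite /Fm; case: eqP => [->|/eqP i0]; first by rewrite inE ww.
  by rewrite -ww; exact: AP.
rewrite -(ler_nat R) natr_sum => /le_trans; apply.
apply: le_trans (_ : \sum_(w0 : 'I_G) X ^+ e <= _); first exact: ler_sum.
by rewrite sumr_const card_ord -[X in X <= _]mulr_natl.
Qed.

End SectorMass.

(** * The grid of base points and the tubes issuing from them *)

Section Sectors.
Variables (R : realType) (e J : nat) (a : 'rV[R]_e.+1).
Let d := e.+1.
Let W := {ffun 'I_e.+1 -> 'I_(2 ^ J)}.
Implicit Types (p q : 'rV[R]_e.+1) (w : W) (i : 'I_e.+1).

(** The d coordinates together move a base point by at most 1/10, whence 13/10 = 6/5 + 1/10 in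
    [base_dist]. *)
Definition grid_mesh : R := 1 / (10 * d%:R).

(* The offset 6/5 along the first axis keeps [tpar] between 1/5 and 23/10 on the
   ball of radius 1 about [a], so that slopes are at most 12 in absolute value. *)
Definition base w : 'rV[R]_e.+1 := \row_i (a ord0 i +
  (if i == ord0 then 6 / 5 else 0) + grid_mesh * (w i)%:R * hpow R J).

Definition tpar w p : R := base w ord0 ord0 - p ord0 ord0.

Definition slope w p i : R := (p ord0 i - base w ord0 i) / tpar w p.

(** Axis 0 is left out because the slope along it is -1. As slopes are at most 12 in absolute value
    on the ball, [int_code] is faithful there. *)
Definition sector w p : {ffun 'I_e -> 'I_(2 * (12 * 2 ^ J)).+1} :=
  [ffun i => int_code (12 * 2 ^ J) (Num.floor (slope w p (lift ord0 i) * 2 ^+ J))].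

Lemma grid_mesh_gt0 : 0 < grid_mesh.
Proof. by rewrite divr_gt0 // mulr_gt0 // ltr0n. Qed.

Lemma grid_mesh_le : d%:R * grid_mesh = 1 / 10.
Proof. by rewrite /grid_mesh; field; rewrite pnatr_eq0. Qed.

Lemma grid_mesh_le1 : grid_mesh <= 1 / 10.
Proof.
rewrite -grid_mesh_le ler_peMl ?(ltW grid_mesh_gt0) //.
by rewrite ler1n.
Qed.

Lemma grid_step w i : 0 <= grid_mesh * (w i)%:R * hpow R J <= grid_mesh.
Proof.
have g0 := grid_mesh_gt0; rewrite !mulr_ge0 ?hpow_ge0 ?(ltW g0) //=.
rewrite -mulrA ler_piMr ?(ltW g0) // hpowE ler_pdivrMr ?exprn_gt0 // mul1r.
by rewrite -natrX ler_nat ltnW.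
Qed.

Lemma base_dist w : renorm (base w - a) <= 13 / 10.
Proof.
apply: le_trans (renorm_le_sum _) _.
apply: le_trans (_ : \sum_(i < e.+1) ((if i == ord0 then 6 / 5 else 0) + grid_mesh) <= _).
  apply: ler_sum => i _; rewrite !mxE; have /andP[h1 h2] := grid_step w i.
  rewrite addrC !addrA addNr add0r ger0_norm; first by rewrite lerD2l.
  by rewrite addr_ge0 //; case: ifP => // _; rewrite divr_ge0.
rewrite big_split /= -big_mkcond big_pred1_eq sumr_const card_ord -[X in _ + X]mulr_natl.
by rewrite grid_mesh_le; lra.
Qed.

Lemma tpar_bounds w p : renorm (p - a) <= 1 -> 1 / 5 <= tpar w p <= 23 / 10.
Proof.
move=> pa; have := coord_le_renorm (p - a) ord0; rewrite !mxE => h.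
have := le_trans h pa; rewrite ler_norml => /andP[h1 h2].
rewrite /tpar mxE eqxx; have /andP[h3 h4] := grid_step w ord0.
by have := grid_mesh_le1; lra.
Qed.

Lemma slope_bound w p i : renorm (p - a) <= 1 -> `|slope w p i| <= 12.
Proof.
move=> pa; have /andP[t1 t2] := tpar_bounds w pa; rewrite normrM normfV.
have t0 : 0 < tpar w p by lra.
rewrite ler_pdivrMr ?normr_gt0 ?gt_eqF // (gtr0_norm t0).
have h1 : `|p ord0 i - base w ord0 i| <= renorm (p - base w).
  have -> : p ord0 i - base w ord0 i = (p - base w) ord0 i by rewrite !mxE.
  exact: coord_le_renorm.
have : p - base w = (p - a) + - (base w - a) by rewrite opprB addrA subrK.
move=> E; have := renorm_triangle (p - a) (- (base w - a)); rewrite -E renormN.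
by have := base_dist w; lra.
Qed.

Lemma slope_ord0 w p : renorm (p - a) <= 1 -> slope w p ord0 = -1.
Proof.
move=> pa; have /andP[t1 t2] := tpar_bounds w pa; rewrite /slope.
have -> : p ord0 ord0 - base w ord0 ord0 = - tpar w p by rewrite /tpar opprB.
by rewrite mulNr divff // gt_eqF //; lra.
Qed.

Lemma slopeE w p i : renorm (p - a) <= 1 ->
  p ord0 i = base w ord0 i + tpar w p * slope w p i.
Proof.
move=> pa; have /andP[t1 t2] := tpar_bounds w pa; rewrite /slope.
have t0 : tpar w p != 0 by rewrite gt_eqF //; lra.
by field.
Qed.

Lemma sector_floor w p q i : renorm (p - a) <= 1 -> renorm (q - a) <= 1 ->
  sector w p = sector w q -> i != ord0 ->
  Num.floor (slope w p i * 2 ^+ J) = Num.floor (slope w q i * 2 ^+ J).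
Proof.
move=> pa qa /ffunP h i0; have [j ->] : exists j, i = lift ord0 j.
  by case: (unliftP ord0 i) i0 => [j ->|->]; [exists j|rewrite eqxx].
have := h j; rewrite !ffunE; apply: int_code_inj; apply: floor_bound;
  rewrite normrM [ `|2 ^+ J|]ger0_norm ?exprn_ge0 // natrM natrX;
  by rewrite ler_wpM2r ?exprn_ge0 ?slope_bound.
Qed.

Lemma sector_slope w p q i : renorm (p - a) <= 1 -> renorm (q - a) <= 1 ->
  sector w p = sector w q -> `|slope w p i - slope w q i| < hpow R J.
Proof.
move=> pa qa h; have [->|i0] := eqVneq i ord0.
  by rewrite !slope_ord0 // subrr normr0 hpow_gt0.
by apply: floor_eq_dist; exact: sector_floor.
Qed.

Lemma tparB w p q : tpar w p - tpar w q = q ord0 ord0 - p ord0 ord0.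
Proof. by rewrite /tpar; ring. Qed.

(** In a tube, axis 0 controls the other axes: 12 bounds the slopes, and the discrepancy 2^-J
    between slopes is multiplied by a position of at most 23/10 < 12/5. *)
Lemma sector_coord w p q i : renorm (p - a) <= 1 -> renorm (q - a) <= 1 ->
  sector w p = sector w q ->
  `|p ord0 i - q ord0 i| <= 12 * `|p ord0 ord0 - q ord0 ord0| + 12 / 5 * hpow R J.
Proof.
move=> pa qa h; rewrite (slopeE w i pa) (slopeE w i qa).
have -> : base w ord0 i + tpar w p * slope w p i - (base w ord0 i + tpar w q * slope w q i) =
  slope w p i * (tpar w p - tpar w q) + tpar w q * (slope w p i - slope w q i) by ring.
have /andP[t1 t2] := tpar_bounds w qa.
have hs := sector_slope i pa qa h.
apply: le_trans (ler_normD _ _) _.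
rewrite [ `|slope w p i * _|]normrM [ `|tpar w q * _|]normrM tparB.
rewrite [ `|q ord0 ord0 - _|]distrC; apply: lerD.
  by rewrite ler_wpM2r // slope_bound.
rewrite ger0_norm; last by lra.
apply: ler_pM => //; [lra|lra|exact: ltW].
Qed.

(** For fixed coordinate 0 of the base point, the slopes of p and q along axis i differ by an affine
    function of the coordinate i, with a leading coefficient proportional to the separation along
    axis 0. Two admissible values are thus close to each other; 11 exceeds 2 (23/10)^2. *)
Lemma sector_count p q : renorm (p - a) <= 1 -> renorm (q - a) <= 1 ->
  p ord0 ord0 != q ord0 ord0 ->
  #|[pred w | sector w q == sector w p]|%:R <=
    (2 ^ J)%:R * (11 / (grid_mesh * `|p ord0 ord0 - q ord0 ord0|) + 1) ^+ e.
Proof.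
move=> pa qa pq; set D : R := `|p ord0 ord0 - q ord0 ord0|.
have D0 : 0 < D by rewrite normr_gt0 subr_eq0.
have g0 := grid_mesh_gt0; have s0 := hpow_gt0 R J.
pose bs i (x : 'I_(2 ^ J)) := a ord0 i +
  (if i == ord0 then 6 / 5 else 0) + grid_mesh * x%:R * hpow R J.
pose tp (x0 : 'I_(2 ^ J)) p := bs ord0 x0 - p ord0 ord0.
pose P (x0 : 'I_(2 ^ J)) i (x : 'I_(2 ^ J)) := `|(p ord0 i - bs i x) / tp x0 p - (q ord0 i - bs i x) / tp x0 q| < hpow R J.
have gD : 0 < grid_mesh * D by exact: mulr_gt0.
have L0 : 0 <= 11 / (grid_mesh * D) by apply: divr_ge0 => //; exact: ltW.
apply: (card_fibred (P := P)); first by rewrite addr_ge0.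
  move=> w i /eqP h _; have := sector_slope i pa qa (esym h).
  by rewrite /slope /tpar /base !mxE.
move=> x0 i i0; apply: card_small_diam => // x y Px Py.
pose w : W := [ffun=> x0].
have tE r : tp x0 r = tpar w r by rewrite /tp /tpar /base mxE ffunE.
have /andP[tp1 tp2] := tpar_bounds w pa; have /andP[tq1 tq2] := tpar_bounds w qa.
rewrite -!tE in tp1 tp2 tq1 tq2; have := tparB w p q; rewrite -!tE => tD.
set u := tp x0 p in Px Py tp1 tp2 tD; set v := tp x0 q in Px Py tq1 tq2 tD.
have u0 : 0 < u by lra.
have v0 : 0 < v by lra.
rewrite /P -/u -/v in Px Py.
have uv : u * v <= 529 / 100.
  apply: le_trans (_ : 23 / 10 * (23 / 10) <= _); last by lra.
  by apply: ler_pM => //; exact: ltW.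
have E : ((p ord0 i - bs i x) / u - (q ord0 i - bs i x) / v) -
         ((p ord0 i - bs i y) / u - (q ord0 i - bs i y) / v) =
   grid_mesh * hpow R J * (x%:R - y%:R) * ((u - v) / (u * v)).
  by rewrite /bs (negbTE i0); field; rewrite !gt_eqF.
have : `|grid_mesh * hpow R J * (x%:R - y%:R) * ((u - v) / (u * v))| < 2 * hpow R J.
  rewrite -E; apply: le_lt_trans (ler_normB _ _) _.
  by move: Px Py; lra.
have -> : `|grid_mesh * hpow R J * (x%:R - y%:R) * ((u - v) / (u * v))| =
    `|x%:R - y%:R| * (grid_mesh * D) * (hpow R J / (u * v)).
  have nE (k1 k2 k3 k4 : R) : 0 < k1 -> 0 < k2 ->
      `|k1 * k2 * k3 * (k4 / (u * v))| = `|k3| * (k1 * `|k4|) * (k2 / (u * v)).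
    move=> k10 k20; rewrite !normrM normfV normrM (gtr0_norm k10) (gtr0_norm k20).
    by rewrite (gtr0_norm u0) (gtr0_norm v0); ring.
  by rewrite nE // tD [ `|q ord0 ord0 - _|]distrC.
have uv0 : 0 < u * v by exact: mulr_gt0.
rewrite mulrA ltr_pdivrMr // => h; rewrite ltr_pdivlMr //.
have h2 : 2 * hpow R J * (u * v) <= 11 * hpow R J.
  have : hpow R J * (u * v) <= hpow R J * (529 / 100) by rewrite ler_pM2l.
  by lra.
by rewrite -(ltr_pM2r s0); apply: lt_le_trans h _.
Qed.

End Sectors.

(** * Proportion of base points that put two given points into one tube *)

Section Kernel.
Variables (R : realType) (e J : nat) (a : 'rV[R]_e.+1).
Let W := {ffun 'I_e.+1 -> 'I_(2 ^ J)}.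
Implicit Types (p q : 'rV[R]_e.+1) (w : W) (i : 'I_e.+1).

Definition same_tube (j : nat) w p q : bool := (sector a w q == sector a w p) &&
  (Num.floor (tpar a w q * 2 ^+ j) == Num.floor (tpar a w p * 2 ^+ j)).

(** 331 = 11 * 30 + 1: 11 comes from [sector_count], 30 from the separation [hpow R n / 30] along
    axis 0 in [pair_count], and 1 absorbs the additive term of [sector_count]. *)
Definition kernel_const : R := 331 / grid_mesh R e.

Lemma kernel_const_gt0 : 0 < kernel_const.
Proof. by apply: divr_gt0; [rewrite ltr0n|exact: grid_mesh_gt0]. Qed.

Let nearb n p q := [forall i, `|q ord0 i - p ord0 i| < hpow R n].

Lemma hpow_succ n : hpow R n = 2 * hpow R n.+1.
Proof. by rewrite /hpow exprS; lra. Qed.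

(** Let n <= J be the finest scale at which p and q are near. If J <= n + 4, counting all base
    points is enough. Otherwise some axis separates them by 2^-(n+1), hence axis 0 does so up to a
    constant, and [sector_count] applies. The bound is a sum over scales, although one term
    suffices, so that the sum over q can later be taken scale by scale. *)
Lemma pair_count p q j : renorm (p - a) <= 1 -> renorm (q - a) <= 1 ->
  (4 <= j)%N -> (j <= J)%N ->
  #|[pred w : W | same_tube j w p q]|%:R <= (2 ^ J)%:R *
    \sum_(n < J.+1 | (j - 4 <= n)%N && nearb n p q) (kernel_const * 2 ^+ n) ^+ e.
Proof.
move=> pa qa j4 jJ; have g0 := grid_mesh_gt0 R e; have g1 := grid_mesh_le1 R e.
have kc0 := kernel_const_gt0.
have t0 n : 0 <= (kernel_const * 2 ^+ n) ^+ e.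
  by apply: exprn_ge0; apply: mulr_ge0; [exact: ltW|exact: exprn_ge0].
have [w /= /andP[/eqP sw /eqP fw]|none] := pickP [pred w : W | same_tube j w p q]; last first.
  by rewrite eq_card0 // mulr_ge0 // sumr_ge0.
have D0 : `|p ord0 ord0 - q ord0 ord0| < hpow R j.
  by rewrite -(tparB a w q p); exact: floor_eq_dist.
have sc i := sector_coord i pa qa (esym sw).
(* The shift by 4 comes from 12 + 12/5 < 2^4. *)
have near0 : nearb (j - 4) p q.
  apply/forallP => i; rewrite distrC; apply: le_lt_trans (sc i) _.
  have -> : hpow R (j - 4) = 16 * hpow R j.
    by rewrite -[in RHS](subnK j4) hpowD [hpow R 4]/hpow; lra.
  have := hpow_anti R jJ; have := hpow_gt0 R j.
  by move: D0; lra.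
have ex : exists n, [&& (n <= J)%N, (j - 4 <= n)%N & nearb n p q].
  by exists (j - 4)%N; rewrite near0 leqnn (leq_trans (leq_subr _ _) jJ).
have ub n : [&& (n <= J)%N, (j - 4 <= n)%N & nearb n p q] -> (n <= J)%N.
  by case/andP.
have [n /and3P[nJ jn nn] nmax] := ex_maxnP ex ub.
have term : (kernel_const * 2 ^+ n) ^+ e <= \sum_(n < J.+1 | (j - 4 <= n)%N && nearb n p q)
    (kernel_const * 2 ^+ n) ^+ e.
  rewrite (bigD1 (Ordinal (nJ : (n < J.+1)%N))) /=; last by rewrite jn nn.
  by rewrite lerDl; apply: sumr_ge0.
suff : #|[pred w : W | same_tube j w p q]|%:R <=
    (2 ^ J)%:R * (kernel_const * 2 ^+ n) ^+ e.
  by move=> /le_trans; apply; rewrite ler_wpM2l.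
have [Jn|nJ4] := leqP J (n + 4).
  apply: le_trans (_ : #|W|%:R <= _); first by rewrite ler_nat max_card.
  rewrite card_ffun !card_ord expnS natrM [((2 ^ J) ^ e)%:R]natrX ler_wpM2l //.
  rewrite lerXn2r ?nnegrE ?(exprn_ge0 _ (ltW kc0)) //.
    by apply: mulr_ge0; [exact: ltW|exact: exprn_ge0].
  apply: le_trans (_ : 16 * 2 ^+ n <= _).
    have -> : 16 * 2 ^+ n = 2 ^+ (n + 4) :> R by rewrite exprD; lra.
    by rewrite natrX ler_eXn2l //; lra.
  rewrite ler_pM2r ?exprn_gt0 // /kernel_const ler_pdivlMr //; lra.
have nJ1 : (n.+1 <= J)%N by apply: leq_trans nJ4; rewrite ltnS leq_addr.
have nS : ~~ nearb n.+1 p q.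
  apply/negP => h; suff : (n.+1 <= n)%N by rewrite ltnn.
  by apply: nmax; rewrite nJ1 h andbT (leq_trans jn).
have [i ni] : exists i, ~~ (`|q ord0 i - p ord0 i| < hpow R n.+1).
  by apply/existsP; rewrite -negb_forall.
move: ni; rewrite -leNgt distrC => hi.
have hJ : hpow R J <= hpow R n.+1 / 16.
  have -> : hpow R n.+1 / 16 = hpow R (n.+1 + 4) by rewrite hpowD [hpow R 4]/hpow; lra.
  by apply: hpow_anti; rewrite addSn.
(* The rounding term is at most 3/20 of [hpow R n.+1], which leaves (17/20) / 24 >= 1/30. *)
have hD : hpow R n / 30 <= `|p ord0 ord0 - q ord0 ord0|.
  have := sc i; have := hpow_gt0 R n; have := hpow_succ n.
  by move: hi hJ; lra.
have hn := hpow_gt0 R n.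
have pq : p ord0 ord0 != q ord0 ord0.
  by rewrite -subr_eq0 -normr_gt0; lra.
apply: le_trans (_ : #|[pred w : W | sector a w q == sector a w p]|%:R <= _).
  rewrite ler_nat; apply: subset_leq_card; apply/fintype.subsetP => w' /=.
  by rewrite !inE => /andP[].
apply: le_trans (sector_count J pa qa pq) _; rewrite ler_wpM2l //.
set D := `|_ - _| in hD *; have Dp : 0 < D by lra.
have gD : 0 < grid_mesh R e * D by exact: mulr_gt0.
have X0 : 0 <= 11 / (grid_mesh R e * D) by apply: divr_ge0 => //; exact: ltW.
rewrite lerXn2r ?nnegrE //; first by rewrite addr_ge0.
  by apply: mulr_ge0; [exact: ltW|exact: exprn_ge0].
have two1 : 1 <= 2 ^+ n :> R by rewrite exprn_ege1 //; lra.
have hE : hpow R n * 2 ^+ n = 1 by rewrite hpowE mulVf // expf_neq0.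
apply: le_trans (_ : 330 * 2 ^+ n / grid_mesh R e + 2 ^+ n / grid_mesh R e <= _); last first.
  by rewrite -mulrDl /kernel_const le_eqVlt; apply/orP; left; apply/eqP; ring.
apply: lerD; last by rewrite ler_pdivlMr //; lra.
rewrite ler_pdivrMr //.
have -> : 330 * 2 ^+ n / grid_mesh R e * (grid_mesh R e * D) = 330 * (D * 2 ^+ n).
  move: (grid_mesh R e) g0 => g gp; field.
  by rewrite gt_eqF.
have : hpow R n * 2 ^+ n / 30 <= D * 2 ^+ n.
  by rewrite mulrAC ler_pM2r // exprn_gt0.
by rewrite hE; lra.
Qed.

Lemma kernel_sum (T : finType) (pt : T -> 'rV[R]_e.+1) (nu : T -> R) (f : nat -> R) j :
  (forall x, renorm (pt x - a) <= 1) -> (forall x, 0 <= nu x) -> (forall n, 0 <= f n) ->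
  (forall n x, (n <= J)%N -> \sum_(y | cell n (pt y) == cell n (pt x)) nu y <= f n) ->
  (4 <= j)%N -> (j <= J)%N ->
  \sum_(w : W) \sum_x \sum_(y | same_tube j w (pt x) (pt y)) nu x * nu y <=
  (\sum_x nu x) * ((2 ^ J)%:R * \sum_(n < J.+1 | (j - 4 <= n)%N)
     (kernel_const * 2 ^+ n) ^+ e * (3 ^+ e.+1 * f n)).
Proof.
move=> pa nu0 f0 nuf j4 jJ.
have t0 n : 0 <= (kernel_const * 2 ^+ n) ^+ e.
  by apply: exprn_ge0; apply: mulr_ge0; [exact/ltW/kernel_const_gt0|exact: exprn_ge0].
rewrite exchange_big /= mulr_suml; apply: ler_sum => x _.
under eq_bigr do rewrite -mulr_sumr.
rewrite -mulr_sumr ler_wpM2l //.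
rewrite [X in X <= _](eq_bigr (fun w : W =>
  \sum_y (if same_tube j w (pt x) (pt y) then nu y else 0))); last first.
  by move=> w _; rewrite big_mkcond.
rewrite exchange_big /=.
apply: le_trans (_ : \sum_y (2 ^ J)%:R * (\sum_(n < J.+1 | (j - 4 <= n)%N && nearb n (pt x) (pt y))
    (kernel_const * 2 ^+ n) ^+ e) * nu y <= _).
  apply: ler_sum => y _; rewrite -big_mkcond /= sumr_const -[X in X <= _]mulr_natl.
  by rewrite ler_wpM2r //; exact: pair_count.
rewrite [X in X <= _](eq_bigr (fun y => (2 ^ J)%:R * \sum_(n < J.+1 | (j - 4 <= n)%N)
    (if nearb n (pt x) (pt y) then (kernel_const * 2 ^+ n) ^+ e * nu y else 0))); last first.
  move=> y _; rewrite -mulrA mulr_suml; congr (_ * _).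
  by rewrite big_mkcondr.
rewrite -mulr_sumr ler_wpM2l // exchange_big /=; apply: ler_sum => n jn.
rewrite -big_mkcond /= -mulr_sumr ler_wpM2l //.
by apply: near_mass => // y; apply: nuf; rewrite -ltnS.
Qed.

End Kernel.

(** * Roots attached to a tube *)

Section SectorRoots.
Variables (R : realType) (e J : nat) (a : 'rV[R]_e.+1).
Variables (phi : 'rV[R[i]]_e.+1 -> R[i]) (M : R).
Hypothesis aphi : analytic_on (cdisc 0 10) phi.
Hypothesis bphi : forall z, cdisc 0 10 z -> nc (phi z) <= M.
Hypothesis a1 : renorm a <= 1.
Let W := {ffun 'I_e.+1 -> 'I_(2 ^ J)}.

Lemma prod_map_filter (m : nat) (t : 'I_m.+1 -> R) k x :
  \prod_(y <- [seq t i | i <- enum (predC1 k)]) `|x - y| = \prod_(i | i != k) `|x - t i|.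
Proof. by rewrite big_map big_enum. Qed.

Lemma nc_realB (x y : R) : nc (real_complex R x - real_complex R y) = `|x - y|.
Proof. by rewrite -rmorphB nc_real. Qed.

Lemma tubular_point (w : W) (p u : 'rV[R]_e.+1) : renorm (p - a) <= 1 ->
  (forall i, `|slope a w p i - u ord0 i| <= hpow R J) ->
  renorm (p - (base a w + tpar a w p *: u)) <= 3 * e.+1%:R * hpow R J.
Proof.
move=> pa su; have /andP[t1 t2] := tpar_bounds w pa.
apply: le_trans (renorm_le_sum _) _.
apply: le_trans (_ : \sum_(i < e.+1) 3 * hpow R J <= _); last first.
  by rewrite sumr_const card_ord -[X in X <= _]mulr_natl mulrA [_%:R * 3]mulrC.
apply: ler_sum => i _.
have -> : (p - (base a w + tpar a w p *: u)) ord0 i =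
    tpar a w p * (slope a w p i - u ord0 i).
  have : (p - (base a w + tpar a w p *: u)) ord0 i =
    p ord0 i - (base a w ord0 i + tpar a w p * u ord0 i) by rewrite !mxE.
  by move=> ->; rewrite [p ord0 i](slopeE w i pa); ring.
rewrite normrM; apply: ler_pM => //.
by rewrite ger0_norm; lra.
Qed.

(** If every Fekete node had product at least 2^-Q, interpolation along the tube would push phi
    below v at the base point, which has parameter 0. So some node k0 has a smaller product, and by
    extremality so has every point of the tube: the roots are the m other nodes. *)
Lemma sector_roots (T : finType) (pt : T -> 'rV[R]_e.+1) (w : W)
    (k : {ffun 'I_e -> 'I_(2 * (12 * 2 ^ J)).+1}) (m Q : nat) (v ep : R) :
  (forall p, renorm (pt p - a) <= 1) ->
  (forall p, nc (phi (of_real_vec (pt p))) <= ep) ->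
  0 < v -> v <= nc (phi (of_real_vec (base a w))) ->
  30 * e.+1%:R * hpow R J <= 1 -> M * (e.+1%:R * hpow R J) <= ep ->
  (2 / 3) ^+ m.+1 * M <= v / 4 ->
  m.+1%:R * 12 ^+ m * 2 ^+ Q * (2 * ep) <= v / 4 ->
  exists2 s : seq R, (size s <= m)%N & forall p, sector a w (pt p) = k ->
    \prod_(y <- s) `|tpar a w (pt p) - y| < hpow R Q.
Proof.
move=> pa pep v0 vb J1 MJ hM hL.
have [[s sm sP]|[f [fA finj fmax]]] :=
    fekete_points (finset (fun p => sector a w (pt p) == k)) (fun p => tpar a w (pt p)) m.
  exists s => // p /eqP pk; rewrite (big_rem (tpar a w (pt p))) /=; last first.
    by apply: sP; rewrite inE.
  by rewrite subrr normr0 mul0r hpow_gt0.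
have {}fA i : sector a w (pt (f i)) = k by have := fA i; rewrite inE => /eqP.
pose t i := tpar a w (pt (f i)).
suff [k0 hk0] : exists k0, \prod_(i | i != k0) `|t k0 - t i| < hpow R Q.
  exists [seq t i | i <- enum (predC1 k0)].
    by rewrite size_map -cardE cardC1 card_ord.
  move=> p pk; rewrite prod_map_filter; apply: le_lt_trans hk0.
  by apply: fmax; rewrite inE pk.
apply: contrapT => nex.
have hQ k0 : hpow R Q <= \prod_(i | i != k0) `|t k0 - t i|.
  by rewrite leNgt; apply/negP => h; apply: nex; exists k0.
(* A common axis for the tube: slopes rounded down to multiples of 2^-J, so that each point lies
   within [eta] of the line at its own parameter [tpar]. *)
pose u : 'rV[R]_e.+1 := \row_i (if i == ord0 then -1 else
  (Num.floor (slope a w (pt (f ord0)) i * 2 ^+ J))%:~R * hpow R J).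
have hu j i : `|slope a w (pt (f j)) i - u ord0 i| <= hpow R J.
  rewrite mxE; case: eqP => [->|/eqP i0].
    by rewrite slope_ord0 // subrr normr0 hpow_ge0.
  rewrite -(sector_floor (pa (f j)) (pa (f ord0))) ?fA //.
  have p0 : 0 < 2 ^+ J :> R by rewrite exprn_gt0.
  have := floor_itv (slope a w (pt (f j)) i * 2 ^+ J); set z := Num.floor _.
  rewrite rmorphD /= hpowE => /andP[h1 h2].
  rewrite -(ler_pM2r p0) -[X in _ * X <= _](gtr0_norm p0) -normrM mulrBl divfK ?gt_eqF //.
  by rewrite mulVf ?gt_eqF // ler_norml; lra.
have dr : 1 <= e.+1%:R :> R by rewrite ler1n.
have tub j := tubular_point (pa (f j)) (hu j).
have hJ := hpow_gt0 R J.
pose eta := 3 * e.+1%:R * hpow R J.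
have eta0 : 0 < eta by rewrite !mulr_gt0 // ltr0n.
have eta1 : eta <= 1 / 10 by rewrite /eta; lra.
have p4 x : renorm (x - a) <= 1 -> renorm x <= 2.
  move=> xa; have := renorm_triangle (x - a) a; rewrite subrK => /le_trans; apply.
  by have -> : 2 = 1 + 1 :> R by []; exact: lerD.
have small j : nc (phi (of_real_vec (base a w + t j *: u))) <= 2 * ep.
  have /= h := lipschitz_real aphi bphi (p := pt (f j)) (q := base a w + t j *: u)
    (eta := eta) _ eta0 _ _.
  have -> : phi (of_real_vec (base a w + t j *: u)) =
    phi (of_real_vec (pt (f j))) + (phi (of_real_vec (base a w + t j *: u)) -
      phi (of_real_vec (pt (f j)))) by rewrite [RHS]addrC subrK.
  apply: le_trans (ncD _ _) _.
  have h1 : M * eta / 3 <= ep by apply: le_trans MJ; rewrite /eta le_eqVlt; apply/orP; left; apply/eqP; field.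
  have h2 := pep (f j).
  suff h3 : nc (phi (of_real_vec (base a w + t j *: u)) - phi (of_real_vec (pt (f j)))) <= M * eta / 3.
    by lra.
  apply: h; [have := p4 _ (pa (f j)); lra|lra|].
  by rewrite -renormN opprB; exact: tub.
have U1 : 1 <= renorm u.
  have := coord_le_renorm u ord0; rewrite mxE eqxx normrN normr1.
  by [].
have U0 : 0 < renorm u by lra.
have ba : renorm (base a w) <= 23 / 10.
  have := renorm_triangle (base a w - a) a; rewrite subrK.
  by have := base_dist a w; move: a1; lra.
have hline : renorm (base a w) + 6 / renorm u * renorm u <= 10.
  by rewrite divfK ?gt_eqF //; lra.
(* 24/10 = 13/10 + 1 + 1/10, from base point, ball and tube; against the radius 6 this is the limit
   case 5 sigma = 2 rho. *)
have node j : nc (real_complex R (t j)) <= (24 / 10) / renorm u.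
  rewrite nc_real ler_pdivlMr // -renormZ.
  have -> : t j *: u = - (pt (f j) - (base a w + t j *: u)) + (pt (f j) - a)
     + - (base a w - a).
    by apply/rowP => i; rewrite !mxE; ring.
  apply: le_trans (renorm_triangle _ _) _; rewrite renormN.
  have := renorm_triangle (- (pt (f j) - (base a w + t j *: u))) (pt (f j) - a).
  rewrite renormN; have := tub j; have := pa (f j); have := base_dist a w.
  by move: eta1; rewrite /eta; lra.
have rinv : (renorm u)^-1 <= 1 by rewrite invf_le1.
have rinv0 : 0 < (renorm u)^-1 by rewrite invr_gt0.
have tinj : injective (fun j => real_complex R (t j)).
  by move=> i j /(congr1 (@complex.Re R)) /= /finj.
have ep0 : 0 <= ep by apply: le_trans (pep (f ord0)); exact: nc_ge0.
have lineE (r : R) : on_line phi (base a w) u (real_complex R r) =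
    phi (of_real_vec (base a w + r *: u)) by exact: on_lineE.
have key := @interpolation_bound R (on_line phi (base a w) u) (6 / renorm u) M
    (24 / 10 / renorm u) (2 * ep) (hpow R Q) m (fun j => real_complex R (t j)).
have /= {key} := key _ _ _ tinj node (on_line_lquot aphi hline) (on_line_le bphi hline).
set L := _ * (2 * ep) => key.
have LB : L <= v / 4.
  apply: le_trans hL; rewrite /L hpowE invrK ler_wpM2r ?mulr_ge0 //.
  rewrite ler_wpM2r ?exprn_ge0 // ler_wpM2l //.
  rewrite lerXn2r ?nnegrE ?mulr_ge0 ?(ltW rinv0) //.
  by have := ltW rinv0; lra.
have : v <= L + (2 / 3) ^+ m.+1 * (M + L).
  apply: le_trans vb _.
  have -> : phi (of_real_vec (base a w)) = on_line phi (base a w) u 0.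
    by rewrite -[0](rmorph0 (real_complex R)) lineE scale0r addr0.
  apply: key.
  - by apply: mulr_ge0; [lra|exact: ltW].
  - by lra.
  - by apply: mulr_gt0.
  - by move=> j; rewrite lineE; exact: small.
  - exact: hpow_gt0.
  - move=> k0; apply: le_trans (hQ k0) _; rewrite le_eqVlt; apply/orP; left; apply/eqP.
    by apply: eq_bigr => i _; exact: esym (nc_realB _ _).
rewrite mulrDr.
have : (2 / 3) ^+ m.+1 * L <= L.
  apply: ler_piMl; last by rewrite exprn_ile1 //; lra.
  rewrite /L mulr_ge0 ?mulr_ge0 ?invr_ge0 ?hpow_ge0 ?exprn_ge0 //.
  by rewrite mulr_ge0 // mulr_ge0 // ltW.
by move: hM LB v0; lra.
Qed.

End SectorRoots.

(** * A Remez inequality on a one-dimensional grid *)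

Section GridRemez.
Variable R : realType.

Lemma sorted_ltn_gap (s : seq nat) i j : sorted ltn s -> (i <= j)%N -> (j < size s)%N ->
  (nth 0 s i + (j - i) <= nth 0 s j)%N.
Proof.
move=> ss /subnKC <-; rewrite addKn; elim: (j - i)%N => [|n IH] hs.
  by rewrite !addn0.
rewrite addnS in hs *; rewrite addnS; apply: leq_ltn_trans (IH (ltnW hs)) _.
by rewrite (sorted_ltn_nth ltn_trans 0%N ss) ?inE // ltnW.
Qed.

Lemma prod_dist_fact (m : nat) (k : 'I_m.+1) :
  \prod_(i < m.+1 | i != k) `|(val k)%:R - (val i)%:R| = (k`! * (m - k)`!)%:R :> R.
Proof.
have lo (n : nat) : \prod_(0 <= i < n) `|n%:R - i%:R| = n`!%:R :> R.
  rewrite fact_prod natr_prod big_nat_rev /= add0n [RHS]big_add1 /=.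
  apply: eq_big_nat => i /andP[_ ik].
  by rewrite -natrB ?leq_subr // subKn // normr_nat.
have hi (n : nat) : \prod_(0 <= i < n) `|(val k)%:R - (i + k.+1)%:R| = n`!%:R :> R.
  rewrite fact_prod natr_prod [RHS]big_add1 /=; apply: eq_big_nat => i _.
  by rewrite addnS -addSn natrD opprD addrCA subrr addr0 normrN normr_nat.
rewrite (big_mkcond (fun i => i != k)) /=.
rewrite (eq_bigr (fun i : 'I_m.+1 => (fun n : nat => if n != k then
  `|(val k)%:R - n%:R| else 1) (val i))) //.
rewrite -(big_mkord xpredT (fun n : nat => if n != k then `|(val k)%:R - n%:R| else 1 : R)).
rewrite (big_cat_nat (n := k)) //=; last exact: ltnW.
rewrite [X in _ * X]big_ltn // eqxx mul1r natrM; congr (_ * _).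
  rewrite -lo; apply: eq_big_nat => i /andP[_ ik].
  by rewrite neq_ltn ik.
rewrite -{1}[k.+1]add0n big_addn subSS -hi; apply: eq_big_nat => i _.
by rewrite neq_ltn addnS ltnS leq_addl orbT.
Qed.

Lemma pow_le_exp_fact (m : nat) : m%:R ^+ m <= expR 1 ^+ m * m`!%:R :> R.
Proof.
elim: m => [|m IH]; first by rewrite !expr0 mul1r fact0.
have [->|m0] := posnP m.
  by rewrite !expr1 (_ : 1`! = 1)%N // mulr1 ltW // expR_gt1.
have mp : 0 < m%:R :> R by rewrite ltr0n.
have step : m.+1%:R ^+ m <= expR 1 * m%:R ^+ m :> R.
  have -> : expR 1 = expR (m%:R^-1) ^+ m :> R.
    by rewrite -expRM_natl mulfV ?gt_eqF.
  rewrite -exprMn; apply: lerXn2r; rewrite ?nnegrE ?mulr_ge0 ?expR_ge0 //.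
  have h : (1 + m%:R^-1) * m%:R <= expR (m%:R^-1) * m%:R :> R.
    by rewrite ler_wpM2r ?expR_ge1Dx.
  by rewrite -natr1 addrC; move: h; rewrite mulrDl mul1r mulVf ?gt_eqF // addrC.
rewrite exprS factS natrM exprS mulrACA [_ * m.+1%:R]mulrC -!mulrA ler_pM2l ?ltr0n //.
apply: le_trans step _; rewrite ler_pM2l ?expR_gt0 //.
Qed.

(** The product is k! (m - k)!, that is m! over a binomial coefficient of size at most 2^m, and m!
    >= (m / expR 1)^m. *)
Lemma prod_dist_lb (m : nat) (k : 'I_m.+1) :
  (m%:R / (2 * expR 1)) ^+ m <= \prod_(i < m.+1 | i != k) `|(val k)%:R - (val i)%:R| :> R.
Proof.
rewrite prod_dist_fact expr_div_n exprMn ler_pdivrMr; last first.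
  by rewrite mulr_gt0 // exprn_gt0 // expR_gt0.
apply: le_trans (pow_le_exp_fact m) _; rewrite mulrC mulrA ler_wpM2r ?exprn_ge0 ?expR_ge0 //.
rewrite -natrX -natrM ler_nat; have km : (k <= m)%N by rewrite -ltnS.
rewrite -(bin_fact km) mulnC leq_mul2l; apply/orP; right; apply: leq_trans (_ : 2 ^ m <= _)%N => //.
rewrite -[X in (_ <= X ^ m)%N](addnn 1) expnDn (bigD1 k) //= !exp1n !muln1.
exact: leq_addr.
Qed.

(** From more than m g bad indices, every g-th one yields m + 1 nodes with successive gaps at least
    g. They are as separated as [prod_dist_lb] requires, and interpolation contradicts the lower
    bound at 0. *)
Lemma remez_grid (f : R[i] -> R[i]) (M v ep h : R) (G m g : nat) (node : 'I_G -> R) :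
  lquot_on 6 f -> (forall z, nc z <= 6 -> nc (f z) <= M) ->
  0 < h -> (forall x y : 'I_G, node x - node y = h * ((val x)%:R - (val y)%:R)) ->
  (forall x, `|node x| <= 24 / 10) ->
  0 < v -> v <= nc (f 0) -> (0 < m)%N -> (0 < g)%N ->
  (2 / 3) ^+ m.+1 * M <= v / 4 ->
  m.+1%:R * (12 / (g%:R * h * m%:R / (2 * expR 1))) ^+ m * ep <= v / 4 ->
  (#|[pred x | (nc (f (real_complex R (node x))) < ep)%R]| <= m * g)%N.
Proof.
move=> hf hM h0 nodeB nodeb v0 vf m0 g0 hsmall hep; set A := (X in #|X|).
rewrite leqNgt; apply/negP => big.
pose s := [seq val x | x <- enum A].
have ss : sorted ltn s.
  have -> : s = [seq val x | x <- [seq x <- enum 'I_G | A x]] by rewrite enumT.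
  rewrite sorted_map; apply: sorted_filter; first by move=> x y z; exact: ltn_trans.
  by have := iota_ltn_sorted 0 G; rewrite -val_enum_ord sorted_map.
have sizes : size s = #|A| by rewrite size_map -cardE.
have Gpos : (0 < G)%N.
  have : (0 < #|'I_G|)%N by apply: leq_trans (max_card A); exact: leq_ltn_trans big.
  by rewrite card_ord.
have idx (i : 'I_m.+1) : (i * g < size s)%N.
  by rewrite sizes; apply: leq_ltn_trans big; rewrite leq_mul2r -ltnS ltn_ord orbT.
have ex (i : 'I_m.+1) : exists2 x, A x & val x = nth 0%N s (i * g).
  have /mapP[x] := mem_nth 0%N (idx i); rewrite mem_enum => Ax e.
  by exists x.
have /fin_all_exists2 [b bA bE] := ex.
have gap (i k : 'I_m.+1) : (i <= k)%N -> (val (b i) + (k - i) * g <= val (b k))%N.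
  by move=> ik; rewrite !bE mulnBl; apply: sorted_ltn_gap => //; rewrite leq_mul2r ik orbT.
have gapR (i k : 'I_m.+1) : g%:R * `|(val k)%:R - (val i)%:R| <= `|(val (b k))%:R - (val (b i))%:R| :> R.
  wlog ik : i k / (i <= k)%N.
    move=> H; case: (leqP i k) => [/H //|/ltnW /H].
    by rewrite [ `|_%:R - _|]distrC [X in _ <= X]distrC.
  have g1 := gap _ _ ik; have ikb : (val (b i) <= val (b k))%N by apply: leq_trans g1; exact: leq_addr.
  rewrite -!natrB // !normr_nat -natrM ler_nat.
  by rewrite mulnC leq_subRL.
pose t i := node (b i).
have gh0 : 0 < g%:R * h by rewrite mulr_gt0 // ltr0n.
pose kap : R := g%:R * h * m%:R / (2 * expR 1).
have E0 : 0 < expR 1 :> R by exact: expR_gt0.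
have kap0 : 0 < kap by rewrite /kap !mulr_gt0 ?invr_gt0 ?mulr_gt0 ?ltr0n.
have sep k : kap ^+ m <= \prod_(i < m.+1 | i != k) `|t k - t i|.
  apply: le_trans (_ : \prod_(i < m.+1 | i != k) (g%:R * h * `|(val k)%:R - (val i)%:R|) <= _); last first.
    apply: ler_prod => i _; rewrite mulr_ge0 ?(ltW gh0) //=.
    rewrite /t nodeB normrM (gtr0_norm h0) mulrAC [X in _ <= X]mulrC.
    by rewrite ler_wpM2r ?(ltW h0) ?gapR.
  rewrite big_split /= prodr_const cardC1 card_ord.
  rewrite /kap -!mulrA exprMn [X in X <= _](_ : _ = (g%:R * h) ^+ m * (m%:R / (2 * expR 1)) ^+ m).
    by rewrite ler_pM2l ?exprn_gt0 // prod_dist_lb.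
  by rewrite -!exprMn; congr (_ ^+ _); rewrite -!mulrA.
have tinj : injective (fun i => real_complex R (t i)).
  move=> i j /(congr1 (@complex.Re R)) /= tij; apply/eqP; apply: contraT => ij.
  have := gapR i j; have : `|t j - t i| = 0 by rewrite tij subrr normr0.
  rewrite /t nodeB normrM => /eqP; rewrite mulf_eq0 normr_eq0 (gt_eqF h0) /= => /eqP ->.
  rewrite pmulr_rle0 ?ltr0n // normr_le0 subr_eq0 eqr_nat eq_sym.
  by move=> /eqP /val_inj e; rewrite e eqxx in ij.
have sb i : nc (real_complex R (t i)) <= 24 / 10 by rewrite nc_real; exact: nodeb.
have fb i : nc (f (real_complex R (t i))) <= ep by have := bA i; exact: ltW.
have P0 : 0 < kap ^+ m by rewrite exprn_gt0.
have sepC k : kap ^+ m <= \prod_(i | i != k) nc (real_complex R (t k) - real_complex R (t i)).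
  apply: le_trans (sep k) _; rewrite le_eqVlt; apply/orP; left; apply/eqP.
  by apply: eq_bigr => i _; exact: esym (nc_realB _ _).
have r60 : 0 < 6 :> R by [].
have s0 : 0 <= 24 / 10 :> R by lra.
have sr : 5 * (24 / 10) <= 2 * 6 :> R by lra.
have /= := interpolation_bound s0 sr r60 tinj sb hf hM fb P0 sepC.
set L := _ * ep => key.
have ep0 : 0 <= ep by apply: le_trans (fb ord0); exact: nc_ge0.
have LE : L = m.+1%:R * (12 / kap) ^+ m * ep.
  have e12 : 2 * 6 = 12 :> R by lra.
  by rewrite /L e12 [(12 / kap) ^+ m]expr_div_n; ring.
have L0 : 0 <= L by rewrite LE !mulr_ge0 ?exprn_ge0 // divr_ge0 // ltW.
have : (2 / 3) ^+ m.+1 * L <= L by apply: ler_piMl => //; rewrite exprn_ile1 //; lra.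
move: key hep hsmall; rewrite -/kap -LE [_ * (M + L)]mulrDr.
by move: vf v0; lra.
Qed.

End GridRemez.

(** * From one large value to large values at half of the base points *)

Section GoodBasePoints.
Variables (R : realType) (e J : nat) (a : 'rV[R]_e.+1).
Variables (phi : 'rV[R[i]]_e.+1 -> R[i]) (M : R) (xs : 'rV[R]_e.+1).
Hypothesis aphi : analytic_on (cdisc 0 10) phi.
Hypothesis bphi : forall z, cdisc 0 10 z -> nc (phi z) <= M.
Hypothesis a1 : renorm a <= 1.
Hypothesis xa : renorm (xs - a) <= 1.
Let d := e.+1.
Let W := {ffun 'I_e.+1 -> 'I_(2 ^ J)}.

Definition replace_coord (G n : nat) (w : {ffun 'I_n -> 'I_G}) (r : 'I_n) (x : 'I_G) :
    {ffun 'I_n -> 'I_G} := [ffun i => if i == r then x else w i].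

(** Swapping [w r] with an extra value x is an involution of the pairs (w, x), so the pairs with w
    in S can be counted along fibres. *)
Lemma card_fibre (G n B : nat) (r : 'I_n) (S : pred {ffun 'I_n -> 'I_G}) :
  (forall w, #|[pred x | S (replace_coord w r x)]| <= B)%N ->
  (#|S| * G <= B * #|{: {ffun 'I_n -> 'I_G}}|)%N.
Proof.
move=> hB; pose h (u : {ffun 'I_n -> 'I_G} * 'I_G) := (replace_coord u.1 r u.2, u.1 r).
have hK : involutive h.
  move=> [w x]; rewrite /h /=; congr pair; last by rewrite ffunE eqxx.
  by apply/ffunP => i; rewrite !ffunE; case: eqP => [->|].
have -> : (#|S| * G)%N = (\sum_(u : {ffun 'I_n -> 'I_G} * 'I_G) S u.1)%N.
  rewrite -(pair_bigA _ (fun w (x : 'I_G) => nat_of_bool (S w))) /=.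
  rewrite -sum1_card big_distrl /= [LHS]big_mkcond; apply: eq_bigr => w _.
  by rewrite big_const_ord iter_addn addn0 /in_mem /=; case: (S w); rewrite ?mul1n ?mul0n.
rewrite (reindex_inj (inv_inj hK)) /=.
rewrite -(pair_bigA _ (fun w x => nat_of_bool (S (replace_coord w r x)))) /=.
rewrite mulnC -sum_nat_const; apply: leq_sum => w _; apply: leq_trans (hB w).
rewrite -sum1_card [X in (_ <= X)%N]big_mkcond; apply: leq_sum => x _.
by rewrite /in_mem /=; case: (S _).
Qed.

(** A walk from [xs] to the base point along lines parallel to the axes. *)
Definition hybrid (r : nat) (w : W) : 'rV[R]_e.+1 :=
  \row_i (if (i < r)%N then base a w ord0 i else xs ord0 i).

Lemma hybrid_norm r w : renorm (hybrid r w) <= 4.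
Proof.
have : renorm (hybrid r w - a) <= 23 / 10.
  apply: le_trans (_ : renorm (base a w - a) + renorm (xs - a) <= _); last first.
    by have := base_dist a w; move: xa; lra.
  have hl2 := l2_triangle (fun i => `|(base a w - a) ord0 i|) (fun i => `|(xs - a) ord0 i|).
  apply: le_trans (_ : Num.sqrt (\sum_i (`|(base a w - a) ord0 i| + `|(xs - a) ord0 i|) ^+ 2) <= _).
    rewrite /renorm; apply: le_trans (_ : Num.sqrt (\sum_i `|(hybrid r w - a) ord0 i| ^+ 2) <= _).
      rewrite le_eqVlt; apply/orP; left; apply/eqP; congr Num.sqrt.
      by apply: eq_bigr => i _; rewrite real_normK ?num_real.
    apply: l2_mono => i //; rewrite [(hybrid r w - a) _ _]mxE [hybrid _ _ _ _]mxE.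
    by case: ifP => _; rewrite [(_ - a) _ _]mxE [(xs - a) _ _]mxE ?lerDl ?lerDr.
  apply: le_trans hl2 _; rewrite le_eqVlt; apply/orP; left; apply/eqP.
  by congr (Num.sqrt _ + Num.sqrt _); apply: eq_bigr => i _; rewrite real_normK ?num_real.
have := renorm_triangle (hybrid r w - a) a; rewrite subrK.
by move: a1; lra.
Qed.

(** The separation in [remez_grid] for nodes g steps apart: as 2^J <= 4 d m g, both J and m
    cancel. *)
Definition remez_const : R := grid_mesh R e / (8 * e.+1%:R * expR 1).

Lemma remez_const_gt0 : 0 < remez_const.
Proof.
apply: divr_gt0; first exact: grid_mesh_gt0.
by rewrite !mulr_gt0 ?expR_gt0 ?ltr0n.
Qed.

(** On each line [remez_grid] allows at most m g <= 2^J / (2 d) bad values out of 2^J, and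
    [card_fibre] makes this a proportion of all base points. *)
Lemma bad_step (r : 'I_e.+1) (v ep : R) (m : nat) :
  0 < v -> 0 <= ep -> (0 < m)%N -> (2 * d * m <= 2 ^ J)%N ->
  (2 / 3) ^+ m.+1 * M <= v / 4 ->
  m.+1%:R * (12 / remez_const) ^+ m * ep <= v / 4 ->
  (#|[pred w : W | (v <= nc (phi (of_real_vec (hybrid r w))))%R &&
     (nc (phi (of_real_vec (hybrid r.+1 w))) < ep)%R]| * (2 * d) <= #|{: W}|)%N.
Proof.
move=> v0 ep0 m0 mJ hM hep; set S := (X in (#|X| * _ <= _)%N).
pose g := (2 ^ J %/ (2 * d * m))%N.
have dm0 : (0 < 2 * d * m)%N by rewrite !muln_gt0 m0.
have g0 : (0 < g)%N by rewrite divn_gt0.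
have gle : (m * g * (2 * d) <= 2 ^ J)%N.
  by rewrite mulnAC [(m * _)%N]mulnC mulnC leq_trunc_div.
have gge : (2 ^ J <= g * (4 * d * m))%N.
  have := ltn_ceil (2 ^ J) dm0; rewrite -/g => h; apply: leq_trans (ltnW h) _.
  have -> : (4 * d * m = 2 * (2 * d * m))%N by rewrite !mulnA.
  by rewrite [(g * _)%N]mulnA leq_mul2r; apply/orP; right; lia.
have hJ := hpow_gt0 R J; have gm0 := grid_mesh_gt0 R e; have rc0 := remez_const_gt0.
suff fib w : (#|[pred x | S (replace_coord w r x)]| <= m * g)%N.
  have := card_fibre fib; rewrite -(leq_pmul2r (m := 2 * d)) ?muln_gt0 // => h.
  have p0 : (0 < 2 ^ J)%N by rewrite expn_gt0.
  rewrite -(leq_pmul2r p0); apply: leq_trans (_ : m * g * #|{: W}| * (2 * d) <= _)%N.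
    by apply: leq_trans h; rewrite mulnAC.
  by rewrite [(m * g * _)%N]mulnC -mulnA leq_mul2l gle orbT.
have hyb_same x : hybrid r (replace_coord w r x) = hybrid r w.
  apply/rowP => i; rewrite !mxE; have [ir|//] := ltnP i r; rewrite ffunE.
  by have [ir'|//] := eqVneq i r; rewrite ir' ltnn in ir.
have [vh|vh] := leP v (nc (phi (of_real_vec (hybrid r w)))); last first.
  rewrite eq_card0 // => x; rewrite /in_mem /= hyb_same.
  by rewrite leNgt vh.
pose node x := base a (replace_coord w r x) ord0 r - xs ord0 r.
have hybS x : hybrid r.+1 (replace_coord w r x) = hybrid r w + node x *: delta_mx ord0 r.
  apply/rowP => i.
  have dE : (node x *: delta_mx ord0 r : 'rV[R]_e.+1) ord0 i = if i == r then node x else 0.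
    by rewrite !mxE eqxx /=; case: eqP; rewrite ?mulr1 ?mulr0.
  have hE n w' : hybrid n w' ord0 i = if (i < n)%N then base a w' ord0 i else xs ord0 i.
    by rewrite mxE.
  have -> : (hybrid r w + node x *: delta_mx ord0 r) ord0 i =
    hybrid r w ord0 i + (node x *: delta_mx ord0 r : 'rV[R]_e.+1) ord0 i by rewrite mxE.
  rewrite dE !hE ltnS leq_eqVlt; have -> : (val i == val r) = (i == r) by [].
  have [->|ir] := eqVneq i r; first by rewrite ltnn /node addrC subrK.
  rewrite addr0 /=; case: (ltnP i r) => // _.
  by rewrite /base !mxE ffunE (negbTE ir).
have dn : renorm (delta_mx ord0 r : 'rV[R]_e.+1) <= 1.
  apply: le_trans (renorm_le_sum _) _; rewrite (bigD1 r) //= mxE !eqxx normr1.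
  rewrite big1 ?addr0 // => i ir; rewrite mxE (negbTE ir) andbF normr0 //.
have hline : renorm (hybrid r w) + 6 * renorm (delta_mx ord0 r : 'rV[R]_e.+1) <= 10.
  by have := hybrid_norm r w; lra.
have hh : 0 < grid_mesh R e * hpow R J by exact: mulr_gt0.
have := @remez_grid R (on_line phi (hybrid r w) (delta_mx ord0 r)) M v ep
  (grid_mesh R e * hpow R J) (2 ^ J) m g node (on_line_lquot aphi hline)
  (on_line_le bphi hline) hh.
have L0 : on_line phi (hybrid r w) (delta_mx ord0 r) 0 = phi (of_real_vec (hybrid r w)).
  by rewrite -[0](rmorph0 (real_complex R)) on_lineE scale0r addr0.
rewrite L0 => key.
apply: leq_trans (key _ _ v0 vh m0 g0 hM _).
- apply: subset_leq_card; apply/fintype.subsetP => x; rewrite !inE => /andP[_].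
  by rewrite on_lineE -hybS.
- by move=> x y; rewrite /node /base !mxE !ffunE eqxx; ring.
- move=> x; rewrite /node.
  have -> : base a (replace_coord w r x) ord0 r - xs ord0 r =
    (base a (replace_coord w r x) - a) ord0 r - (xs - a) ord0 r.
    by rewrite [(_ - a) _ _]mxE [(xs - a) _ _]mxE !mxE; ring.
  apply: le_trans (ler_normB _ _) _.
  have := coord_le_renorm (base a (replace_coord w r x) - a) r.
  have := coord_le_renorm (xs - a) r; have := base_dist a (replace_coord w r x).
  by move: xa; lra.
apply: le_trans hep; rewrite ler_wpM2r // ler_wpM2l //.
have E0 := expR_gt0 (1 : R).
have rle : remez_const <= g%:R * (grid_mesh R e * hpow R J) * m%:R / (2 * expR 1).
  rewrite /remez_const; move: (grid_mesh R e) gm0 => gm gm0'.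
  rewrite ler_pdivrMr; last by rewrite !mulr_gt0 ?ltr0n.
  have -> : g%:R * (gm * hpow R J) * m%:R / (2 * expR 1) * (8 * e.+1%:R * expR 1) =
    gm * (hpow R J * (g%:R * (4 * e.+1%:R * m%:R))).
    by field; rewrite gt_eqF.
  rewrite ler_peMr ?(ltW gm0') // hpowE -ler_pdivrMl ?invr_gt0 ?exprn_gt0 //.
  by rewrite invrK mulr1 -!natrM -natrX ler_nat; rewrite /d in gge.
apply: lerXn2r; rewrite ?nnegrE.
- by apply: divr_ge0 => //; apply: le_trans rle; exact: ltW.
- by apply: divr_ge0 => //; exact: ltW.
by rewrite ler_pM2l // lef_pV2 ?posrE //; exact: lt_le_trans rle.
Qed.

(** Union bound: a base point with a value below [v d] loses too much at one of the d steps, each of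
    which is bad for a proportion of at most 1 / (2 d). *)
Lemma good_count (v : nat -> R) (ms : nat -> nat) :
  v 0%N <= nc (phi (of_real_vec xs)) -> (forall r, 0 < v r) ->
  (forall r, (r < d)%N -> [/\ (0 < ms r)%N, (2 * d * ms r <= 2 ^ J)%N,
     (2 / 3) ^+ (ms r).+1 * M <= v r / 4 &
     (ms r).+1%:R * (12 / remez_const) ^+ ms r * v r.+1 <= v r / 4]) ->
  (2 * #|[pred w : W | (nc (phi (of_real_vec (base a w))) < v d)%R]| <= #|{: W}|)%N.
Proof.
move=> v0 vpos hv.
pose Bad r := [pred w : W | (v r <= nc (phi (of_real_vec (hybrid r w))))%R &&
     (nc (phi (of_real_vec (hybrid r.+1 w))) < v r.+1)%R].
have step (r : 'I_e.+1) : (#|Bad r| * (2 * d) <= #|{: W}|)%N.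
  have [m0 mJ hM hep] := hv r (ltn_ord r).
  have h := @bad_step r (v r) (v r.+1) (ms r) (vpos r) (ltW (vpos r.+1)) m0 mJ hM hep; exact: h.
have cover n (w : W) : (n <= d)%N -> (nc (phi (of_real_vec (hybrid n w))) < v n)%R ->
    exists r : 'I_e.+1, Bad r w.
  elim: n => [|n IH] nd h.
    have h0 : hybrid 0 w = xs by apply/rowP => i; rewrite mxE.
    by move: h; rewrite h0 ltNge v0.
  have [h1|h1] := ltP (nc (phi (of_real_vec (hybrid n w)))) (v n).
    by apply: IH => //; exact: ltnW.
  by exists (Ordinal nd); rewrite /Bad /= h1 h.
have hd w : hybrid d w = base a w by apply/rowP => i; rewrite mxE ltn_ord.
have : (#|[pred w : W | (nc (phi (of_real_vec (base a w))) < v d)%R]| <=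
    \sum_(r < e.+1) #|Bad r|)%N.
  rewrite -sum1_card; under [X in (_ <= X)%N]eq_bigr do rewrite -sum1_card big_mkcond.
  rewrite big_mkcond exchange_big /=; apply: leq_sum => w _.
  case: ifP => // hw; have [|r hr] := cover d w (leqnn d).
    by rewrite hd.
  have hr' : (w \in Bad r) = true by exact: hr.
  by rewrite (bigD1 r) // hr'.
rewrite -(leq_pmul2r (m := 2 * d)) // => /leq_trans h.
have : (#|[pred w : W | (nc (phi (of_real_vec (base a w))) < v d)%R]| * (2 * d) <=
    d * #|{: W}|)%N.
  apply: h; rewrite big_distrl /=.
  apply: (@leq_trans (\sum_(r < e.+1) #|{: W}|)%N); first by apply: leq_sum => r _; exact: step.
  by rewrite sum_nat_const card_ord.
by rewrite mulnA [(_ * 2)%N]mulnC mulnC leq_mul2l.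
Qed.

End GoodBasePoints.

(** * The mass inequality averaged over base points *)

Section MassBound.
Variables (R : realType) (e J : nat) (a : 'rV[R]_e.+1).
Variables (phi : 'rV[R[i]]_e.+1 -> R[i]) (M : R).
Hypothesis aphi : analytic_on (cdisc 0 10) phi.
Hypothesis bphi : forall z, cdisc 0 10 z -> nc (phi z) <= M.
Hypothesis a1 : renorm a <= 1.
Let W := {ffun 'I_e.+1 -> 'I_(2 ^ J)}.

Definition tube_energy (f : nat -> R) (j : nat) : R :=
  \sum_(n < J.+1 | (j - 4 <= n)%N)
     (kernel_const R e * 2 ^+ n) ^+ e * (3 ^+ e.+1 * f n).

(** [sector_mass] holds at the good base points, at least half of them, whence the factor 2. Its
    right-hand side is nonnegative, so the sum may run over all base points, where [kernel_sum]
    applies. *)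
Lemma mass_bound (T : finType) (pt : T -> 'rV[R]_e.+1) (nu : T -> R) (f : nat -> R)
    (m I : nat) (Jl : nat -> nat) (th : nat -> R) (v ep : R) :
  (forall p, renorm (pt p - a) <= 1) ->
  (forall p, nc (phi (of_real_vec (pt p))) <= ep) ->
  (forall p, 0 <= nu p) -> (forall n, 0 <= f n) ->
  (forall n p, (n <= J)%N -> \sum_(q | cell n (pt q) == cell n (pt p)) nu q <= f n) ->
  (forall i, 0 < th i) -> (m <= 2 ^ I)%N ->
  (forall i, (i <= I)%N -> (4 <= Jl i <= J)%N) ->
  0 < v -> 30 * e.+1%:R * hpow R J <= 1 -> M * (e.+1%:R * hpow R J) <= ep ->
  (2 / 3) ^+ m.+1 * M <= v / 4 ->
  m.+1%:R * 12 ^+ m * 2 ^+ (\sum_(i < I) Jl i * 2 ^ i.+1 + Jl I * m) * (2 * ep) <= v / 4 ->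
  (2 * #|[pred w : W | (nc (phi (of_real_vec (base a w))) < v)%R]| <= #|{: W}|)%N ->
  \sum_p nu p <= 2 * \sum_(i < I.+1)
    (25 ^+ e * (3 * m%:R / 2 ^+ i) * th i +
     (\sum_p nu p) * tube_energy f (Jl i) / th i).
Proof.
move=> pa pep nu0 f0 nuf th0 mI JlJ v0 J1 MJ hM hL hgood.
set Nu := \sum_p nu p; set Q := (_ + _)%N in hL.
have G0 : 0 < (2 ^ J)%:R :> R by rewrite ltr0n expn_gt0.
pose K := {ffun 'I_e -> 'I_(2 * (12 * 2 ^ J)).+1}.
(* A base point has of the order of (2^J)^e tubes; with this scaling all powers of 2^J cancel. *)
pose th' i := th i / (2 ^ J)%:R ^+ e.
have th'0 i : 0 < th' i by rewrite divr_gt0 ?exprn_gt0.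
pose En (w : W) (i : nat) := \sum_x \sum_(y | same_tube a (Jl i) w (pt x) (pt y)) nu x * nu y.
pose X (w : W) := \sum_(i < I.+1) (#|{: K}|%:R * (3 * m%:R / 2 ^+ i * th' i) + (th' i)^-1 * En w i).
have En0 w i : 0 <= En w i.
  by apply: sumr_ge0 => x _; apply: sumr_ge0 => y _; exact: mulr_ge0.
have X0 w : 0 <= X w.
  apply: sumr_ge0 => i _; apply: addr_ge0; last by rewrite mulr_ge0 ?invr_ge0 // ltW.
  by rewrite !mulr_ge0 ?invr_ge0 ?exprn_ge0 // ltW.
pose bad := [pred w : W | nc (phi (of_real_vec (base a w))) < v].
have good w : ~~ bad w -> Nu <= X w.
  rewrite /bad /= -leNgt => vb.
  apply: (sector_mass (c := fun p => sector a w (pt p)) (t := fun p => tpar a w (pt p))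
     (Jl := Jl) nu0 th'0 _ mI) => k.
  exact: (sector_roots aphi bphi a1 (pt := pt) k pa pep v0 vb J1 MJ hM hL).
have Nu0 : 0 <= Nu by exact: sumr_ge0.
have half : #|{: W}|%:R * Nu <= 2 * \sum_(w : W) X w.
  apply: le_trans (_ : 2 * (\sum_(w : W | ~~ bad w) Nu) <= _); last first.
    rewrite ler_pM2l // [X in _ <= X](bigID bad) /= addrC.
    by apply: le_trans (ler_sum _ good) _; rewrite lerDl; apply: sumr_ge0.
  rewrite sumr_const -[X in _ <= 2 * X]mulr_natl mulrA -natrM.
  rewrite ler_wpM2r // ler_nat.
  have e1 := cardC bad; rewrite -e1.
  have : (2 * #|bad| <= #|bad| + #|predC bad|)%N by rewrite e1.
  have -> : #|[pred w | ~~ bad w]| = #|predC bad| by apply: eq_card.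
  by rewrite mul2n -addnn leq_add2l => h; rewrite mul2n -addnn leq_add2r.
have sumX : \sum_(w : W) X w <= #|{: W}|%:R * \sum_(i < I.+1)
    (25 ^+ e * (3 * m%:R / 2 ^+ i) * th i + Nu * tube_energy f (Jl i) / th i).
  rewrite /X exchange_big /= mulr_sumr; apply: ler_sum => i _.
  rewrite big_split /= sumr_const -[X in X + _]mulr_natl mulrDr; apply: lerD.
    (* 2 (12 * 2^J) + 1 <= 25 * 2^J. *)
    have Kth : #|{: K}|%:R * th' i <= 25 ^+ e * th i.
      rewrite /th' mulrA ler_pdivrMr ?exprn_gt0 // mulrAC ler_wpM2r ?(ltW (th0 _)) //.
      rewrite -exprMn card_ffun !card_ord natrX.
      rewrite lerXn2r ?nnegrE ?mulr_ge0 // -[25]/(25%:R) -natrM ler_nat.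
      have : (0 < 2 ^ J)%N by rewrite expn_gt0.
      by lia.
    rewrite ler_wpM2l //.
    have m0 : 0 <= 3 * m%:R / 2 ^+ i :> R by rewrite !mulr_ge0 ?invr_ge0 ?exprn_ge0.
    have := ler_wpM2l m0 Kth; rewrite mulrCA => /le_trans; apply.
    by rewrite mulrCA mulrA.
  have /andP[j4 jJ] := JlJ i (ltn_ord i : (i <= I)%N).
  have := kernel_sum pa nu0 f0 nuf j4 jJ; rewrite -/Nu => h.
  rewrite -mulr_sumr; apply: le_trans (ler_wpM2l _ h) _.
    by rewrite invr_ge0 ltW.
  rewrite /th' card_ffun !card_ord [((2 ^ J) ^ _)%:R]natrX [(2 ^ J)%:R ^+ e.+1]exprS invf_div /tube_energy.
  by rewrite le_eqVlt; apply/orP; left; apply/eqP; ring.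
have Wp : 0 < #|{: W}|%:R :> R by rewrite card_ffun !card_ord ltr0n !expn_gt0.
rewrite -(ler_pM2l Wp) mulrCA; apply: le_trans half _.
by rewrite ler_pM2l.
Qed.

End MassBound.

(** * The energy of the gauge for beta = 3/2 *)

Section GaugeEnergy.
Variable R : realType.

Lemma inv_pow32_telescope (k : nat) : (0 < k)%N ->
  (k.+1%:R * Num.sqrt k.+1%:R)^-1 <=
    2 / Num.sqrt k%:R - 2 / Num.sqrt k.+1%:R :> R.
Proof.
move=> k0; set p := Num.sqrt k%:R; set q := Num.sqrt k.+1%:R.
have p0 : 0 < p by rewrite sqrtr_gt0 ltr0n.
have q0 : 0 < q by rewrite sqrtr_gt0 ltr0n.
have p2 : p ^+ 2 = k%:R by rewrite sqr_sqrtr.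
have q2 : q ^+ 2 = k.+1%:R by rewrite sqr_sqrtr.
have pq : q ^+ 2 = p ^+ 2 + 1 by rewrite p2 q2 natr1.
have lepq : p <= q by nra.
have qp : 1 <= 2 * q * (q - p).
  have : (q + p) * (q - p) = 1 by rewrite mulrC -subr_sqr pq; ring.
  by nra.
rewrite -q2 -subr_ge0.
have -> : 2 / p - 2 / q - (q ^+ 2 * q)^-1 = (2 * q ^+ 2 * (q - p) - p) / (p * q ^+ 3).
  by field; rewrite !gt_eqF.
apply: divr_ge0; last by rewrite mulr_ge0 ?exprn_ge0 // ltW.
rewrite subr_ge0; apply: le_trans lepq _.
by rewrite -[X in X <= _]mulr1 (_ : 2 * q ^+ 2 * (q - p) = q * (2 * q * (q - p))) ?ler_pM2l //; ring.
Qed.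

Lemma sum_inv_pow32 (N J : nat) : (1 < N)%N ->
  \sum_(n < J.+1 | (N <= n)%N) (n%:R * Num.sqrt n%:R)^-1 <= 2 / Num.sqrt N.-1%:R :> R.
Proof.
move=> N1; have -> : \sum_(n < J.+1 | (N <= n)%N) (n%:R * Num.sqrt n%:R)^-1 =
    \sum_(N <= n < J.+1) (n%:R * Num.sqrt n%:R)^-1 :> R.
  by rewrite big_geq_mkord.
have [NJ|JN] := leqP N J.+1; last first.
  by rewrite big_geq ?divr_ge0 ?sqrtr_ge0 // ltnW.
pose g (n : nat) : R := - (2 / Num.sqrt n.-1%:R).
apply: le_trans (_ : \sum_(N <= n < J.+1) (g n.+1 - g n) <= _).
  apply: ler_sum_nat => n /andP[Nn _]; rewrite /g opprK addrC.
  have n1 : (0 < n.-1)%N by lia.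
  by have := inv_pow32_telescope n1; rewrite prednK //; lia.
rewrite telescope_sumr // /g opprK addrC gerDl oppr_le0.
by rewrite divr_ge0 ?sqrtr_ge0.
Qed.

Lemma powR32 (x : R) : 0 < x -> x `^ (3 / 2) = x * Num.sqrt x.
Proof.
move=> x0; have -> : 3 / 2 = 1 + 2^-1 :> R by lra.
by rewrite powRD ?gt_eqF ?implybT // powRr1 ?(ltW x0) // powR12_sqrt // ltW.
Qed.

Lemma powRN_le (x y r : R) : 0 <= r -> 0 < x -> x <= y -> y `^ (- r) <= x `^ (- r).
Proof.
move=> r0 x0 xy; rewrite !powRN lef_pV2 ?posrE ?powR_gt0 //; last exact: lt_le_trans xy.
by rewrite ge0_ler_powR // nnegrE ltW //; exact: lt_le_trans xy.
Qed.

Lemma ln2_ge : 1 / 2 <= ln 2 :> R.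
Proof.
have h : ln (1 + - (1 / 2)) <= - (1 / 2) :> R by apply: le_ln1Dx; lra.
have : ln (1 + - (1 / 2)) = - ln 2 :> R.
  have -> : 1 + - (1 / 2) = 2^-1 :> R by lra.
  by rewrite lnV // posrE.
by move: h; lra.
Qed.

(** For t = 4 d 2^-n, ln 2 >= 1/2 and ln (4 d) <= n/4 give ln (1/t) >= n/4 > 3, so the explicit
    formula for F applies; and (n/4)^(-3/2) = 8 n^(-3/2). *)
Lemma gauge_term (e : nat) (alpha : R) (F : R -> R) (n : nat) :
  0 <= alpha -> log_gauge_extension e.+1 alpha (3 / 2) F ->
  (16 <= n)%N -> 4 * ln (4 * e.+1%:R) <= n%:R :> R ->
  F (4 * e.+1%:R * hpow R n) <= (4 * e.+1%:R * hpow R n) ^+ e *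
     (8 * (n%:R * Num.sqrt n%:R)^-1) * ln (n%:R / 4) `^ (- alpha).
Proof.
move=> al0 [[F0 _ _ _] FE _] n16 nl; set t := _ * hpow R n.
have d0 : 0 < 4 * e.+1%:R :> R by rewrite mulr_gt0 // ltr0n.
have t0 : 0 < t by rewrite mulr_gt0 // hpow_gt0.
have nR : 16 <= n%:R :> R by rewrite (ler_nat R 16).
have lnt : ln t^-1 = n%:R * ln 2 - ln (4 * e.+1%:R).
  rewrite lnV ?posrE // /t lnM ?posrE ?hpow_gt0 // hpowE lnV ?posrE ?exprn_gt0 //.
  by rewrite lnXn // -mulr_natl; ring.
have xn : n%:R / 4 <= ln t^-1.
  by rewrite lnt; have := ln2_ge; move: nl nR; nra.
have x3 : 3 <= ln t^-1 by move: xn nR; lra.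
rewrite FE //; last first.
  by rewrite -ler_ln ?posrE ?expR_gt0 // expRK; move: x3; rewrite lnV ?posrE //; lra.
have n40 : 0 < n%:R / 4 :> R by lra.
have ln4 : 0 < ln (n%:R / 4) :> R by rewrite ln_gt0 //; lra.
rewrite /log_gauge /=; apply: ler_pM; rewrite ?mulr_ge0 ?powR_ge0 ?exprn_ge0 ?(ltW t0) //.
  rewrite ler_wpM2l ?exprn_ge0 ?(ltW t0) //.
  apply: le_trans (_ : (n%:R / 4) `^ (- (3 / 2)) <= _).
    by apply: powRN_le => //; lra.
  rewrite powRN powR32 // le_eqVlt; apply/orP; left; apply/eqP.
  have -> : Num.sqrt (n%:R / 4) = Num.sqrt n%:R / 2 :> R.
    rewrite sqrtrM // (_ : 4^-1 = (2^-1) ^+ 2 :> R); last by field.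
    by rewrite sqrtr_sqr ger0_norm.
  have : 0 < Num.sqrt n%:R :> R by rewrite sqrtr_gt0; lra.
  by move=> s0; field; rewrite !gt_eqF //; lra.
apply: powRN_le => //; rewrite ler_ln ?posrE //.
by apply: lt_le_trans x3.
Qed.

(** The power 2^(n e) of the kernel cancels t^(d-1) in the gauge; what remains is n^(-3/2), whose
    tail telescopes. *)
Lemma gauge_energy (e : nat) (alpha : R) (F : R -> R) :
  0 <= alpha -> log_gauge_extension e.+1 alpha (3 / 2) F ->
  exists C : R, exists2 j0 : nat, 0 < C & forall J j, (j0 <= j)%N ->
    tube_energy e J (fun n => F (4 * e.+1%:R * hpow R n)) j <=
      C / Num.sqrt j%:R * ln (j%:R / 8) `^ (- alpha).
Proof.
move=> al0 hF; set kc := kernel_const R e.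
have kc0 : 0 < kc := kernel_const_gt0 R e.
have d0 : 0 < 4 * e.+1%:R :> R by rewrite mulr_gt0 // ltr0n.
pose K : R := (kc * (4 * e.+1%:R)) ^+ e * 3 ^+ e.+1 * 8.
have kd0 : 0 < kc * (4 * e.+1%:R) by exact: mulr_gt0.
have K0 : 0 < K by rewrite !mulr_gt0 // exprn_gt0.
(* Every n >= j - 4 then meets both lower bounds of [gauge_term]. *)
exists (4 * K), (20 + Num.trunc (4 * ln (4 * e.+1%:R) : R)).+1 => [|J j jj].
  by rewrite mulr_gt0.
have j20 : (20 <= j)%N by lia.
have jR : 20 <= j%:R :> R by rewrite (ler_nat R 20).
have tr : 4 * ln (4 * e.+1%:R) <= (j - 4)%:R :> R.
  apply: ltW; apply: lt_le_trans (truncnS_gt _) _; rewrite ler_nat.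
  by move: jj; move: (Num.trunc _) => n0; lia.
have j8 : 0 < ln (j%:R / 8) :> R by rewrite ln_gt0 //; lra.
apply: le_trans (_ : \sum_(n < J.+1 | (j - 4 <= n)%N)
    K * (n%:R * Num.sqrt n%:R)^-1 * ln (j%:R / 8) `^ (- alpha) <= _).
  apply: ler_sum => n jn.
  have nj : (j - 4)%:R <= n%:R :> R by rewrite ler_nat.
  have nj' : j%:R - 4 <= n%:R :> R.
    by move: nj; rewrite natrB //; apply: leq_trans j20.
  have g := gauge_term (n := n) al0 hF _ (le_trans tr nj).
  have {}g := g (leq_trans _ jn).
  apply: le_trans (_ : (kc * 2 ^+ n) ^+ e * (3 ^+ e.+1 * ((4 * e.+1%:R * hpow R n) ^+ e *
     (8 * (n%:R * Num.sqrt n%:R)^-1) * ln (n%:R / 4) `^ (- alpha))) <= _).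
    apply: ler_wpM2l; first by rewrite exprn_ge0 // mulr_ge0 ?exprn_ge0 // ltW.
    by apply: ler_wpM2l; rewrite ?exprn_ge0 //; apply: g; move: j20; clear; lia.
  have -> : (kc * 2 ^+ n) ^+ e * (3 ^+ e.+1 * ((4 * e.+1%:R * hpow R n) ^+ e *
     (8 * (n%:R * Num.sqrt n%:R)^-1) * ln (n%:R / 4) `^ (- alpha))) =
     K * (n%:R * Num.sqrt n%:R)^-1 * ln (n%:R / 4) `^ (- alpha).
    have hh : (kc * 2 ^+ n) ^+ e * (4 * e.+1%:R * hpow R n) ^+ e = (kc * (4 * e.+1%:R)) ^+ e.
      rewrite -exprMn; congr (_ ^+ e); rewrite hpowE; field.
      by rewrite expf_neq0.
    by rewrite /K -hh; ring.
  apply: ler_wpM2l.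
    by apply: mulr_ge0; [exact: ltW|rewrite invr_ge0 mulr_ge0 // sqrtr_ge0].
  apply: powRN_le => //; rewrite ler_ln ?posrE; lra.
rewrite -mulr_suml -mulr_sumr; apply: ler_wpM2r; first exact: powR_ge0.
have -> : 4 * K / Num.sqrt j%:R = K * (4 / Num.sqrt j%:R) by rewrite [4 * K]mulrC mulrA.
rewrite ler_pM2l //.
apply: le_trans (sum_inv_pow32 _ _) _; first by lia.
have sj : 0 < Num.sqrt j%:R :> R by rewrite sqrtr_gt0; lra.
have sj' : 0 < Num.sqrt (j - 4).-1%:R :> R by rewrite sqrtr_gt0 ltr0n; move: j20; clear; lia.
rewrite ler_pdivrMr // mulrAC ler_pdivlMr //.
suff : Num.sqrt j%:R <= 2 * Num.sqrt (j - 4).-1%:R :> R by lra.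
have -> : 2 = Num.sqrt (2 ^+ 2) :> R by rewrite sqrtr_sqr ger0_norm.
rewrite -sqrtrM ?sqr_ge0 // ler_wsqrtr //.
have : j%:R <= 4 * (j - 4).-1%:R :> R by rewrite -natrM ler_nat; move: j20; clear; lia.
by lra.
Qed.

End GaugeEnergy.

(** * Comparisons with the exponential *)

Section Growth.
Variable R : realType.

(** Applied at x = ln N: powers of ln N are eventually below N. *)
Lemma powR_le_expR (K p : R) : 0 <= K -> exists2 x0 : R, 1 <= x0 &
  forall x, x0 <= x -> K * x `^ p <= expR x.
Proof.
move=> K0; pose q := (Num.trunc `|p|).+1.
exists (Num.max 1 (K * q.+1`!%:R)); first by rewrite le_max lexx.
move=> x; rewrite ge_max => /andP[x1 xK]; have x0 : 0 < x by lra.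
have xp : x `^ p <= x ^+ q.
  rewrite -powR_mulrn ?(ltW x0) //; apply: ler_powR => //.
  by apply: le_trans (ler_norm _) (ltW (truncnS_gt _)).
apply: le_trans (ler_wpM2l K0 xp) _.
have fp : 0 < q.+1`!%:R :> R by rewrite ltr0n fact_gt0.
apply: le_trans (_ : x ^+ q.+1 / q.+1`!%:R <= _).
  rewrite ler_pdivlMr // exprS mulrAC ler_wpM2r ?exprn_ge0 // ltW //.
by apply: le_trans (expR_ge1Dxn q (ltW x0)); lra.
Qed.

Lemma pow23_le (n : nat) : (2 / 3) ^+ n <= expR (- (n%:R / 3)) :> R.
Proof.
have -> : - (n%:R / 3) = n%:R * (- (1 / 3)) :> R by ring.
rewrite expRM_natl lerXn2r ?nnegrE ?expR_ge0 //.
by apply: le_trans (expR_ge1Dx _); lra.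
Qed.

Lemma two_pow_le (n : nat) : 2 ^+ n <= expR n%:R :> R.
Proof.
rewrite -[n%:R]mulr1 expRM_natl lerXn2r ?nnegrE ?expR_ge0 //.
by apply: le_trans (expR_ge1Dx _); lra.
Qed.

Lemma expR_quarter (x y : R) : x + 2 <= y -> expR x <= expR y / 4.
Proof.
move=> h; have -> : expR x = expR (x + 2) * expR (- 2) by rewrite -expRD addrK.
apply: ler_pM; rewrite ?expR_ge0 ?ler_expR // expRN lef_pV2 ?posrE ?expR_gt0 //.
have -> : expR 2 = expR 1 ^+ 2 :> R by rewrite -expRM_natl mulr1.
have : 2 <= expR 1 :> R by apply: le_trans (expR_ge1Dx _); lra.
by nra.
Qed.

End Growth.

(** * Constants for the good base points *)

Section GoodBasePointsExist.
Variable R : realType.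

(** After r steps the value is W0 exp (- cs r N). A degree just above 3 (cs r + 2) N makes
    (2/3)^(m+1) M negligible, since (2/3)^n <= exp (- n / 3). That degree is at most (3 cs r + 7) N
    and costs a factor exp (L m), which is the recursion for [cs]. B makes the grid fine enough for
    all these degrees. *)
Lemma good_base_points (e : nat) : exists c B : R, [/\ 0 <= c, 0 <= B &
  forall (J : nat) (a xs : 'rV[R]_e.+1) (phi : 'rV[R[i]]_e.+1 -> R[i]) (M N W0 : R),
  analytic_on (cdisc 0 10) phi -> (forall z, cdisc 0 10 z -> nc (phi z) <= M) ->
  renorm a <= 1 -> renorm (xs - a) <= 1 -> 2 <= N -> 0 < W0 -> M <= W0 * expR N ->
  W0 <= nc (phi (of_real_vec xs)) -> B * N <= 2 ^+ J ->
  (2 * #|[pred w : {ffun 'I_e.+1 -> 'I_(2 ^ J)} |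
     (nc (phi (of_real_vec (base a w))) < W0 * expR (- (c * N)))%R]| <=
   #|{: {ffun 'I_e.+1 -> 'I_(2 ^ J)}}|)%N].
Proof.
have k0 := remez_const_gt0 R e; set kap := remez_const R e in k0.
pose L : R := 1 + `|ln (12 / kap)|.
have L1 : 1 <= L by rewrite lerDl.
have [cs [csZ csE]] : exists cs : nat -> R, cs 0%N = 0 /\
    forall r, cs r.+1 = cs r + 2 + L * (3 * cs r + 7).
  by exists (fix cs (r : nat) : R := if r is r'.+1 then cs r' + 2 + L * (3 * cs r' + 7) else 0).
have L0 : 0 <= L by lra.
have cs0 r : 0 <= cs r.
  elim: r => [|r IH]; first by rewrite csZ.
  rewrite csE; have : 0 <= L * (3 * cs r + 7) by rewrite mulr_ge0 //; lra.
  by lra.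
have csS r : cs r <= cs r.+1.
  rewrite csE; have : 0 <= L * (3 * cs r + 7) by rewrite mulr_ge0 //; have := cs0 r; lra.
  by lra.
have csm r n : (r <= n)%N -> cs r <= cs n.
  by move=> /subnK <-; elim: (n - r)%N => //= k IH; apply: le_trans IH _; exact: csS.
exists (cs e.+1), (2 * e.+1%:R * (3 * cs e.+1 + 7)); split=> //.
  by rewrite !mulr_ge0 //; have := cs0 e.+1; lra.
move=> J a xs phi M N W0 aphi bphi a1 xa N2 W00 MW Wxs BN.
have [ms m1 m2] : exists2 ms : nat -> nat, forall r, 3 * (cs r + 2) * N < (ms r)%:R &
    forall r, (ms r)%:R <= (3 * cs r + 7) * N /\ (0 < ms r)%N.
  exists (fun r => (Num.trunc (3 * (cs r + 2) * N)).+1) => r; first exact: truncnS_gt.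
  have h0 : 0 <= 3 * (cs r + 2) * N by rewrite !mulr_ge0 //; have := cs0 r; lra.
  have /andP[h _] := truncn_itv h0; split=> //; rewrite -[_.+1%:R]natr1.
  by move: (Num.trunc _)%:R h => t; lra.
pose v r := W0 * expR (- (cs r * N)).
apply: (good_count aphi bphi a1 xa (v := v) (ms := ms)).
- by rewrite /v csZ mul0r oppr0 expR0 mulr1.
- by move=> r; rewrite mulr_gt0 ?expR_gt0.
move=> r rd; have [m2r m0r] := m2 r; split => //.
- rewrite -(ler_nat R) natrX; apply: le_trans BN.
  rewrite !natrM -!mulrA ler_pM2l // ler_pM2l ?ltr0n //.
  apply: le_trans m2r _; rewrite ler_wpM2r //; first by lra.
  by have := csm _ _ (ltnW rd); lra.
- have e23 := pow23_le R (ms r).+1.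
  apply: le_trans (_ : expR (- ((ms r).+1%:R / 3)) * (W0 * expR N) <= _).
    apply: le_trans (ler_wpM2l _ MW) _; first exact: exprn_ge0.
    by rewrite ler_wpM2r // mulr_ge0 ?expR_ge0 // ltW.
  rewrite mulrCA /v -mulrA ler_pM2l // -expRD; apply: expR_quarter.
  have [t tm tE] : exists2 t : R, 3 * (cs r + 2) * N < t & (ms r).+1%:R = t + 1 :> R.
    by exists (ms r)%:R; [exact: m1|rewrite natr1].
  by rewrite tE; move: tm N2; clear; lra.
have km : (12 / kap) ^+ ms r <= expR ((ms r)%:R * `|ln (12 / kap)|).
  rewrite expRM_natl lerXn2r ?nnegrE ?expR_ge0 ?divr_ge0 ?(ltW k0) //.
  have kp : 0 < 12 / kap by rewrite divr_gt0.
  by rewrite -{1}(lnK (x := 12 / kap)) ?posrE // ler_expR ler_norm.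
have mm : (ms r).+1%:R <= expR (ms r)%:R :> R.
  by rewrite -[_.+1%:R]natr1 addrC; exact: expR_ge1Dx.
apply: le_trans (_ : expR (ms r)%:R * expR ((ms r)%:R * `|ln (12 / kap)|) * v r.+1 <= _).
  apply: ler_wpM2r; first by rewrite mulr_ge0 ?expR_ge0 // ltW.
  by apply: ler_pM => //; apply: exprn_ge0; rewrite divr_ge0 // ltW.
rewrite mulrCA /v -mulrA ler_pM2l // -!expRD; apply: expR_quarter.
have [t tm tE] : exists2 t : R, t <= (3 * cs r + 7) * N & (ms r)%:R = t by exists (ms r)%:R.
rewrite tE csE; have : L * t <= L * ((3 * cs r + 7) * N) by rewrite ler_wpM2l.
have -> : t + t * `|ln (12 / kap)| = L * t by rewrite /L; ring.
by move: N2; generalize (cs r) L => c1 L2; clear; lra.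
Qed.

End GoodBasePointsExist.

(** * Choice of the levels and of the thresholds *)

Section Schedule.
Variable R : realType.

Lemma geometric_le (x : R) n : 0 <= x -> x < 1 -> \sum_(i < n) x ^+ i <= (1 - x)^-1.
Proof.
move=> x0 x1; have xp : 0 < 1 - x by lra.
rewrite -[X in _ <= X]mul1r ler_pdivlMr // mulrC.
have -> : (1 - x) * (\sum_(i < n) x ^+ i) = 1 - x ^+ n.
  by rewrite -[in RHS](expr1n _ n) subrXX; congr (_ * _); apply: eq_bigr => i _; rewrite expr1n mul1r.
by have := exprn_ge0 n x0; lra.
Qed.

(* With ratio 4/9 the exponent [\sum_i level i * 2 ^ i.+1] stays below [A / 2],
   while the energies, of order [level i] to the power -1/2, grow only like
   (3/2)^i, which the factors [2 ^- i] of [mass_bound] absorb. *)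
Definition level_size (A : R) (i : nat) : R := A / 40 * (4 / 9) ^+ i.

Definition level (A : R) (i : nat) : nat := Num.trunc (level_size A i).

Lemma level_size_gt0 A i : 0 < A -> 0 < level_size A i.
Proof. by move=> A0; rewrite mulr_gt0 ?exprn_gt0 // divr_gt0. Qed.

Lemma level_le A i : 0 < A -> (level A i)%:R <= level_size A i.
Proof. by move=> A0; have /andP[] := truncn_itv (ltW (level_size_gt0 i A0)). Qed.

Lemma pow_up_log_le m : (1 < m)%N -> (2 ^ up_log 2 m <= 2 * m)%N.
Proof.
move=> m1; have /andP[h _] := up_log_bounds (isT : (1 < 2)%N) m1.
have I0 : (0 < up_log 2 m)%N by rewrite up_log_gt0 // .
by rewrite -(prednK I0) expnS leq_mul2l ltnW.
Qed.

(** Keeps the logarithm of every level comparable with ln N. As (9/4)^4 <= 2^5, (9/4)^(4i) is at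
    most (2m)^5 for i <= log m; 640 = 40 * 16. *)
Lemma level_size_lb A (N : R) m i : (1 < m)%N -> 0 < A -> 0 <= N ->
  N ^+ 2 * (2 * m%:R) ^+ 5 <= (A / 640) ^+ 4 -> (i <= up_log 2 m)%N ->
  16 * Num.sqrt N <= level_size A i.
Proof.
move=> m1 A0 N0 hA iI.
have s0 : 0 <= 16 * Num.sqrt N by rewrite mulr_ge0 ?sqrtr_ge0.
rewrite -(@ler_pXn2r _ 4) ?nnegrE ?(ltW (level_size_gt0 _ A0)) //.
have -> : (16 * Num.sqrt N) ^+ 4 = 16 ^+ 4 * N ^+ 2.
  by rewrite exprMn -[in RHS](sqr_sqrtr N0) -exprM.
have p1 : (9 / 4) ^+ (4 * i) <= (2 * m%:R) ^+ 5 :> R.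
  apply: le_trans (_ : (2 ^+ i) ^+ 5 <= _).
    by rewrite exprM -[X in _ <= X]exprM mulnC [X in _ <= X]exprM lerXn2r ?nnegrE ?exprn_ge0 //; lra.
  rewrite lerXn2r ?nnegrE ?exprn_ge0 ?mulr_ge0 //.
  rewrite -natrX -natrM ler_nat; apply: leq_trans (pow_up_log_le m1).
  by rewrite leq_exp2l.
have q0 : 0 < (9 / 4) ^+ (4 * i) :> R by rewrite exprn_gt0.
have -> : level_size A i ^+ 4 = 16 ^+ 4 * ((A / 640) ^+ 4 / (9 / 4) ^+ (4 * i)).
  rewrite /level_size exprMn -exprM [(i * 4)%N]mulnC.
  have -> : 4 / 9 = (9 / 4)^-1 :> R by rewrite invf_div.
  by rewrite exprVn; field; rewrite gt_eqF.
rewrite ler_pM2l ?exprn_gt0 // ler_pdivlMr //; apply: le_trans hA.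
by rewrite ler_wpM2l // exprn_ge0.
Qed.

(** The products [level A i * 2 ^ i] are at most (A / 40) (8/9)^i, with sum at most 9A / 40;
    doubling this and adding A / 40 for the last term gives 19A / 40. *)
Lemma level_sum A m : 0 < A ->
  (\sum_(i < up_log 2 m) level A i * 2 ^ i.+1 + level A (up_log 2 m) * m)%:R <= 19 / 40 * A.
Proof.
move=> A0; set I := up_log 2 m.
have mI : (m <= 2 ^ I)%N by exact: up_logP.
have E i : level_size A i * 2 ^+ i = A / 40 * (8 / 9) ^+ i.
  rewrite /level_size -mulrA -exprMn; congr (_ * _ ^+ _); lra.
have term i : (level A i * 2 ^ i)%:R <= A / 40 * (8 / 9) ^+ i.
  by rewrite natrM natrX -E ler_wpM2r ?exprn_ge0 ?level_le.
rewrite natrD natr_sum.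
apply: le_trans (_ : \sum_(i < I) 2 * (A / 40 * (8 / 9) ^+ i) + A / 40 * (8 / 9) ^+ I <= _).
  apply: lerD.
    by apply: ler_sum => i _; rewrite expnS mulnCA natrM ler_pM2l.
  by apply: le_trans (term I); rewrite ler_nat leq_mul2l mI orbT.
rewrite -mulr_sumr -mulr_sumr.
have g : \sum_(i < I) (8 / 9) ^+ i <= (1 - 8 / 9)^-1 :> R by apply: geometric_le; lra.
have g1 : (8 / 9) ^+ I <= 1 :> R by rewrite exprn_ile1 //; lra.
have A40 : 0 < A / 40 by lra.
have := ler_wpM2l (ltW A40) g; have := ler_wpM2l (ltW A40) g1; rewrite mulr1.
have -> : (1 - 8 / 9)^-1 = 9 :> R by field.
by lra.
Qed.

Definition mass_const (e : nat) : R := 3840 * 25 ^+ e.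

Lemma mass_const_gt0 e : 0 < mass_const e.
Proof. by apply: mulr_gt0; rewrite ?exprn_gt0 ?ltr0n. Qed.

(** The ratio 15/8 of the thresholds lies between the growth 3/2 of the energies and the gain 2 in
    the number of intervals, so both sums are geometric, of ratios 15/16 and 4/5. The second
    contributes Nu / 2, absorbed on the left; 3840 = 2 * 2 * 60 * 16. *)
Lemma mass_small (e m I : nat) (Nu g : R) (TE : nat -> R) :
  0 <= Nu -> 0 < g -> (forall i, (i <= I)%N -> TE i <= g * (3 / 2) ^+ i) ->
  Nu <= 2 * \sum_(i < I.+1) (25 ^+ e * (3 * m%:R / 2 ^+ i) * (20 * g * (15 / 8) ^+ i) +
     Nu * TE i / (20 * g * (15 / 8) ^+ i)) ->
  Nu <= mass_const e * m%:R * g.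
Proof.
move=> Nu0 g0 hTE h.
have bound (i : 'I_I.+1) : 25 ^+ e * (3 * m%:R / 2 ^+ i) * (20 * g * (15 / 8) ^+ i) +
     Nu * TE i / (20 * g * (15 / 8) ^+ i) <=
   60 * 25 ^+ e * m%:R * g * (15 / 16) ^+ i + Nu / 20 * (4 / 5) ^+ i.
  have p0 : 0 < (15 / 8) ^+ i :> R by rewrite exprn_gt0.
  have gp0 : 0 < 20 * g * (15 / 8) ^+ i by rewrite !mulr_gt0.
  apply: lerD.
    rewrite le_eqVlt; apply/orP; left; apply/eqP.
    have -> : (15 / 16) ^+ i = (15 / 8) ^+ i / 2 ^+ i :> R.
      by rewrite -expr_div_n; congr (_ ^+ _); lra.
    by ring.
  rewrite ler_pdivrMr //.
  have -> : Nu / 20 * (4 / 5) ^+ i * (20 * g * (15 / 8) ^+ i) = Nu * (g * (3 / 2) ^+ i).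
    have -> : (3 / 2) ^+ i = (4 / 5) ^+ i * (15 / 8) ^+ i :> R.
      by rewrite -exprMn; congr (_ ^+ _); lra.
    by field.
  by rewrite ler_wpM2l // hTE // -ltnS.
have := le_trans h (ler_wpM2l (ler0n _ 2) (ler_sum _ (fun i _ => bound i))).
rewrite big_split /= -!mulr_sumr.
have g1 : \sum_(i < I.+1) (15 / 16) ^+ i <= (1 - 15 / 16)^-1 :> R by apply: geometric_le; lra.
have g2 : \sum_(i < I.+1) (4 / 5) ^+ i <= (1 - 4 / 5)^-1 :> R by apply: geometric_le; lra.
have c0 : 0 <= 60 * 25 ^+ e * m%:R * g by rewrite !mulr_ge0 ?exprn_ge0 // ltW.
have n0 : 0 <= Nu / 20 by lra.
have := ler_wpM2l c0 g1; have := ler_wpM2l n0 g2.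
have -> : (1 - 15 / 16)^-1 = 16 :> R by field.
have -> : (1 - 4 / 5)^-1 = 5 :> R by field.
by rewrite /mass_const; lra.
Qed.

End Schedule.

(** * The contradiction: a violated inequality forces small content *)

Section Core.
Variable R : realType.

(** Truncation at most halves a level, so its square root is at least sqrt (A / 80) (2/3)^i.
    Moreover the level is at least 8 sqrt N, which gives ln (level / 8) >= ln N / 2. *)
Lemma energy_of_level (e J : nat) (alpha CF A N : R) (F : R -> R) (j0 m i : nat) :
  0 <= alpha -> 0 < CF -> 0 < A -> 400 <= N -> (j0 + 20)%:R ^+ 2 <= N -> (1 < m)%N ->
  N ^+ 2 * (2 * m%:R) ^+ 5 <= (A / 640) ^+ 4 -> (i <= up_log 2 m)%N ->
  (forall J j, (j0 <= j)%N -> tube_energy e J (fun n => F (4 * e.+1%:R * hpow R n)) j <=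
      CF / Num.sqrt j%:R * ln (j%:R / 8) `^ (- alpha)) ->
  [/\ (4 <= level A i)%N, (level A i <= level A 0)%N &
    tube_energy e J (fun n => F (4 * e.+1%:R * hpow R n)) (level A i) <=
      CF / Num.sqrt (A / 80) * (ln N / 2) `^ (- alpha) * (3 / 2) ^+ i].
Proof.
move=> al0 CF0 A0 N400 Nj m1 hA iI hCF.
have N0 : 0 <= N by lra.
have xs := level_size_lb m1 A0 N0 hA iI.
have s20 : (j0 + 20)%:R <= Num.sqrt N.
  by rewrite -[X in X <= _]ger0_norm // -sqrtr_sqr ler_wsqrtr.
have j0R : 0 <= j0%:R :> R by [].
rewrite natrD in s20.
have x0 := level_size_gt0 i A0.
have tS : level_size A i < (level A i).+1%:R by exact: truncnS_gt.
rewrite -natr1 in tS.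
have jx : level_size A i / 2 <= (level A i)%:R.
  by move: tS xs s20 j0R; generalize ((level A i)%:R : R) (level_size A i) (Num.sqrt N) => t1 t2 t3; clear; lra.
split.
- rewrite -(ler_nat R); move: jx xs s20 j0R; clear; lra.
- have l0 : level_size A i <= level_size A 0.
    rewrite /level_size expr0 ler_pM2l ?divr_gt0 // exprn_ile1 //; lra.
  have := truncnS_gt (level_size A 0); rewrite -/(level A 0) => h.
  have := level_le i A0 => h'.
  by rewrite -ltnS -(ltr_nat R); apply: le_lt_trans h' (le_lt_trans l0 h).
have j0j : (j0 <= level A i)%N.
  rewrite -(ler_nat R); move: jx xs s20 j0R; clear; lra.
apply: le_trans (hCF J _ j0j) _.
have sA : 0 < Num.sqrt (A / 80) by rewrite sqrtr_gt0 divr_gt0.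
have sN : 0 < Num.sqrt N by rewrite sqrtr_gt0; lra.
have lnN : ln (Num.sqrt N) = ln N / 2.
  have e2 : N = Num.sqrt N ^+ 2 by rewrite sqr_sqrtr.
  by rewrite [in RHS]e2 lnXn // mulr2n; lra.
have lnN0 : 0 < ln N by rewrite ln_gt0 //; lra.
have p23 : 0 < (2 / 3) ^+ i :> R by rewrite exprn_gt0.
have sj : Num.sqrt (A / 80) * (2 / 3) ^+ i <= Num.sqrt (level A i)%:R.
  have -> : Num.sqrt (A / 80) * (2 / 3) ^+ i = Num.sqrt (A / 80 * ((2 / 3) ^+ i) ^+ 2).
    by rewrite [Num.sqrt (A / 80 * _)]sqrtrM ?divr_ge0 ?(ltW A0) // sqrtr_sqr ger0_norm // ltW.
  apply: ler_wsqrtr; apply: le_trans jx; rewrite /level_size -exprM mulnC exprM.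
  have -> : (2 / 3) ^+ 2 = 4 / 9 :> R by lra.
  by lra.
have -> : CF / Num.sqrt (A / 80) * (ln N / 2) `^ (- alpha) * (3 / 2) ^+ i =
  CF / (Num.sqrt (A / 80) * (2 / 3) ^+ i) * (ln N / 2) `^ (- alpha).
  have -> : (3 / 2) ^+ i = ((2 / 3) ^+ i)^-1 :> R by rewrite -exprVn invf_div.
  by field; rewrite !gt_eqF.
have sp : 0 < Num.sqrt (A / 80) * (2 / 3) ^+ i by exact: mulr_gt0.
apply: ler_pM; rewrite ?powR_ge0 ?divr_ge0 ?sqrtr_ge0 ?(ltW CF0) //.
  by rewrite ler_pM2l // lef_pV2 ?posrE //; exact: lt_le_trans sj.
apply: powRN_le => //; first by lra.
rewrite -lnN ler_ln ?posrE //; move: jx xs sN; clear; lra.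
Qed.

(** C = s^2 enters A, and the energy carries A^(-1/2), so the mass is at most K5 / s times (ln
    N)^(kappa/2 - alpha) <= 1. The choice of s puts K5 / s below c', whereas content above c' would
    supply a measure of mass at least c'. *)
Lemma smallness_contradiction (e : nat) (alpha kappa c' : R) (F : R -> R) :
  0 <= alpha -> kappa / 2 <= alpha -> log_gauge_extension e.+1 alpha (3 / 2) F -> 0 < c' ->
  exists C N0 : R, [/\ 0 < C, 1 < N0 & forall N, N0 <= N ->
  forall (a xs : 'rV[R]_e.+1) (E : set 'rV[R]_e.+1) (phi : 'rV[R[i]]_e.+1 -> R[i]) (M W0 : R),
  analytic_on (cdisc 0 10) phi -> (forall z, cdisc 0 10 z -> nc (phi z) <= M) ->
  renorm a <= 1 -> renorm (xs - a) <= 1 -> (forall x, E x -> renorm (x - a) <= 1) ->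
  0 < W0 -> M <= W0 * expR N -> W0 <= nc (phi (of_real_vec xs)) ->
  (forall x, E x ->
     nc (phi (of_real_vec x)) <= W0 * expR (- (C * N ^+ 2 / ln N `^ kappa))) ->
  (hausdorff_content F E <= c'%:E)%E].
Proof.
move=> al0 kal gF c'0; have [gFg _ _] := gF.
have [c [B [c0 B0 hgood]]] := good_base_points R e.
have [CF [j0 CF0 hCF]] := gauge_energy al0 gF.
pose Cm : R := 3 * c + 7.
have Cm0 : 0 < Cm by rewrite /Cm; lra.
pose q2 : R := 2^-1 `^ alpha.
have q20 : 0 < q2 by rewrite powR_gt0.
pose s80 : R := Num.sqrt 80.
have s800 : 0 < s80 by rewrite sqrtr_gt0.
pose K5 : R := mass_const R e * Cm * (CF * s80 / q2).
have mc0 := mass_const_gt0 R e.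
have K50 : 0 < K5.
  by apply: mulr_gt0; [exact: mulr_gt0|apply: divr_gt0 => //; exact: mulr_gt0].
pose s : R := K5 / c' + 1.
have s1 : 1 <= s by rewrite lerDr divr_ge0 // ltW.
have s0 : 0 < s by lra.
have C1ge : 1 <= s ^+ 2 by rewrite exprn_ege1.
(* [C1 * N <= A], secured by [x2], leaves room in [cond5] for 5 m + c N + 3 besides 19A / 40. [x1]
   secures the hypothesis of [level_size_lb], which compares N^7 with N^8 up to logarithms. *)
pose C1 : R := 2 * (5 * Cm + c + 3).
have [u u0 uE] : exists2 u : R, 0 < u & u = 640 by exists 640; rewrite ?ltr0n.
have [|x1 x11 hx1] := powR_le_expR (K := u ^+ 4 * (2 * Cm) ^+ 5) (kappa * 4%:R).
  by apply: mulr_ge0; apply: exprn_ge0; [exact: ltW|apply: mulr_ge0 => //; exact: ltW].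
have [|x2 x21 hx2] := powR_le_expR (K := C1) kappa.
  by rewrite /C1 mulr_ge0 //; move: Cm0 c0; clear; lra.
exists (s ^+ 2), (expR (Num.max x1 x2) + (j0 + 20)%:R ^+ 2 + 400); split.
- by rewrite exprn_gt0.
- by have := expR_gt0 (Num.max x1 x2); have := sqr_ge0 ((j0 + 20)%:R : R); lra.
move=> N hN a xs E phi M W0 aphi bphi a1 xa Ea W00 MW Wxs hE.
have eg := expR_gt0 (Num.max x1 x2); have jg := sqr_ge0 ((j0 + 20)%:R : R).
have N400 : 400 <= N by lra.
have Nj : (j0 + 20)%:R ^+ 2 <= N by lra.
have Nx : expR (Num.max x1 x2) <= N by lra.
have Np : 0 < N by move: N400; clear; lra.
clear hN eg jg.
pose L : R := ln N.
have NL : expR L = N by rewrite lnK.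
have Lx : Num.max x1 x2 <= L by rewrite -ler_expR NL.
have [Lx1 Lx2] : x1 <= L /\ x2 <= L by move: Lx; rewrite ge_max => /andP[].
have L1 : 1 <= L by exact: le_trans x11 Lx1.
have L0 : 0 < L by exact: lt_le_trans ltr01 L1.
have h1 := hx1 _ Lx1; have h2 := hx2 _ Lx2; rewrite NL in h1 h2.
pose P : R := L `^ kappa.
have P0 : 0 < P by exact: powR_gt0.
have P4 : L `^ (kappa * 4%:R) = P ^+ 4 by rewrite powRrM powR_mulrn // ltW.
rewrite P4 in h1; rewrite -/P in h2.
pose A : R := s ^+ 2 * N ^+ 2 / P.
have hE' x : E x -> nc (phi (of_real_vec x)) <= W0 * expR (- A) by exact: hE.
have AP : N ^+ 2 / P <= A.
  by rewrite /A -mulrA ler_peMl // divr_ge0 ?exprn_ge0 // ltW.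
have A0 : 0 < A by rewrite /A !mulr_gt0 ?invr_gt0 ?exprn_gt0.
have A1 : C1 * N <= A.
  apply: le_trans AP; rewrite ler_pdivlMr // mulrAC expr2 ler_pM2r //.
have [m m1 m2] : exists2 m : nat, 3 * (c + 2) * N < m%:R & m%:R <= Cm * N.
  exists (Num.trunc (3 * (c + 2) * N)).+1; first exact: truncnS_gt.
  have hh : 0 <= 3 * (c + 2) * N by rewrite !mulr_ge0 ?(ltW Np) //; move: c0; clear; lra.
  have /andP[h _] := truncn_itv hh; rewrite -[_.+1%:R]natr1 /Cm.
  by move: h N400; generalize ((Num.trunc (3 * (c + 2) * N))%:R : R) => t; clear; lra.
have mgt1 : (1 < m)%N.
  rewrite -(ltr_nat R); apply: lt_trans m1; have : 0 <= c * N by rewrite mulr_ge0 // ltW.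
  by move: N400; clear; lra.
have A4 : N ^+ 2 * (2 * m%:R) ^+ 5 <= (A / 640) ^+ 4.
  rewrite -uE; have NP0 : 0 < N ^+ 2 / P by apply: divr_gt0 => //; exact: exprn_gt0.
  apply: le_trans (_ : (N ^+ 2 / P / u) ^+ 4 <= _); last first.
    rewrite lerXn2r // ?nnegrE; [exact/ltW/divr_gt0|exact/ltW/divr_gt0|].
    by rewrite ler_pM2r // invr_gt0.
  apply: le_trans (_ : N ^+ 2 * (2 * (Cm * N)) ^+ 5 <= _).
    apply: ler_wpM2l; first by apply: exprn_ge0; exact: ltW.
    rewrite lerXn2r // ?nnegrE; [exact: mulr_ge0| |by rewrite ler_pM2l].
    by apply: mulr_ge0 => //; apply/ltW/mulr_gt0.
  have -> : (N ^+ 2 / P / u) ^+ 4 = N ^+ 7 * N / (u ^+ 4 * P ^+ 4).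
    by clear -P0 u0; field; rewrite !gt_eqF.
  rewrite ler_pdivlMr; last by apply: mulr_gt0; exact: exprn_gt0.
  have -> : N ^+ 2 * (2 * (Cm * N)) ^+ 5 * (u ^+ 4 * P ^+ 4) =
    N ^+ 7 * (u ^+ 4 * (2 * Cm) ^+ 5 * P ^+ 4) by ring.
  by rewrite ler_pM2l // exprn_gt0.
pose ep : R := W0 * expR (- A).
have ep0 : 0 < ep by rewrite mulr_gt0 ?expR_gt0.
have d0 : 0 < e.+1%:R :> R by rewrite ltr0n.
(* Only lower bounds on J occur, so one mesh meets all four requirements. *)
have [J [J1 J2 J3 J4]] : exists J : nat, [/\ 30 * e.+1%:R * hpow R J <= 1,
    W0 * expR N * (e.+1%:R * hpow R J) <= ep, B * N <= 2 ^+ J & (level A 0 <= J)%N].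
  have W0N : 0 < W0 * expR N by rewrite mulr_gt0 ?expR_gt0.
  have BN0 : 0 < B * N + 1 by rewrite ltr_wpDl // mulr_ge0 // ltW.
  have [|J hJ] := @hpow_archi R (Num.min (30 * e.+1%:R)^-1
     (Num.min (ep / (W0 * expR N * e.+1%:R)) (B * N + 1)^-1)).
    rewrite !lt_min !invr_gt0 BN0 andbT; apply/andP; split; first exact: mulr_gt0.
    by apply: divr_gt0 => //; exact: mulr_gt0.
  move: hJ; rewrite !le_min => /andP[j1 /andP[j2 j3]].
  exists (maxn J (level A 0)); have := hpow_anti R (leq_maxl J (level A 0)).
  set J' := maxn _ _ => hJJ; split; last exact: leq_maxr.
  - by rewrite mulrC -ler_pdivlMr ?mulr_gt0 // div1r; exact: le_trans hJJ j1.
  - have := le_trans hJJ j2; rewrite ler_pdivlMr; last exact: mulr_gt0.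
    have -> // : hpow R J' * (W0 * expR N * e.+1%:R) = W0 * expR N * (e.+1%:R * hpow R J').
    by clear; ring.
  have := le_trans hJJ j3; rewrite hpowE lef_pV2 ?posrE ?exprn_gt0 //.
  by apply: le_trans; rewrite lerDl.
apply: contrapT => /negP; rewrite -ltNge => cE.
have bE x i : E x -> `|x ord0 i| <= 2.
  move=> Ex; apply: le_trans (coord_le_renorm _ _) _.
  have := renorm_triangle (x - a) a; rewrite subrK; have := Ea _ Ex.
  by move: a1; generalize (renorm x) (renorm a) (renorm (x - a)) => t1 t2 t3; clear; lra.
have [T [pt [nu [ptE nu0 nuf Nu]]]] := frostman_set J (ltn0Sn e) gFg bE cE.
pose f n := F (4 * e.+1%:R * hpow R n).
have f0 n : 0 <= f n by case: gFg => F0 _ _ _; apply: F0; rewrite !mulr_gt0 // hpow_gt0.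
have lev i (iI : (i <= up_log 2 m)%N) := energy_of_level J al0 CF0 A0 N400 Nj mgt1 A4 iI hCF.
pose g : R := CF / Num.sqrt (A / 80) * (L / 2) `^ (- alpha).
have g0 : 0 < g.
  by rewrite mulr_gt0 ?divr_gt0 ?sqrtr_gt0 ?powR_gt0 // divr_gt0.
pose v : R := W0 * expR (- (c * N)).
have v0 : 0 < v by rewrite mulr_gt0 ?expR_gt0.
have N2 : 2 <= N by move: N400; clear; lra.
have good := hgood J a xs phi M N W0 aphi bphi a1 xa N2 W00 MW Wxs J3.
have cond3 : M * (e.+1%:R * hpow R J) <= ep.
  by apply: le_trans J2; rewrite ler_wpM2r // mulr_ge0 ?hpow_ge0 // ltW.
have cond4 : (2 / 3) ^+ m.+1 * M <= v / 4.
  have e23 := pow23_le R m.+1.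
  apply: le_trans (_ : expR (- (m.+1%:R / 3)) * (W0 * expR N) <= _).
    apply: le_trans (ler_wpM2l _ MW) _; first exact: exprn_ge0.
    by rewrite ler_wpM2r // mulr_ge0 ?expR_ge0 // ltW.
  rewrite mulrCA /v -mulrA ler_pM2l // -expRD; apply: expR_quarter.
  by rewrite -[m.+1%:R]natr1; move: m1 N2; generalize (m%:R : R) => t; clear; lra.
set Q := (\sum_(i < up_log 2 m) level A i * 2 ^ i.+1 + level A (up_log 2 m) * m)%N.
have QA : Q%:R <= 19 / 40 * A by exact: level_sum.
have cond5 : m.+1%:R * 12 ^+ m * 2 ^+ Q * (2 * ep) <= v / 4.
  have e1 : m.+1%:R <= expR m%:R :> R.
    by rewrite -[_.+1%:R]natr1 addrC; exact: expR_ge1Dx.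
  have e2 : 12 ^+ m <= expR (4 * m%:R) :> R.
    apply: le_trans (_ : 2 ^+ (4 * m) <= _); last first.
      by have := two_pow_le R (4 * m); rewrite natrM.
    by rewrite exprM lerXn2r ?nnegrE //; clear; lra.
  have e3 : 2 ^+ Q <= expR (19 / 40 * A).
    by apply: le_trans (two_pow_le _ _) _; rewrite ler_expR.
  have e4 : 2 <= expR 1 :> R by apply: le_trans (expR_ge1Dx _); clear; lra.
  apply: le_trans (_ : expR m%:R * expR (4 * m%:R) * expR (19 / 40 * A) * (expR 1 * ep) <= _).
    have q12 : 0 <= 12 ^+ m :> R by exact: exprn_ge0.
    have q2Q : 0 <= 2 ^+ Q :> R by exact: exprn_ge0.
    have qm : 0 <= m.+1%:R * 12 ^+ m :> R by exact: mulr_ge0.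
    apply: (ler_pM (mulr_ge0 qm q2Q)); last by rewrite ler_pM2r.
      by apply: mulr_ge0 => //; exact: ltW.
    apply: (ler_pM qm q2Q) => //; exact: (ler_pM _ q12).
  have -> : expR m%:R * expR (4 * m%:R) * expR (19 / 40 * A) * (expR 1 * ep) =
      W0 * (expR m%:R * expR (4 * m%:R) * expR (19 / 40 * A) * expR 1 * expR (- A)).
    by rewrite /ep; clear; ring.
  rewrite /v -[leRHS]mulrA ler_pM2l //.
  rewrite -!expRD; apply: expR_quarter.
  have cN : 0 <= c * N by rewrite mulr_ge0 // ltW.
  have CN : 0 <= Cm * N by rewrite mulr_ge0 // ltW.
  have {}A1 : 2 * (5 * (Cm * N) + c * N + 3 * N) <= A.
    by apply: le_trans A1; rewrite /C1 le_eqVlt; apply/orP; left; apply/eqP; clear; ring.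
  have lin (t : R) : t <= Cm * N ->
      t + 4 * t + 19 / 40 * A + 1 - A + 2 <= - (c * N).
    by move: A1 N2 cN CN; generalize A (c * N) (Cm * N) => t2 t3 t4; clear; lra.
  exact: lin.
have mb := @mass_bound R e J a phi M aphi bphi a1 T pt nu f m (up_log 2 m) (level A)
  (fun i => 20 * g * (15 / 8) ^+ i) v ep _ _ nu0 f0 nuf _ (@up_logP 2 m isT) _ v0 J1 cond3 cond4 cond5 good.
have {}mb := mb (fun p => Ea _ (ptE p)) (fun p => hE' _ (ptE p)).
have small := @mass_small R e m (up_log 2 m) (\sum_p nu p) g
  (fun i => tube_energy e J f (level A i)) _ g0 _ (mb _ _).
have {small mb} : \sum_p nu p <= mass_const R e * m%:R * g.
  apply: small.
  - exact: sumr_ge0.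
  - by move=> i iI; have [_ _ h] := lev i iI; exact: h.
  - by move=> i; apply: mulr_gt0; [exact: mulr_gt0|apply: exprn_gt0; clear; lra].
  - by move=> i iI; have [-> l2 _] := lev i iI; rewrite (leq_trans l2).
apply/negP; rewrite -ltNge; apply: lt_le_trans Nu.
pose p : R := L `^ (kappa / 2).
have p0 : 0 < p by exact: powR_gt0.
have pP : P = p ^+ 2.
  have kE : kappa = kappa / 2 * 2%:R by clear; field.
  by rewrite /P [in LHS]kE powRrM powR_mulrn // ltW.
have La0 : 0 < L `^ alpha by exact: powR_gt0.
have pL : p <= L `^ alpha by apply: ler_powR.
have sA : Num.sqrt (A / 80) = s * N / (p * s80).
  have -> : A / 80 = (s * N / (p * s80)) ^+ 2.
    rewrite /A pP expr_div_n !exprMn /s80 sqr_sqrtr //.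
    by field; rewrite gt_eqF.
  by rewrite sqrtr_sqr ger0_norm // divr_ge0 // mulr_ge0 // ltW.
have gE : g = CF * (p * s80) / (s * N) / (L `^ alpha * q2).
  rewrite /g sA powRN powRM ?(ltW L0) //.
  by rewrite -/q2; field; rewrite !gt_eqF.
apply: le_lt_trans (_ : mass_const R e * (Cm * N) * g < _).
  by rewrite ler_pM2r // ler_pM2l.
have -> : mass_const R e * (Cm * N) * g = K5 / s * (p / L `^ alpha).
  by rewrite gE /K5; field; rewrite !gt_eqF.
apply: le_lt_trans (_ : K5 / s < _).
  by rewrite ler_piMr ?divr_ge0 ?(ltW K50) ?(ltW s0) // ler_pdivrMr // mul1r.
rewrite ltr_pdivrMr // /s mulrDr mulr1 mulrCA divff ?gt_eqF // mulr1.
by rewrite ltrDl.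
Qed.

End Core.

(** * Suprema in the extended reals, and the theorem *)

Section SupOn.
Variables (R : realType) (T : Type) (A : set T) (g : T -> R[i]).

Lemma sup_on_ub x : A x -> ((nc (g x))%:E <= sup_on A g)%E.
Proof. by move=> Ax; apply: ereal_sup_ubound; exists x. Qed.

Lemma sup_on_ge0 x : A x -> (0 <= sup_on A g)%E.
Proof. by move=> Ax; apply: le_trans (sup_on_ub Ax); rewrite lee_fin nc_ge0. Qed.

End SupOn.

Theorem proposition5p16 (R : realType) (d : nat) (alpha beta delta : R)
    (F : R -> R) (c : \bar R) :
  (2 <= d)%N -> 1 < alpha -> beta = 3 / 2 ->
  0 < delta -> delta < alpha - 1 ->
  log_gauge_extension d alpha beta F ->
  (0 < c)%E ->
  exists C eps0 : R, [/\ 0 < C, 0 < eps0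
    & forall (a : 'rV[R]_d) (B1 E : set 'rV[R]_d),
        is_eball B1 a 1 -> B1 0 ->
        compact E -> E `<=` B1 -> hausdorff_content F E = c ->
      forall phi : 'rV[R[i]]_d -> R[i],
        analytic_on (cdisc 0 10) phi ->
      forall eps : R, 0 < eps -> eps <= eps0 ->
        (sup_on B1 (fun x => phi (of_real_vec x)) <=
         eps%:E * sup_on (cdisc 0 10) phi +
         (expR (C * ln eps^-1 ^+ 2 /
                ln (ln eps^-1) `^ (2 * (alpha - 1 - delta) / 3)))%:E *
         sup_on E (fun x => phi (of_real_vec x)))%E].
Proof.
case: d => [//|e] d2 al1 -> dl0 dla gF c0.
set kappa := 2 * (alpha - 1 - delta) / 3.
have al0 : 0 <= alpha by lra.
have kal : kappa / 2 <= alpha by rewrite /kappa; lra.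
(* The content may be infinite, so a real number below it is used. *)
have [c' c'0 c'c] : exists2 c' : R, 0 < c' & (c'%:E < c)%E.
  case: c c0 => [r| |] //.
    by rewrite lte_fin => r0; exists (r / 2); rewrite ?lte_fin; lra.
  by move=> _; exists 1; rewrite ?ltry.
have [C [N0 [C0 N01 core]]] := smallness_contradiction al0 kal gF c'0.
exists C, (expR (- N0)); split => //; first exact: expR_gt0.
move=> a B1 E ballB B10 _ EB cE phi aphi eps eps0 epsN.
set N := ln eps^-1; set A := C * N ^+ 2 / ln N `^ kappa.
have Bx x : B1 x -> renorm (x - a) <= 1.
  by case: ballB => -> //=; exact: ltW.
have a1 : renorm a <= 1 by rewrite -renormN -sub0r; exact: Bx.
have NN : N0 <= N.
  by rewrite /N lnV ?posrE // -[N0]opprK lerN2 -[- N0]expRK ler_ln ?posrE ?expR_gt0.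
have epsE : eps = expR (- N) by rewrite /N lnV ?posrE // opprK lnK.
(* Otherwise the empty list of balls would give content 0. A point of E keeps the supremum over E
   from being -oo. *)
have [x0 Ex0] : exists x, E x.
  apply: contrapT => nE; have [gFg _ _] := gF.
  have := @hausdorff_content_le R e.+1 F gFg E [::] (fun _ h => ltac:(by [])).
  rewrite big_nil cE leNgt c0 => h; suff : false by [].
  by apply: h => x Ex; case: nE; exists x.
have cd0 : cdisc 0 10 (0 : 'rV[R[i]]_e.+1).
  rewrite /cdisc /= subr0 /cenorm big1 ?sqrtr0 // => i _.
  by rewrite mxE nc0 expr0n.
have sD0 := sup_on_ge0 phi cd0.
have sE0 := sup_on_ge0 (fun x => phi (of_real_vec x)) Ex0.
have bE x := @sup_on_ub R _ E (fun x => phi (of_real_vec x)) x.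
have bD z := @sup_on_ub R _ (cdisc 0 10) phi z.
rewrite leNgt; apply/negP => /ereal_sup_gt[_ [xs Bxs <-]].
have eA := expR_gt0 A.
(* If either supremum is infinite, so is the right-hand side, because both coefficients are
   positive. *)
move: sD0 bD; case: (sup_on (cdisc 0 10) phi) => [M| |] //; last first.
  move=> _ _; rewrite gt0_muley ?lte_fin // addye //.
  by rewrite -ltNye; apply: lt_le_trans (ltNyr 0) (mule_ge0 _ sE0); rewrite lee_fin ltW.
move: sE0 bE; case: (sup_on E _) => [S| |] //; last first.
  by move=> _ _ M0 _; rewrite gt0_muley ?lte_fin // addey.
rewrite !lee_fin => S0 bE M0 bD; rewrite -!EFinM -EFinD lte_fin => lt.
set W0 := nc (phi (of_real_vec xs)) in lt.
have epsM : 0 <= eps * M by rewrite mulr_ge0 // ltW.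
have AS : 0 <= expR A * S by rewrite mulr_ge0 // ltW.
have W00 : 0 < W0 by lra.
have {}bD z : cdisc 0 10 z -> nc (phi z) <= M by move/bD; rewrite lee_fin.
have MW : M <= W0 * expR N.
  by rewrite -ler_pdivrMr ?expR_gt0 // -expRN mulrC -epsE; lra.
have {}bE x : E x -> nc (phi (of_real_vec x)) <= W0 * expR (- A).
  move=> /bE; rewrite lee_fin => h; apply: le_trans h _.
  by rewrite expRN ler_pdivlMr // mulrC; lra.
have := core N NN a xs E phi M W0 aphi bD a1 (Bx _ Bxs) (fun x Ex => Bx _ (EB _ Ex))
  W00 MW (lexx _) bE.
by rewrite cE leNgt c'c.
Qed.
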